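(* Let $n\ge 1$, let $z\in\mathcal I(W_n)$, and let $m=|\mathrm{Neg}(z)|$ where $\mathrm{Neg}(z)=\{i\in[n]: z(i)=-i\}$. Then the poset $(\mathcal A(z)^{-1},<_A)$ has $\binom{m}{\lfloor m/2\rfloor}$ connected components. These components are in bijection with the perfect matchings in $\mathrm{Neg}(z)\sqcup -\mathrm{Neg}(z)$ that are noncrossing and symmetric with respect to negation. Moreover, each connected component of $(\mathcal A(z)^{-1},<_A)$ is isomorphic (as a poset) to $(\mathcal A(\zeta)^{-1},<_A)$ for some $\zeta\in\mathcal I(S_n)$.
   Context: Notation: $[n]=\{1,\dots,n\}$, $[\pm n]=\{\pm1,\dots,\pm n\}$. $W_n$ is the group of bijections $w:[\pm n]\to[\pm n]$ with $w(-i)=-w(i)$ (signed permutations); it is a Coxeter group with simple generators $t_0=(-1,1)$ and $t_i=(-i,-i-1)(i,i+1)$ for $i\in[n-1]$. $S_n$ is the symmetric group with simple generators $s_i=(i,i+1)$, $i\in[n-1]$. For a Coxeter system $(W,S)$ with length function $\ell$, the Demazure product $\circ$ is the unique associative product $W\times W\to W$ with $s\circ s=s$ for $s\in S$ and $u\circ v=uv$ whenever $\ell(uv)=\ell(u)+\ell(v)$. $\mathcal I(W)=\{w\in W:w=w^{-1}\}$. For $z\in\mathcal I(W)$, $\mathcal A(z)$ is the set of minimal-length elements of $\{w\in W:w^{-1}\circ w=z\}$ and $\mathcal A(z)^{-1}=\{w^{-1}:w\in\mathcal A(z)\}$. A word is a finite sequence of integers. Elements of $S_n$ and $W_n$ are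 identified with their one-line words $w_1w_2\cdots w_n$, $w_i=w(i)$. The relation $v\vartriangleleft_A w$ on $n$-letter words holds if $v$ and $w$ agree outside three consecutive positions, and in those positions $v$ has letters $c\,a\,b$ and $w$ has letters $b\,c\,a$, for some $a<b<c$. The relation $<_A$ is the transitive closure of $\vartriangleleft_A$. Connected components of a poset are the connected components of its Hasse diagram (equivalently of its comparability graph). For a set $X\subset[\pm n]$ with $X=-X$, a matching in $X$ is a set $M$ of pairwise disjoint 2-element subsets of $X$; it is perfect if every element of $X$ lies in some (unique) block, symmetric if $\{i,j\}\in M$ implies $\{-i,-j\}\in M$, and noncrossing if no two blocks $\{i,k\},\{j,l\}\in M$ have $i<j<k<l$. *)

(* Defs.v *)
From mathcomp Require Import all_boot all_order all_algebra all_fingroup.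
From mathcomp Require Import boolp.
From Stdlib Require Import Relation_Operators.

Set Implicit Arguments.
Unset Strict Implicit.
Unset Printing Implicit Defensive.

Import Order.TTheory GRing.Theory Num.Theory.

(* Permutations are composed right to left, (uv)(x) = u(v(x)), whereas
   MathComp's [u * v] applies u first.  All products below are taken with
   respect to [comp_mul], so that a finGroupType of permutations carries the
   Coxeter group structure with functional composition. *)
Definition comp_mul (gT : finGroupType) (u v : gT) : gT := (v * u)%g.

Section Coxeter.

Variables (gT : finGroupType) (S : {set gT}).

(* The least k such that w is a product of k elements of S ([S ^+ k] is the set
   of all such products, a set that does not depend on the order convention).
   When S consists of involutions generating gT such a k exists below #|gT|. *)
Definition cox_length (w : gT) : nat :=
  find (fun k => w \in (S ^+ k)%g) (iota 0 #|gT|).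

Definition is_demazure_product (op : gT -> gT -> gT) : Prop :=
  [/\ associative op,
      forall s, s \in S -> op s s = s &
      forall u v,
        cox_length (comp_mul u v) = (cox_length u + cox_length v)%N ->
        op u v = comp_mul u v].

(* The unique operation satisfying [is_demazure_product]; the default value is
   irrelevant, since such an operation exists for every finite Coxeter system. *)
Definition demazure : gT -> gT -> gT :=
  if [pick op : {ffun gT -> {ffun gT -> gT}}
        | `[< is_demazure_product (fun u v => op u v) >]] is Some op
  then fun u v => op u v
  else @comp_mul gT.

Definition atoms (z : gT) : {set gT} :=
  [set w | (demazure w^-1%g w == z) &&
     [forall u, (demazure u^-1%g u == z) ==> (cox_length w <= cox_length u)%N]].

Definition atoms_inv (z : gT) : {set gT} := [set w^-1%g | w in atoms z].

End Coxeter.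

Definition triA (v w : seq int) : Prop :=
  exists (p q : seq int) (a b c : int),
    [/\ (a < b < c)%R,
        v = p ++ [:: c; a; b] ++ q &
        w = p ++ [:: b; c; a] ++ q].

Definition ltA (v w : seq int) : bool := `[< clos_trans (seq int) triA v w >].

Section Poset.

Variables (T : finType) (lt : rel T) (X : {set T}).

Definition covers (x y : T) : bool :=
  lt x y && [forall u in X, ~~ (lt x u && lt u y)].

Definition hasse : rel T :=
  fun x y => [&& x \in X, y \in X & covers x y || covers y x].

Definition components : {set {set T}} :=
  equivalence_partition (connect hasse) X.

End Poset.

Definition poset_iso (T U : finType) (ltT : rel T) (X : {set T})
    (ltU : rel U) (Y : {set U}) : Prop :=
  exists f : T -> U,
    [/\ {in X &, injective f}, f @: X = Y &
        {in X &, forall x y, ltU (f x) (f y) = ltT x y}].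

Definition set_bijection (T U : finType) (X : {set T}) (Y : {set U}) : Prop :=
  exists f : T -> U, {in X &, injective f} /\ f @: X = Y.

Section Symmetric.

Variable n : nat.

Definition S_gens : {set 'S_n} :=
  [set s | [exists i : 'I_n, exists j : 'I_n,
              (j == i.+1 :> nat) && (s == tperm i j)]].

Definition S_word (w : 'S_n) : seq int := [seq Posz (w i).+1 | i : 'I_n].

Definition S_lt : rel 'S_n := fun v w => ltA (S_word v) (S_word w).

End Symmetric.

Section Signed.

Variable n : nat.

(* The index set {-n, ..., -1, 1, ..., n}: (false, i) stands for i + 1 and
   (true, i) for -(i + 1). *)
Definition pm : finType := (bool * 'I_n)%type.

Definition pm_val (x : pm) : int :=
  if x.1 then (- Posz x.2.+1)%R else Posz x.2.+1.

Definition pm_opp (x : pm) : pm := (~~ x.1, x.2).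

Definition signed_perms : {set {perm pm}} :=
  [set w : {perm pm} | [forall x, w (pm_opp x) == pm_opp (w x)]].

Lemma signed_perms_group_set : group_set signed_perms.
Proof.
apply/group_setP; split; first by rewrite inE; apply/forallP=> x; rewrite !perm1.
move=> u v; rewrite !inE => /forallP hu /forallP hv; apply/forallP=> x.
by rewrite !permM (eqP (hu x)) (eqP (hv _)).
Qed.

Canonical signed_perms_group := Group signed_perms_group_set.

Definition W : finGroupType := [subg signed_perms_group].

Definition W_fun (w : W) : pm -> pm := sgval w.

Definition W_gens : {set W} :=
  [set t : W |
     [exists i : 'I_n, (i == 0 :> nat) &&
        (sgval t == tperm (true, i) (false, i))]
  || [exists i : 'I_n, exists j : 'I_n, (j == i.+1 :> nat) &&
        (sgval t == (tperm (true, i) (true, j) *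
                     tperm (false, i) (false, j))%g)]].

Definition W_word (w : W) : seq int :=
  [seq pm_val (W_fun w (false, i)) | i : 'I_n].

Definition W_lt : rel W := fun v w => ltA (W_word v) (W_word w).

Definition Neg (z : W) : {set pm} :=
  [set x : pm | ~~ x.1 && (W_fun z x == pm_opp x)].

Definition matching (X : {set pm}) (M : {set {set pm}}) : bool :=
  [forall B in M, (B \subset X) && (#|B| == 2)] && trivIset M.

Definition perfect (X : {set pm}) (M : {set {set pm}}) : bool :=
  cover M == X.

Definition symmetric_matching (M : {set {set pm}}) : bool :=
  [forall B in M, (pm_opp @: B) \in M].

Definition noncrossing (M : {set {set pm}}) : bool :=
  ~~ [exists i : pm, exists j : pm, exists k : pm, exists l : pm,
        [&& [set i; k] \in M, [set j; l] \in M,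
            (pm_val i < pm_val j)%R, (pm_val j < pm_val k)%R &
            (pm_val k < pm_val l)%R]].

Definition ncsp_matchings (X : {set pm}) : {set {set {set pm}}} :=
  [set M | [&& matching X M, perfect X M, symmetric_matching M
             & noncrossing M]].

End Signed.

(* Main.v *)
(** Let [z] be an involution of [W_n].  Stripping a left descent [s] from an inverse
    atom [v] of [z] gives an inverse atom of the involution [y < z] with
    [s o y o s = z], and conversely, because the lengths of atoms are governed by a
    rank function on involutions.  This recursion is solved explicitly on one-line
    words.  In type A, [v] is an inverse atom of [f] iff each 2-cycle [a < b] occurs
    as [b ... a] with no value of [(a, b)] in between, and cycles [a <= b],
    [a' <= b'] with [a < a'], [b < b'] have [a] before [b'].  In type B, [v] is an
    inverse atom of [z] iff for some symmetric noncrossing perfect matching [pi] of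
    [Neg z] and its opposite, the letters [x] of [v] are the left endpoints of the
    blocks of [pi] together with the points with [0 < x + z x] outside [Neg z], and
    [v] satisfies the type A condition for the involution of its letters given by
    [x |-> - pi x] on the former and [z] on the latter.

    The letters of [v] determine [pi], and [<_A] preserves letters, while any two
    words satisfying the type A condition for the same involution are linked by
    moves [b c a -> c a b]: with [a] the least letter and [b] its partner, [b a] is
    a factor which these moves bring to the front.  So components correspond to
    matchings, and relabelling the letters of a component by their ranks turns it
    into the inverse atoms of an involution of [S_n].  A matching is recorded by the
    signs of the letters in [Neg z], a sequence all of whose suffixes have at least
    as many minus as plus signs; there are ['C(m, m./2)] of them. *)

(* The steps of the recursion in type B can be chosen so that the word is hardly touched. If [v] has
   a negative letter, let [- k] be the one of least absolute value. For [k > 1] the letter [k - 1]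
   occurs in [v], and [t_(k-1)] is a descent that preserves the relative order of all letters,
   because neither [k] nor [- (k - 1)] is a letter; for [k = 1] the same holds of [t_0]. Such a step
   merely relabels the word, and everything else happens in [z] and the matching: the matching is
   conjugated, or it loses the blocks on which the generator acts. A word of positive letters leaves
   no room for negated points, and there the recursion of type A takes over.

   The rank function on involutions is a multiple of length plus a statistic: the number of moved
   points in [S_n], and the number of moved points plus the number of negated points in [W_n].

   With MathComp's product, [w * s] applies [s] to the values of the one-line word of [w]; stripping
   a left descent in functional notation is therefore right multiplication in the code. *)
Require Import Defs.
From mathcomp Require Import all_boot all_order all_algebra all_fingroup.
From mathcomp Require Import boolp zify.
From Stdlib Require Import Relation_Operators.

Set Implicit Arguments.
Unset Strict Implicit.
Unset Printing Implicit Defensive.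

Import Order.TTheory GRing.Theory Num.Theory.

(** * Inverse atoms of type A *)

Section AtomOrder.
Local Open Scope ring_scope.

Definition invol_on (L : pred int) (f : int -> int) : Prop :=
  forall x, L x -> L (f x) /\ f (f x) = x.

(* [p x] stands for the position of the letter [x] in a word with letter set [L]. *)
Definition atom_order (L : pred int) (f : int -> int) (p : int -> nat) : Prop :=
  [/\ forall x, L x -> x < f x -> (p (f x) < p x)%N,
      forall x e, L x -> L e -> x < e -> e < f x ->
        ~ ((p (f x) < p e)%N /\ (p e < p x)%N) &
      forall x y, L x -> L y -> x <= f x -> f y <= y -> x < f y -> f x < y ->
        (p x < p y)%N].

(** Only the values on [L] are constrained, so that [swap_int i] qualifies and so does [swap_abs i]
    when all letters are positive. *)
Definition swap_on (L : pred int) (i : int) (s : int -> int) : Prop :=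
  forall x, L x ->
    [\/ x = i /\ s x = i + 1, x = i + 1 /\ s x = i |
        [/\ x <> i, x <> i + 1 & s x = x]].

Variables (L : pred int) (i : int) (s f f' : int -> int) (p : int -> nat).
Hypotheses (fL : invol_on L f) (Li : L i) (Li1 : L (i + 1)).
Hypothesis (sP : swap_on L i s).
Hypothesis (pinj : forall x y, L x -> L y -> p x = p y -> x = y).
Hypothesis (p_desc : (p (i + 1) < p i)%N).

Let si : s i = i + 1. Proof. by case: (sP Li) => [[]|[]|[]]; lia. Qed.
Let si1 : s (i + 1) = i. Proof. by case: (sP Li1) => [[]|[]|[]]; lia. Qed.
Let sL x : L x -> L (s x).
Proof. by move=> Lx; case: (sP Lx) => [[_ ->]|[_ ->]|[_ _ ->]]. Qed.
Let ss x : L x -> s (s x) = x.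
Proof. by move=> Lx; case: (sP Lx) => [[-> _]|[-> _]|[_ _ e]]; rewrite ?si ?si1 ?e. Qed.
Let finj x y : L x -> L y -> f x = f y -> x = y.
Proof. by move=> Lx Ly e; rewrite -(fL Lx).2 e (fL Ly).2. Qed.
Let fLL x : L x -> L (f x). Proof. by case/fL. Qed.
Let ff x : L x -> f (f x) = x. Proof. by case/fL. Qed.
Let pneq x y : L x -> L y -> x <> y -> p x <> p y.
Proof. by move=> Lx Ly nxy /(pinj Lx Ly). Qed.

(** If [f i < f (i + 1)], the cycle of [i] is below that of [i + 1] in both coordinates, so all of
    it stands before the latter, against [p_desc]. *)
Lemma atom_order_descent : atom_order L f p -> f (i + 1) < f i.
Proof.
case=> A1 _ A2.
have Lfi := fLL Li; have Lfi1 := fLL Li1.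
have ne : f i <> f (i + 1) by move/(finj Li Li1); lia.
have := A1 _ Li; have := A1 _ Li1; have := A1 _ Lfi; have := A1 _ Lfi1.
have := A2 _ _ Li Li1; have := A2 _ _ Li Lfi1; have := A2 _ _ Lfi Li1.
have := A2 _ _ Lfi Lfi1.
rewrite !ff //; lia.
Qed.

Let slt x y : L x -> L y ->
  (s x < s y) <-> (x = i + 1 /\ y = i) \/ (x < y /\ ~ (x = i /\ y = i + 1)).
Proof.
by move=> Lx Ly; case: (sP Lx) (sP Ly) => [[? ?]|[? ?]|[? ? ?]] [[? ?]|[? ?]|[? ? ?]];
  subst; lia.
Qed.
Let sle x y : L x -> L y ->
  (s x <= s y) <-> (x = i + 1 /\ y = i) \/ (x <= y /\ ~ (x = i /\ y = i + 1)).
Proof.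
by move=> Lx Ly; case: (sP Lx) (sP Ly) => [[? ?]|[? ?]|[? ? ?]] [[? ?]|[? ?]|[? ? ?]];
  subst; lia.
Qed.

(** Conjugation by [s] alters only comparisons between [i] and [i + 1]. All instances of the
    conditions that avoid such a comparison transfer verbatim; the few exceptional ones are settled
    by the descent in [p] together with that in [f]. *)
Lemma atom_order_swap_conj :
    f i <> i + 1 -> ~ (f i = i /\ f (i + 1) = i + 1) ->
    (forall x, L x -> f' (s x) = s (f x)) ->
  atom_order L f p <-> f (i + 1) < f i /\ atom_order L f' (p \o s).
Proof.
move=> nij nfix f'E.
have Lfi := fLL Li; have Lfi1 := fLL Li1.
have n1 : f (i + 1) <> i by move=> /(congr1 f); rewrite ff // => /esym.
have fxi x : L x -> f x = i -> x = f i by move=> Lx /(congr1 f); rewrite ff.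
have fxi1 x : L x -> f x = i + 1 -> x = f (i + 1) by move=> Lx /(congr1 f); rewrite ff.
have to_s (Q : int -> Prop) : (forall x, L x -> Q (s x)) -> forall x, L x -> Q x.
  by move=> QP x Lx; rewrite -[x]ss //; apply/QP/sL.
have nii1 x : L x -> ~ (x = i /\ f x = i + 1) /\ ~ (x = i + 1 /\ f x = i).
  by move=> Lx; split=> -[-> ]; lia.
(* Since [f] does not exchange [i] and [i + 1], no cycle changes its orientation. *)
have sltf x : L x -> (s x < s (f x)) = (x < f x).
  move=> Lx; have := nii1 _ Lx; have := slt Lx (fLL Lx).
  by case: (_ < _); case: (_ < _); lia.
have slef x : L x -> (s x <= s (f x)) = (x <= f x).
  move=> Lx; have := nii1 _ Lx; have := sle Lx (fLL Lx).
  by case: (_ <= _); case: (_ <= _); lia.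
have sgef x : L x -> (s (f x) <= s x) = (f x <= x).
  by move=> Lx; have := slef _ (fLL Lx); rewrite ff.
split=> [A|[D [B1 Be B2]]].
  have D := atom_order_descent A.
  have [A1 Ae A2] := A; split=> //; split=> /=.
  - apply: (to_s) => x Lx; have Lfx := fLL Lx.
    rewrite f'E // !ss // => /slt-/(_ Lx Lfx) [[xE yE]|[xy _]]; last exact: A1.
    by move: (fxi _ Lx yE); lia.
  - move=> x e Lx Le; move: x Lx e Le.
    apply: (to_s) => x Lx; apply: (to_s) => e Le; have Lfx := fLL Lx.
    rewrite f'E // !ss // => /slt-/(_ Lx Le) + /slt-/(_ Le Lfx).
    move=> [[xE eE]|[xe nxe]] [[eE' fE]|[ef nef]]; try (subst; lia); exact: Ae.
  - move=> x y Lx Ly; move: x Lx y Ly.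
    apply: (to_s) => x Lx; apply: (to_s) => y Ly; have Lfx := fLL Lx; have Lfy := fLL Ly.
    rewrite !f'E // !ss // slef // sgef // => xf fy.
    move=> /slt-/(_ Lx Lfy) [[xE fyE]|[xfy _]] /slt-/(_ Lfx Ly) [[fxE yE]|[fxy _]]; last exact: A2.
      by rewrite xE yE.
    (* Unless [f i = i], the value [i + 1] lies between [i] and [f i]; it precedes [i], so [Ae]
       forces it to precede [f i] too. The next case is symmetric. *)
    + rewrite (fxi _ Ly fyE) xE in xf fy *.
      have := A1 _ Li; have := Ae _ _ Li Li1; have := pneq Li1 Lfi.
      rewrite !ff // in fy *; by have [->|] := eqVneq (f i) i; lia.
    + rewrite (fxi1 _ Lx fxE) yE in xf fy *.
      have := A1 _ Lfi1; have := Ae _ _ Lfi1 Li; have := pneq Li Lfi1.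
      rewrite !ff // in xf *; by have [->|] := eqVneq (f (i + 1)) (i + 1); lia.
- have C1 x : L x -> s x < s (f x) -> (p (f x) < p x)%N.
    by move=> Lx; have := B1 _ (sL Lx); rewrite /= f'E // !ss //; apply: fLL.
  have Ce x e : L x -> L e -> s x < s e -> s e < s (f x) ->
      ~ ((p (f x) < p e)%N /\ (p e < p x)%N).
    by move=> Lx Le; have := Be _ _ (sL Lx) (sL Le); rewrite /= f'E // !ss //; apply: fLL.
  have C2 x y : L x -> L y -> s x <= s (f x) -> s (f y) <= s y ->
      s x < s (f y) -> s (f x) < s y -> (p x < p y)%N.
    by move=> Lx Ly; have := B2 _ _ (sL Lx) (sL Ly); rewrite /= !f'E // !ss //; apply: fLL.
  have h1 : s (f (i + 1)) < s (f i) by apply/slt => //; right; split=> //; lia.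
  have h2 : s (i + 1) < s i by rewrite si si1; lia.
  (* Settles the instance [x = i], [e = i + 1] of the betweenness condition, one of the two whose
     comparisons [s] reverses. *)
  have Di : i <= f i -> (p (i + 1) < p (f i))%N.
    move=> ifi; have [le|lt] := leP (i + 1) (f (i + 1)).
      by apply: C2; rewrite ?slef ?sgef // ?ff.
    apply: (@ltn_trans (p (f (i + 1)))).
      by have := C1 _ Lfi1; rewrite ff //; apply; have := sltf _ Lfi1; rewrite ff // => ->.
    have n2 : s (f (i + 1)) < s i by apply/slt => //; right; split=> //; lia.
    have n3 : s (i + 1) < s (f i) by apply/slt => //; lia.
    by apply: C2; rewrite ?slef ?sgef // ?ff //; lia.
  split.
  - by move=> x Lx xf; apply: C1 => //; rewrite sltf.
  - move=> x e Lx Le xe ef; have Lfx := fLL Lx.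
    have [[xE eE]|nxe] : (x = i /\ e = i + 1) \/ ~ (x = i /\ e = i + 1) by lia.
      by rewrite xE eE in ef *; have := Di; lia.
    have [[eE fE]|nef] : (e = i /\ f x = i + 1) \/ ~ (e = i /\ f x = i + 1) by lia.
      rewrite (fxi1 _ Lx fE) eE in xe ef *; rewrite ff //.
      have [le|lt] := leP i (f i).
        suff : (p (f (i + 1)) < p (f i))%N.
          by have := C1 _ Li; rewrite sltf //; have [<-|] := eqVneq i (f i); lia.
        by apply: C2; rewrite ?slef ?sgef // ?ff //; [lia|apply/slt => //; lia..].
      suff : (p (f (i + 1)) < p i)%N by lia.
      by apply: C2; rewrite ?slef ?sgef // ?ff //; lia.
    by apply: Ce => //; apply/slt => //; right.
  - move=> x y Lx Ly xf fy xfy fxy; have Lfx := fLL Lx; have Lfy := fLL Ly.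
    apply: C2; rewrite ?slef ?sgef //; apply/slt => //; right; split=> // -[E1 E2].
      by have := fxi1 _ Ly E2 ; rewrite E1 in fxy; lia.
    by have := fxi _ Lx E1; rewrite E2 in xfy; lia.
Qed.

(** A 2-cycle [i < i + 1], read as [i + 1 ... i], becomes after the swap two fixed points in
    increasing order. No integer separates [i] from [i + 1], so against any other letter the cycle
    and the two fixed points impose the same conditions. *)
Lemma atom_order_swap_comm :
    f i = i + 1 ->
    (forall x, L x -> x <> i -> x <> i + 1 -> f' x = f x) ->
    f' i = i -> f' (i + 1) = i + 1 ->
  atom_order L f p <-> atom_order L f' (p \o s).
Proof.
move=> fi f'E f'i f'i1.
have fi1 : f (i + 1) = i by rewrite -fi ff.
have fN x : L x -> x <> i -> x <> i + 1 -> f x <> i /\ f x <> i + 1.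
  by move=> Lx x1 x2; split=> /(congr1 f); rewrite ff // ?fi ?fi1.
have sN x : L x -> x <> i -> x <> i + 1 -> s x = x.
  by move=> Lx x1 x2; case: (sP Lx) => [[]|[]|[]].
split=> -[A1 Ae A2]; split=> /=.
- move=> x Lx; have [->|x1] := eqVneq x i; first by rewrite f'i; lia.
  have [->|x2] := eqVneq x (i + 1); first by rewrite f'i1; lia.
  move/eqP in x1; move/eqP in x2; have [? ?] := fN _ Lx x1 x2.
  by rewrite f'E // !sN //; [apply: A1|apply: fLL].
- move=> x e Lx Le; have [->|x1] := eqVneq x i; first by rewrite f'i; lia.
  have [->|x2] := eqVneq x (i + 1); first by rewrite f'i1; lia.
  move/eqP in x1; move/eqP in x2; have [? ?] := fN _ Lx x1 x2.
  rewrite f'E // (sN x) // (sN (f x)) //; last exact: fLL.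
  case: (sP Le) => [[-> ->]|[-> ->]|[e1 e2 ->]] xe ef; apply: Ae => //; lia.
- move=> x y Lx Ly.
  have [[yi y_in]|[ni1 ni2]] : (s y = i \/ s y = i + 1) /\ (y = i \/ y = i + 1)
      \/ (y <> i /\ y <> i + 1).
    by case: (sP Ly) => [[-> ->]|[-> ->]|[? ? _]];
      [left|left|right]; split=> //; [right|left|left|right].
    have -> : f' y = y by case: y_in => ->.
    have [[xi x_in]|[mi1 mi2]] : (s x = i \/ s x = i + 1) /\ (x = i \/ x = i + 1)
        \/ (x <> i /\ x <> i + 1).
      by case: (sP Lx) => [[-> ->]|[-> ->]|[? ? _]];
      [left|left|right]; split=> //; [right|left|left|right].
      have -> : f' x = x by case: x_in => ->.
      have sxy : x < y -> x = i /\ y = i + 1 by lia.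
      by move=> _ _ /sxy [-> ->] _; rewrite si si1.
    have [? ?] := fN _ Lx mi1 mi2.
    rewrite f'E // (sN x) // => xf _ xy fxy.
    have : (p x < p (i + 1))%N by apply: A2 => //; rewrite ?fi1; lia.
    by case: yi => ->; lia.
  have [? ?] := fN _ Ly ni1 ni2.
  rewrite (f'E y) // (sN y) //.
  have [[xi x_in]|[mi1 mi2]] : (s x = i \/ s x = i + 1) /\ (x = i \/ x = i + 1)
      \/ (x <> i /\ x <> i + 1).
    by case: (sP Lx) => [[-> ->]|[-> ->]|[? ? _]];
      [left|left|right]; split=> //; [right|left|left|right].
    have -> : f' x = x by case: x_in => ->.
    move=> _ fy xf xy.
    have : (p i < p y)%N by apply: A2 => //; rewrite ?fi; lia.
    by case: xi => ->; lia.
  by rewrite f'E // (sN x) //; apply: A2.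
- move=> x Lx; have [->|x1] := eqVneq x i; first by rewrite fi.
  have [->|x2] := eqVneq x (i + 1); first by rewrite fi1; lia.
  move/eqP in x1; move/eqP in x2; have [? ?] := fN _ Lx x1 x2.
  by have /= := A1 _ Lx; rewrite f'E // !sN //; apply: fLL.
- move=> x e Lx Le; have [->|x1] := eqVneq x i; first by rewrite fi; lia.
  have [->|x2] := eqVneq x (i + 1); first by rewrite fi1; lia.
  move/eqP in x1; move/eqP in x2; have [? ?] := fN _ Lx x1 x2.
  have /= := Ae _ _ Lx (sL Le).
  rewrite f'E // ss // (sN x) // (sN (f x)) //; last exact: fLL.
  by case: (sP Le) => [[-> ->]|[-> ->]|[e1 e2 ->]] + xe ef; apply => //; lia.
- move=> x y Lx Ly; have [->|x2] := eqVneq x (i + 1); first by rewrite fi1; lia.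
  have [->|y1] := eqVneq y i; first by rewrite fi; lia.
  move/eqP in x2; move/eqP in y1.
  have [->|/eqP x1] := eqVneq x i.
    have [->|/eqP y2] := eqVneq y (i + 1); first by rewrite fi1; lia.
    have [? ?] := fN _ Ly y1 y2.
    have /= := A2 _ _ Li1 Ly; rewrite si1 (sN y) // (f'E y) // f'i1 fi.
    by move=> + _ fy iy yi; apply=> //; lia.
  have [? ?] := fN _ Lx x1 x2.
  have [->|/eqP y2] := eqVneq y (i + 1).
    have /= := A2 _ _ Lx Li; rewrite si (sN x) // (f'E x) // f'i fi1.
    by move=> + xf _ xy fxy; apply=> //; lia.
  have [? ?] := fN _ Ly y1 y2.
  by have /= := A2 _ _ Lx Ly; rewrite !f'E // !sN.
Qed.

End AtomOrder.

(** * The type A condition on words *)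

Section AtomWord.
Local Open Scope ring_scope.

Definition atom_word (f : int -> int) (v : seq int) : Prop :=
  [/\ uniq v, invol_on (fun x => x \in v) f &
      atom_order (fun x => x \in v) f (index^~ v)].

Lemma index_map_in (T1 T2 : eqType) (h : T1 -> T2) (v : seq T1) x :
  {in v &, injective h} -> x \in v -> index (h x) (map h v) = index x v.
Proof.
elim: v => //= y v IH inj xv; have [->|nyx] := eqVneq y x; first by rewrite eqxx.
have -> : (h y == h x) = false.
  by apply/negP => /eqP/inj; rewrite mem_head => /(_ isT xv) e; rewrite e eqxx in nyx.
rewrite IH //; last by move: xv; rewrite inE eq_sym (negPf nyx).
by move=> a b av bv; apply: inj; rewrite inE ?av ?bv orbT.
Qed.

Lemma atom_order_ext (L L' : pred int) f f' p p' :
    L =1 L' -> (forall x, L x -> f' x = f x) -> (forall x, L x -> p' x = p x) ->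
    (forall x, L x -> L (f x)) ->
  atom_order L f p -> atom_order L' f' p'.
Proof.
move=> eL ef ep fL [A1 Ae A2]; split.
- by move=> x; rewrite -eL => Lx; rewrite ef // !ep //; [apply: A1 | apply: fL].
- move=> x e; rewrite -!eL => Lx Le; rewrite ef // !ep //; [exact: Ae|exact: fL].
- by move=> x y; rewrite -!eL => Lx Ly; rewrite !ef // !ep //; apply: A2.
Qed.

Lemma eq_atom_word f f' v :
  {in v, f =1 f'} -> atom_word f v -> atom_word f' v.
Proof.
move=> e [uv fv A]; split=> //.
  by move=> x xv; have [? ?] := fv _ xv; rewrite -e // -e.
apply: atom_order_ext A => // x xv; first by rewrite e.
by case: (fv _ xv).
Qed.

(** Only the relative order of the letters enters the condition. This serves both the
    standardization of components and the steps of type B, whose generators are increasing on the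
    letters. *)
Lemma atom_word_map (f f' h : int -> int) (v : seq int) :
    {in v &, {mono h : x y / x < y}} -> {in v, forall x, f x \in v} ->
    {in v, forall x, f' (h x) = h (f x)} ->
  atom_word f v <-> atom_word f' (map h v).
Proof.
move=> hlt fv f'h.
have hinj : {in v &, injective h}.
  move=> x y xv yv e; have := hlt _ _ xv yv; have := hlt _ _ yv xv.
  by rewrite e ltxx; lia.
have hle : {in v &, {mono h : x y / x <= y}}.
  by move=> x y xv yv; rewrite !leNgt hlt.
have hidx x : x \in v -> index (h x) (map h v) = index x v.
  exact: index_map_in.
rewrite /atom_word (map_inj_in_uniq hinj).
split=> -[uv I [A1 Ae A2]]; split=> //.
- move=> _ /mapP [x xv ->]; have [fxv ffx] := I _ xv.
  by rewrite f'h // f'h // ffx; split=> //; apply: map_f.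
- split.
  + by move=> _ /mapP [x xv ->]; rewrite f'h // hlt ?fv // !hidx ?fv //; apply: A1.
  + move=> _ _ /mapP [x xv ->] /mapP [e ev ->].
    by rewrite f'h // !hlt ?fv // !hidx ?fv //; apply: Ae.
  + move=> _ _ /mapP [x xv ->] /mapP [y yv ->].
    by rewrite !f'h // !hlt ?fv // !hle ?fv // !hidx ?fv //; apply: A2.
- move=> x xv; split; first exact: fv.
  have [_] := I _ (map_f h xv); rewrite f'h // f'h ?fv // => /hinj.
  by apply; rewrite ?fv // fv.
- split.
  + by move=> x xv; have := A1 _ (map_f h xv); rewrite f'h // hlt ?fv // !hidx ?fv.
  + move=> x e xv ev; have := Ae _ _ (map_f h xv) (map_f h ev).
    by rewrite f'h // !hlt ?fv // !hidx ?fv.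
  + move=> x y xv yv; have := A2 _ _ (map_f h xv) (map_f h yv).
    by rewrite !f'h // !hlt ?fv // !hle ?fv // !hidx ?fv.
Qed.

(** Applying [s] to the letters of [v] amounts to precomposing the position function with [s], which
    brings the two preceding swap lemmas to words. *)
Lemma atom_word_swap (f f' s : int -> int) (i : int) (v : seq int) :
    uniq v -> invol_on (fun x => x \in v) f -> i \in v -> i + 1 \in v ->
    swap_on (fun x => x \in v) i s -> (index (i + 1)%R v < index i v)%N ->
    f (i + 1) < f i ->
    (f i = i + 1 -> [/\ f' i = i, f' (i + 1) = i + 1 &
       forall x, x \in v -> x <> i -> x <> i + 1 -> f' x = f x]) ->
    (f i <> i + 1 -> forall x, x \in v -> f' (s x) = s (f x)) ->
  atom_word f v <-> atom_word f' (map s v).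
Proof.
move=> uv fv iv iv1 sP vd fd fc fn.
have pinj x y : x \in v -> y \in v -> index x v = index y v -> x = y.
  by move=> xv yv; apply: index_inj.
have si : s i = i + 1 by case: (sP _ iv) => [[]|[]|[]]; lia.
have si1 : s (i + 1) = i by case: (sP _ iv1) => [[]|[]|[]]; lia.
have sv x : x \in v -> s x \in v.
  by move=> xv; case: (sP _ xv) => [[_ ->]|[_ ->]|[_ _ ->]].
have ss x : x \in v -> s (s x) = x.
  by move=> xv; case: (sP _ xv) => [[-> _]|[-> _]|[_ _ e]]; rewrite ?si ?si1 ?e.
have sinj : {in v &, injective s}.
  by move=> x y xv yv e; rewrite -[x]ss // e ss.
have svE : (fun x => x \in map s v) =1 (fun x => x \in v).
  move=> x; apply/mapP/idP => [[y yv ->]|xv]; first exact: sv.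
  by exists (s x); rewrite ?sv ?ss.
have sidx x : x \in v -> index x (map s v) = index (s x) v.
  by move=> xv; rewrite -{1}[x]ss // index_map_in // sv.
have f'v : invol_on (fun x => x \in v) f'.
  have [fi|fi] := eqVneq (f i) (i + 1).
    have [f'i f'i1 f'E] := fc fi; move=> x xv.
    have [->|/eqP x1] := eqVneq x i; first by rewrite !f'i.
    have [->|/eqP x2] := eqVneq x (i + 1); first by rewrite !f'i1.
    have [fxv ffx] := fv _ xv; rewrite f'E // f'E //; move=> e.
      by move: ffx; rewrite e fi => /esym.
    by apply: x1; rewrite -ffx e -fi (fv _ iv).2.
  move/eqP in fi; move=> x xv; have [fxv ffx] := fv _ (sv _ xv).
  have e : f' x = s (f (s x)) by rewrite -(fn fi) ?sv // ss.
  by rewrite e (fn fi) // ffx ss // sv.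
have E' : atom_word f' (map s v) <->
          atom_order (fun x => x \in v) f' (fun x => index (s x) v).
  rewrite /atom_word (map_inj_in_uniq sinj) uv; split=> [[_ I A]|A].
    apply: atom_order_ext A => [y|y|y|y]; rewrite ?svE // => yv; first by rewrite sidx.
    by have [] := f'v _ yv.
  split=> //; first by move=> x; rewrite !svE => xv; apply: f'v.
  apply: atom_order_ext A => [y|y|y|y]; rewrite ?svE // => yv; first exact: sidx.
  by case: (f'v _ yv).
have E : atom_word f v <-> atom_order (fun x => x \in v) f (index^~ v).
  by split=> [[]|A].
apply: (iff_trans E); apply: iff_trans (iff_sym E').
have [fi|/eqP fi] := eqVneq (f i) (i + 1).
  have [f'i f'i1 f'E] := fc fi.
  exact: (atom_order_swap_comm fv iv iv1 sP vd fi f'E f'i f'i1).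
have nfix : ~ (f i = i /\ f (i + 1) = i + 1) by lia.
apply: (iff_trans (atom_order_swap_conj fv iv iv1 sP pinj vd fi nfix (fn fi))).
by split=> [[]|].
Qed.

(** With its converse below, the base of the recursion: an increasing word leaves no place for a
    pair [b ... a] with [a < b]. *)
Lemma atom_word_sorted (f : int -> int) (v : seq int) :
    (forall x y, x \in v -> y \in v -> x < y -> (index x v < index y v)%N) ->
  atom_word f v -> {in v, forall x, f x = x}.
Proof.
move=> vs [uv fv [A1 _ _]] x xv; have [fxv ffx] := fv _ xv.
case: (ltgtP x (f x)) => // lt.
  by have := A1 _ xv lt; have := vs _ _ xv fxv lt; lia.
by have := A1 _ fxv; rewrite ffx => /(_ lt); have := vs _ _ fxv xv lt; lia.
Qed.

Lemma atom_word_id (f : int -> int) (v : seq int) :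
    (forall x y, x \in v -> y \in v -> x < y -> (index x v < index y v)%N) ->
    uniq v -> {in v, forall x, f x = x} ->
  atom_word f v.
Proof.
move=> vs uv fv; split=> //; first by move=> x xv; rewrite !fv.
split.
- by move=> x xv; rewrite fv // ltxx.
- by move=> x e xv ev; rewrite fv //; lia.
- by move=> x y xv yv; rewrite !fv // => _ _ xy _; apply: vs.
Qed.

End AtomWord.

(** * Connectivity under the moves, and existence of words *)

Section Connectivity.
Local Open Scope ring_scope.
Implicit Types (f : int -> int) (v u t : seq int) (a : int).

Definition cycle_word f a : seq int := if f a == a then [:: a] else [:: f a; a].

Definition atom_move f v w := [/\ triA v w, atom_word f v & atom_word f w].

Definition atom_conn f := clos_refl_sym_trans (seq int) (atom_move f).

Lemma triA_perm (v w : seq int) : triA v w -> perm_eq v w.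
Proof.
case=> p [q [i [j [k [_ -> ->]]]]]; rewrite perm_cat2l perm_cat2r.
by apply/seq.permP => z /=; lia.
Qed.

Lemma atom_conn_word f (x y : seq int) : atom_conn f x y ->
  (atom_word f x <-> atom_word f y) /\ perm_eq x y.
Proof.
elim=> {x y} [x y [xy xf yf]|x|x y _ [e p]|x y w _ [e1 p1] _ [e2 p2]].
- by split=> //; apply: triA_perm.
- by [].
- by split; [apply: iff_sym|rewrite perm_sym].
- by split; [apply: iff_trans e2|apply: perm_trans p2].
Qed.

Lemma seq_min v : v != [::] -> exists2 a, a \in v & {in v, forall x, a <= x}.
Proof.
elim: v => // x v IH _; have [->|/IH [a av amin]] := eqVneq v [::].
  by exists x; rewrite ?mem_head // => y; rewrite inE => /eqP ->.
have [le|lt] := leP x a.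
  exists x; rewrite ?mem_head // => y; rewrite inE => /orP [/eqP -> //|/amin].
  exact: le_trans.
exists a; rewrite ?inE ?av ?orbT // => y; rewrite inE => /orP [/eqP ->|/amin //].
exact: ltW.
Qed.

Lemma mem_cycle_word f a x : (x \in cycle_word f a) = (x == a) || (x == f a).
Proof.
rewrite /cycle_word; case: eqP => [->|_]; first by rewrite inE orbb.
by rewrite !inE orbC.
Qed.

(** As [a] is the least letter, every condition between the front cycle and the rest either asks
    that the cycle come first or is vacuous. *)
Lemma atom_word_cycle f a u :
    uniq (cycle_word f a ++ u) ->
    invol_on (fun x => x \in cycle_word f a ++ u) f ->
    {in cycle_word f a ++ u, forall x, a <= x} ->
  atom_word f (cycle_word f a ++ u) <-> atom_word f u.
Proof.
set c := cycle_word f a => uv fv amin.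
have uu : uniq u by move: uv; rewrite cat_uniq => /and3P [].
have cu x : x \in u -> x \notin c.
  move=> xu; apply/negP => xc; move: uv; rewrite cat_uniq => /and3P [_ /hasPn/(_ _ xu)/=].
  by rewrite xc.
have av : a \in c ++ u by rewrite mem_cat mem_cycle_word eqxx.
have ffa : f (f a) = a by have [] := fv _ av.
have alef : a <= f a by apply: amin; have [] := fv _ av.
have fc x : x \in c -> f x \in c.
  rewrite !mem_cycle_word => /orP [] /eqP ->; rewrite ?ffa eqxx ?orbT //.
have uv' x : x \in u -> x \in c ++ u by rewrite mem_cat orbC => ->.
have fu x : x \in u -> f x \in u.
  move=> xu; have [fxv ffx] := fv _ (uv' _ xu).
  move: fxv; rewrite mem_cat => /orP [/fc|//]; rewrite ffx => xc.
  by have := cu _ xu; rewrite xc.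
have idu x : x \in u -> index x (c ++ u) = (size c + index x u)%N.
  by move=> xu; rewrite index_cat (negPf (cu _ xu)).
have idc x : x \in c -> index x (c ++ u) = index x c.
  by move=> xu; rewrite index_cat xu.
have idc' x : x \in c -> (index x (c ++ u) < size c)%N.
  by move=> xu; rewrite idc // index_mem.
have ltau x : x \in u -> a < x.
  move=> xu; rewrite lt_neqAle amin ?uv' // andbT; apply/eqP => e.
  by have := cu _ xu; rewrite mem_cycle_word -e eqxx.
split=> [[_ _ [A1 Ae A2]]|[_ _ [A1 Ae A2]]]; split=> //.
- by move=> x xu; have [_ ?] := fv _ (uv' _ xu); rewrite fu.
- split.
  + by move=> x xu; have := A1 _ (uv' _ xu); rewrite !idu ?fu // ltn_add2l.
  + by move=> x e xu eu; have := Ae _ _ (uv' _ xu) (uv' _ eu); rewrite !idu ?fu // !ltn_add2l.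
  + by move=> x y xu yu; have := A2 _ _ (uv' _ xu) (uv' _ yu); rewrite !idu ?fu // !ltn_add2l.
have csz : a < f a -> c = [:: f a; a] by rewrite /c /cycle_word; case: eqP => // ->; rewrite ltxx.
have xca x : x \in c -> x < f x -> x = a.
  by rewrite mem_cycle_word => /orP [] /eqP -> //; rewrite ffa; lia.
have ida : a < f a -> index a (c ++ u) = 1 /\ index (f a) (c ++ u) = 0.
  by move=> lt; rewrite csz //= eqxx; case: eqP => [e|_]; [lia|rewrite eqxx].
split.
- move=> x; rewrite mem_cat => /orP [xc lt|xu lt].
    by have e := xca _ xc lt; rewrite e in lt *; have [-> ->] := ida lt.
  by rewrite !idu ?fu // ltn_add2l; apply: A1.
- move=> x e; rewrite mem_cat => /orP [xc _ xe ef|xu].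
    have lt : x < f x by lia.
    by have e' := xca _ xc lt; rewrite e' in lt *; have [-> ->] := ida lt; lia.
  rewrite mem_cat => /orP [ec|eu]; last by rewrite !idu ?fu // !ltn_add2l; apply: Ae.
  by rewrite idu ?fu //; have := idc' _ ec; lia.
- move=> x y; rewrite !mem_cat => /orP [xc|xu] /orP [yc|yu].
  + by move: xc yc; rewrite !mem_cycle_word => /orP [] /eqP -> /orP [] /eqP ->; rewrite ?ffa; lia.
  + by rewrite (idu _ yu); have := idc' _ xc; lia.
  + have ax := ltau _ xu; move: yc.
    by rewrite mem_cycle_word => /orP [] /eqP ->; rewrite ?ffa; lia.
  + by rewrite !idu // ltn_add2l; apply: A2.
Qed.

(** Letters above [f a] must follow [a], and letters with value between [a] and [f a] may not stand
    between the two. Hence [f a] and [a] are adjacent, and only letters of the open interval can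
    precede them. *)
Lemma atom_word_front f v a :
    atom_word f v -> a \in v -> {in v, forall x, a <= x} ->
  exists t u, v = t ++ cycle_word f a ++ u /\ {in t, forall y, a < y < f a}.
Proof.
move=> [uv fv [A1 Ae A2]] av amin.
have [fav ffa] := fv _ av.
have alt x : x \in v -> x <> a -> a < x.
  by move=> xv xa; rewrite lt_neqAle amin // andbT; apply/eqP => /esym.
(* The order condition speaks of the larger element of a cycle ([up]); a smaller one stands behind
   its partner, which is larger still. *)
have after y : y \in v -> f a < y -> y <> a -> (index a v < index y v)%N.
  have up z : z \in v -> f a < z -> f z <= z -> (index a v < index z v)%N.
    move=> zv az fz; have [fzv ffz] := fv _ zv.
    apply: A2; rewrite // ?amin //; apply: alt => // e.
    by move: az; rewrite -e ffz ltxx.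
  move=> yv ay ya; have [fyv ffy] := fv _ yv.
  have [lt|] := ltP y (f y); last exact: up.
  have := A1 _ yv lt; have := up _ fyv; rewrite ffy; lia.
have nbetw y : y \in v -> y <> a -> y < f a ->
    ~ ((index (f a) v < index y v)%N /\ (index y v < index a v)%N).
  by move=> yv ya yfa; apply: Ae => //; apply: alt.
have idx : index a v = (index (f a) v + (f a != a))%N.
  have [->|/eqP ne] := eqVneq (f a) a; first by rewrite addn0.
  have lt : (index (f a) v < index a v)%N by apply: A1 => //; apply: alt.
  rewrite /= addn1; apply/eqP; rewrite eqn_leq lt andbT leqNgt; apply/negP => lt2.
  have sz : ((index (f a) v).+1 < size v)%N by apply: leq_trans lt2 _; rewrite index_size.
  have [y [yv iy]] : exists y : int, y \in v /\ index y v = (index (f a) v).+1.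
    exists (nth 0 v (index (f a) v).+1); split; first exact: mem_nth.
    by rewrite index_uniq.
  have ya : y <> a by move=> e; rewrite e in iy; lia.
  have [lty|] := ltP y (f a); first by apply: (nbetw y yv ya lty); lia.
  rewrite le_eqVlt => /orP [/eqP e|gt]; first by rewrite -e in iy; lia.
  by have := after _ yv gt ya; lia.
have before y : y \in v -> (index y v < index (f a) v)%N -> a < y < f a.
  move=> yv lt; have ya : y <> a by move=> e; rewrite e in lt; lia.
  rewrite alt //= ltNge le_eqVlt; apply/negP => /orP [/eqP e|gt].
    by rewrite e in lt; lia.
  by have := after _ yv gt ya; lia.
exists (take (index (f a) v) v), (drop (index a v).+1 v); split; last first.
  move=> y yt; have yv := mem_take yt; apply: before => //.
  by rewrite -(in_take_leq _ (index_size _ _)).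
rewrite -{1}(cat_take_drop (index (f a) v) v); congr (_ ++ _).
rewrite drop_index // /cycle_word; move: idx.
have [e|/eqP ne] := eqVneq (f a) a; first by rewrite e addn0.
by rewrite addn1 => idx; rewrite -idx /= drop_index.
Qed.

(** The cycle of [y] is nested in [[a, f a]], so no order condition relates the two cycles. The move
    may put [f a] and [a] between [f y] and [y], but their values are not inside the cycle of
    [y]. *)
Lemma atom_word_move f a t y u (v := t ++ [:: y, f a, a & u]) :
    atom_word f v -> {in v, forall x, a <= x} -> a < y < f a ->
  atom_word f (t ++ [:: f a, a, y & u]).
Proof.
move=> [uv fv [A1 Ae A2]] amin /andP [ay yb].
set w := t ++ _.
have wv : w =i v by move=> x; rewrite !mem_cat !inE; do !case: (_ == _); rewrite ?orbT.
have pvw : perm_eq w v.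
  by rewrite perm_cat2l; apply/seq.permP => q /=; lia.
have uw : uniq w by rewrite (perm_uniq pvw).
have av : a \in v by rewrite mem_cat !inE eqxx !orbT.
have yv : y \in v by rewrite mem_cat !inE eqxx !orbT.
have [bv fb] := fv _ av.
have [fyv fy] := fv _ yv.
have nt x : x \in [:: y; f a; a] -> x \notin t.
  move=> xc; move: uv; rewrite cat_uniq => /and3P [_ /hasPn/(_ x) h _]; apply: h.
  by move: xc; rewrite !inE => /or3P [] ->; rewrite ?orbT.
have ab : a < f a by lia.
(* The positions of each letter before and after the move, in a form that leaves only linear
   arithmetic. *)
have pos x : (x = y /\ index x v = size t /\ index x w = (size t).+2) \/
    (x = f a /\ index x v = (size t).+1 /\ index x w = size t) \/
    (x = a /\ index x v = (size t).+2 /\ index x w = (size t).+1) \/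
    ((x <> y /\ x <> f a /\ x <> a) /\ index x v = index x w /\
        ((index x v < size t)%N \/ ((size t).+2 < index x v)%N)).
  have [xc|nxc] := boolP (x \in [:: y; f a; a]).
    have e1 : (f a == a) = false by lia.
    have e2 : (f a == y) = false by lia.
    have e3 : (a == y) = false by lia.
    have e4 : (a == f a) = false by rewrite eq_sym.
    have e5 : (y == f a) = false by rewrite eq_sym.
    have e6 : (y == a) = false by rewrite eq_sym.
    rewrite !index_cat (negPf (nt _ xc)) /=.
    move: xc; rewrite !inE => /or3P [] /eqP ->; rewrite ?eqxx ?e1 ?e2 ?e3 ?e4 ?e5 ?e6.
    - by left; split=> //; lia.
    - by right; left; split=> //; lia.
    - by right; right; left; split=> //; lia.
  move: nxc; rewrite !inE !negb_or => /and3P [/eqP n1 /eqP n2 /eqP n3].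
  do 3!right; rewrite !index_cat /=.
  have -> : (y == x) = false by apply/eqP => e; apply: n1.
  have -> : (f a == x) = false by apply/eqP => e; apply: n2.
  have -> : (a == x) = false by apply/eqP => e; apply: n3.
  by do !split=> //; case: ifP; rewrite -?index_mem; [left|lia].
have fA x : f x = f a -> x \in v -> x = a.
  by move=> /(congr1 f); rewrite fb => e /fv [_ <-].
have fB x : f x = a -> x \in v -> x = f a.
  by move=> <- /fv [_ ->].
have cA x : x = a -> f x = f a by move->.
have cB x : x = f a -> f x = a by move->.
(* If [f y] exceeded [f a], it would have to follow [a] and yet precede [y], which stands before [a]
   in [v]. *)
have fyb x : x = y -> f x <= f a.
  move=> ->; rewrite leNgt; apply/negP => lt.
  have yf : y < f y by lia.
  have := A2 _ _ av fyv; rewrite fy => /(_ (ltW ab) (ltW yf) ay lt).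
  have := A1 _ yv yf; have := pos y; have := pos a; move: ab ay yb; clear.
  by generalize (index (f y) v) (index y v) (index a v) (index a w) (index y w); lia.
split=> //.
  by move=> x; rewrite !wv; apply: fv.
split.
- move=> x; rewrite wv => xv lt; have := A1 _ xv lt.
  have := fA x; have := fB x; have := cA x; have := cB x; have := pos x; have := pos (f x).
  move: lt ab ay yb; rewrite xv; clear.
  generalize (index (f x) v) (index (f x) w) (index x v) (index x w) (size t) (f x) (f a).
  lia.
- move=> x e; rewrite !wv => xv ev xe ef; have := Ae _ _ xv ev xe ef.
  have xa := amin _ xv.
  have [[xE xP]|[[xE _]|[xP|xP]]] := pos x; first 1 last.
  - by have := cB _ xE; move: xE xa ab xe ef; clear; lia.
  - case: xP => xE [_ ->]; have -> : index (f x) w = size t.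
      by rewrite (cA _ xE); have := pos (f a); move: ab yb; clear; lia.
    by clear; lia.
  - case: xP => [[xy [xfa xna]] [<- xP]].
    have := pos e; have [[fE [-> ->]]|[[/fA fE _]|[[/fB fE _]|]]] := pos (f x); last 1 first.
    + move=> [_ [<- fP]]; move: xe xa xP fP; clear => xe xa xP fP.
      by case=> [|[|[|]]] eP; lia.
    + by move: xP; clear; case=> xP; [lia|case=> [|[|[|]]] eP; lia].
    + by case: xna; apply: fE.
    + by case: xfa; apply: fE.
  - have fb' := fyb _ xE; case: xP => -> ->.
    have := pos e; have [[fE _]|[[fE _]|[[fE _]|]]] := pos (f x).
    + by move: fE xE xe ef; clear; lia.
    + by have := fA _ fE xv; move: xE ay; clear; lia.
    + by have := fB _ fE xv; move: xE yb; clear; lia.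
    move=> [_ [<- fP]]; move: xe ef fb' xE xa fP; clear => xe ef fb' xE xa fP.
    by case=> [|[|[|]]] eP; lia.
- move=> x z; rewrite !wv => xv zv xf fz xz fxz; have := A2 _ _ xv zv xf fz xz fxz.
  have := cA x; have := cB x; have := cA z; have := cB z.
  have := amin _ xv; have := amin _ (fv _ zv).1; have := pos x; have := pos z.
  move: xf fz xz fxz ab ay yb; clear.
  generalize (index z v) (index z w) (index x v) (index x w) (size t) (f x) (f z) (f a).
  lia.
Qed.

Lemma atom_conn_front f v a :
    atom_word f v -> a \in v -> {in v, forall x, a <= x} ->
  exists u, atom_conn f (cycle_word f a ++ u) v /\ atom_word f (cycle_word f a ++ u).
Proof.
move=> vf av amin; have [t [u [vE tP]]] := atom_word_front vf av amin.
elim/last_ind: t u v vE vf av amin tP => [|t y IH] u v vE vf av amin tP.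
  exists u; rewrite -[cycle_word f a ++ u]/([::] ++ cycle_word f a ++ u) -vE.
  by split=> //; apply: rst_refl.
have yP : a < y < f a by apply: tP; rewrite mem_rcons mem_head.
have cE : cycle_word f a = [:: f a; a] by rewrite /cycle_word; case: eqP => // e; lia.
have vE' : v = t ++ [:: y, f a, a & u] by rewrite vE cE cat_rcons.
set w := t ++ [:: f a, a, y & u].
have wf : atom_word f w by apply: atom_word_move yP; rewrite -vE'.
have wv : w =i v by move=> x; rewrite vE' !mem_cat !inE; do !case: (_ == _); rewrite ?orbT.
have [||||u' [c uf]] := IH (y :: u) w _ wf.
- by rewrite cE.
- by rewrite wv.
- by move=> x; rewrite wv; apply: amin.
- by move=> x xt; apply: tP; rewrite mem_rcons inE xt orbT.
exists u'; split=> //; apply: rst_trans c _; apply: rst_step; split=> //.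
by exists t, u, a, y, (f a); rewrite vE'.
Qed.

Lemma atom_conn_cycle f a u w :
    uniq (cycle_word f a ++ u) ->
    invol_on (fun x => x \in cycle_word f a ++ u) f ->
    {in cycle_word f a ++ u, forall x, a <= x} ->
    perm_eq u w -> atom_conn f u w ->
  atom_conn f (cycle_word f a ++ u) (cycle_word f a ++ w).
Proof.
move=> uu fu amin _ c; set d := cycle_word f a in uu fu amin *.
have ext x : atom_word f x -> perm_eq u x -> atom_word f (d ++ x).
  move=> xf ux; have px : perm_eq (d ++ x) (d ++ u) by rewrite perm_cat2l perm_sym.
  have mx := perm_mem px; apply/atom_word_cycle => //.
  - by rewrite (perm_uniq px).
  - by move=> z; rewrite !mx; apply: fu.
  - by move=> z; rewrite mx; apply: amin.
suff : forall x y, atom_conn f x y -> perm_eq u x -> atom_conn f (d ++ x) (d ++ y).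
  by move=> H; apply: H c _; rewrite perm_refl.
move=> x y; elim=> {x y w c} [x y [xy xf yf]|x|x y c IH|x y z c1 IH1 _ IH2] ux.
- apply: rst_step; split; [|exact: ext|exact: ext (perm_trans ux (triA_perm xy))].
  case: xy => p [q [i [j [k [ijk -> ->]]]]]; exists (d ++ p), q, i, j, k.
  by rewrite -!catA.
- exact: rst_refl.
- apply: rst_sym; apply: IH; apply: perm_trans ux _; rewrite perm_sym.
  by have [] := atom_conn_word c.
- apply: rst_trans (IH1 ux) (IH2 _); apply: perm_trans ux _.
  by have [] := atom_conn_word c1.
Qed.

Lemma atom_word_conn f v w :
  atom_word f v -> atom_word f w -> perm_eq v w -> atom_conn f v w.
Proof.
have [m] := ubnP (size v); elim: m v w => // m IH v w sv vf wf vw.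
have [v0|vn] := eqVneq v [::].
  by move: vw; rewrite v0 perm_sym => /perm_nilP ->; apply: rst_refl.
have [a av amin] := seq_min vn.
have wv := perm_mem vw.
have [u [cu uf]] := atom_conn_front vf av amin.
have aw : a \in w by rewrite -wv.
have amin' : {in w, forall x, a <= x} by move=> x; rewrite -wv; apply: amin.
have [u' [cu' uf']] := atom_conn_front wf aw amin'.
have [_ pu] := atom_conn_word cu; have [_ pu'] := atom_conn_word cu'.
have mu := perm_mem pu; have mu' := perm_mem pu'.
have puu : perm_eq u u'.
  rewrite -(perm_cat2l (cycle_word f a)) (perm_trans pu) // (perm_trans vw) //.
  by rewrite perm_sym.
have su : (size u < m)%N.
  have := perm_size pu; rewrite size_cat /cycle_word; case: eqP => _ /=; lia.
have [U I _] := uf; have [U' I' _] := uf'.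
have min1 : {in cycle_word f a ++ u, forall x, a <= x}.
  by move=> x; rewrite mu; apply: amin.
have min2 : {in cycle_word f a ++ u', forall x, a <= x}.
  by move=> x; rewrite mu'; apply: amin'.
apply: rst_trans (rst_sym _ _ _ _ cu) _; apply: rst_trans cu'.
apply: atom_conn_cycle => //; apply: IH => //.
  by apply/(atom_word_cycle U I min1).
by apply/(atom_word_cycle U' I' min2).
Qed.

(** The word lists the cycles by increasing least element. It is what makes every matching come from
    some inverse atom. *)
Lemma atom_word_exists f (L : seq int) :
    uniq L -> invol_on (fun x => x \in L) f ->
  exists2 v, perm_eq v L & atom_word f v.
Proof.
have [m] := ubnP (size L); elim: m L => // m IH L sL uL fL.
have [L0|Ln] := eqVneq L [::].
  by exists [::]; [rewrite L0|split=> //; split].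
have [a aL amin] := seq_min Ln; have [faL ffa] := fL _ aL.
pose d := cycle_word f a; pose L' := [seq x <- L | x \notin d].
have uc : uniq d by rewrite /d /cycle_word; case: eqP => //= /eqP ne; rewrite inE ne.
have dL : {subset d <= L}.
  by move=> x; rewrite mem_cycle_word => /orP [] /eqP ->.
have fd x : x \in L -> (f x \in d) = (x \in d).
  move=> xL; have [_ ffx] := fL _ xL; rewrite !mem_cycle_word orbC; congr orb.
    by apply/eqP/eqP => [/(congr1 f)|->]; rewrite ?ffx ?ffa.
  by apply/eqP/eqP => [<-|->].
have fL' : invol_on (fun x => x \in L') f.
  move=> x; rewrite !mem_filter => /andP [xd xL]; have [fxL ffx] := fL _ xL.
  by rewrite fd // xd fxL.
have pL : perm_eq (d ++ L') L.
  have := permEl (perm_filterC (mem d) L); apply: perm_trans; rewrite perm_cat2r.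
  apply: uniq_perm => // [|x]; first exact: filter_uniq.
  by rewrite mem_filter /= andbC; case xd: (x \in d); rewrite ?andbF ?andbT ?dL.
have sL' : (size L' < m)%N.
  have := perm_size pL; rewrite size_cat /d /cycle_word; case: eqP => _ /=; lia.
have [u uL' uf] := IH L' sL' (filter_uniq _ uL) fL'.
have pu : perm_eq (d ++ u) L by apply: perm_trans pL; rewrite perm_cat2l.
have mu := perm_mem pu.
exists (d ++ u) => //; apply/atom_word_cycle => //.
- by rewrite (perm_uniq pu).
- by move=> x; rewrite !mu; apply: fL.
- by move=> x; rewrite mu; apply: amin.
Qed.

End Connectivity.

(** * Inverse atoms of type B *)

Section SignedAtoms.
Local Open Scope ring_scope.
Implicit Types (z pi s : int -> int) (v : seq int).

(** Zero is excluded because an odd map on all of [int] satisfies [z 0 = - 0]. *)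
Definition neg_pt z (x : int) : bool := (x != 0) && (z x == - x).

Definition nc_matching (N : pred int) pi : Prop :=
  (forall x, N x -> [/\ N (pi x), pi (pi x) = x, pi x <> x & pi (- x) = - pi x]) /\
  (forall x y, N x -> N y -> x < y -> y < pi x -> pi x < pi y -> False).

(* A block [{x, pi x}] with [x < pi x] and its opposite contribute to [v] the letters
   [x] and [- pi x], which form one cycle. *)
Definition fold_invol z pi (x : int) : int := if neg_pt z x then - pi x else z x.

Definition signed_atom z pi v : Prop :=
  [/\ nc_matching (neg_pt z) pi,
      {in v, forall x, if neg_pt z x then x < pi x else 0 < x + z x} &
      atom_word (fold_invol z pi) v].

(** Step with [z'] the conjugate of [z]: as [s] is increasing on the negated points and on the
    letters, it carries matching and word along. Only the positivity of [x + z x] is not a matter of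
    relative order, whence the last hypothesis. *)
Lemma signed_atom_conj s z z' pi v :
    (forall x, s (- x) = - s x) -> involutive s ->
    (forall x, z' (s x) = s (z x)) ->
    {in neg_pt z &, {homo s : x y / x < y}} ->
    {in v &, {mono s : x y / x < y}} ->
    {in v, forall x, ~~ neg_pt z x -> 0 < x + z x -> 0 < s x + s (z x)} ->
  signed_atom z pi v -> signed_atom z' (s \o pi \o s) (map s v).
Proof.
move=> so si z's sN sv pos [[M NC] D A].
have sinj : injective s := inv_inj si.
have s0 x : (s x == 0) = (x == 0).
  have e : s 0 = 0 by move: (so 0); rewrite oppr0; move: (s 0) => c; lia.
  by rewrite -{1}e (inj_eq sinj).
have N' x : neg_pt z' (s x) = neg_pt z x.
  by rewrite /neg_pt s0 z's -so (inj_eq sinj).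
have N'' x : neg_pt z' x = neg_pt z (s x) by rewrite -[x in LHS]si N'.
have sNm : {in neg_pt z &, {mono s : x y / x < y}}.
  move=> x y Nx Ny; apply/idP/idP; last exact: sN.
  case: (ltgtP x y) => // [yx|->]; last by rewrite ltxx.
  by move=> /(lt_trans (sN _ _ Ny Nx yx)); rewrite ltxx.
split.
- split=> [x|x y].
    rewrite N'' => /M [Np pp px po] /=; rewrite N' Np !si pp so po so.
    by split=> // /(canRL si).
  rewrite !N'' /= => Nx Ny; have [Npx _ _ _] := M _ Nx; have [Npy _ _ _] := M _ Ny.
  rewrite -[x]si -[y]si !si => xy ypx pxy.
  apply: (NC (s x) (s y)) => //.
  - by rewrite -sNm // !si.
  - by rewrite -sNm // si.
  - by rewrite -sNm.
- move=> _ /mapP [x xv ->]; rewrite N' /= si z's; have := D _ xv.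
  case: ifP => Nx; last by apply: pos; rewrite ?Nx.
  by have [Npx _ _ _] := M _ Nx; rewrite sNm.
- have zE x : x \in v -> fold_invol z' (s \o pi \o s) (s x) = s (fold_invol z pi x).
    by move=> _; rewrite /fold_invol N' /= si z's; case: ifP; rewrite ?so.
  have [_ I _] := A; have cl : {in v, forall x, fold_invol z pi x \in v}.
    by move=> x /I [].
  exact/(atom_word_map sv cl zE).
Qed.

(** Step with [z' = z s]: the points moved by [s] form blocks of [pi]. They are no longer negated by
    [z'], so these blocks disappear while [pi] is unchanged on the remaining points. *)
Lemma signed_atom_comm s z z' pi v :
    (forall x, s (- x) = - s x) -> involutive s -> involutive z ->
    (forall x, s x != x -> neg_pt z x) -> (forall x, z' x = z (s x)) ->
    {in v &, {mono s : x y / x < y}} ->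
    (forall x, s x != x -> pi x = s x) ->
  signed_atom z pi v -> signed_atom z' pi (map s v).
Proof.
move=> so si zi sN z'E sv pis [[M NC] D A].
have sinj : injective s := inv_inj si.
have N'P x : neg_pt z' x = neg_pt z x && (s x == x).
  have [e|ne] := eqVneq (s x) x; first by rewrite /neg_pt z'E e andbT.
  rewrite andbF /neg_pt z'E; apply/negP => /andP [x0 /eqP].
  have := sN (s x); rewrite si eq_sym => /(_ ne) /andP [_ /eqP ->] e.
  by move: ne; rewrite (oppr_inj e) eqxx.
have spi x : neg_pt z x -> s x == x -> s (pi x) == pi x.
  move=> Nx /eqP sx; have [_ pp px _] := M _ Nx.
  apply/negPn/negP => /pis; rewrite pp => /(congr1 s).
  by rewrite si sx => /esym.
split.
- split=> [x|x y].
    rewrite !N'P => /andP [/[dup] Nx /M [Np pp px po] sx].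
    by rewrite Np spi.
  by rewrite !N'P => /andP [Nx _] /andP [Ny _]; apply: NC.
- move=> _ /mapP [x xv ->]; rewrite N'P si z'E si.
  have [e|ne] := eqVneq x (s x).
    by rewrite -e andbT; apply: D.
  have := D _ xv.
  have Nx : neg_pt z x by apply: sN; rewrite eq_sym.
  by rewrite Nx pis 1?eq_sym // andbF; have /andP [_ /eqP ->] := Nx; lia.
- have [_ I _] := A; have cl : {in v, forall x, fold_invol z pi x \in v}.
    by move=> x /I [].
  have zE x : x \in v -> fold_invol z' pi (s x) = s (fold_invol z pi x).
    move=> _; rewrite /fold_invol N'P si z'E si.
    have [e|ne] := eqVneq (s x) x.
      rewrite e ?eqxx ?andbT; case: ifP => Nx; first by rewrite so (eqP (spi _ Nx _)) // e.
      apply/esym/eqP; apply/negPn/negP => /sN /andP [z0 /eqP].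
      rewrite zi => xE; move: z0 (negbT Nx); rewrite /neg_pt -oppr_eq0 -xE => -> /=.
      by rewrite {2}xE opprK eqxx.
    have Nx := sN _ ne; rewrite ?(eq_sym x) ?(negPf ne) andbF Nx pis // so si.
    by have /andP [_ /eqP ->] := Nx.
  exact/(atom_word_map sv cl zE).
Qed.

(** Converse step: the blocks [{x, s x}] are inserted into the matching. They cross nothing since no
    negated point lies between [x] and [s x]. *)
Lemma signed_atom_uncomm s z z' pi v :
    (forall x, s (- x) = - s x) -> involutive s -> involutive z ->
    (forall x, s x != x -> neg_pt z x) -> (forall x, z' x = z (s x)) ->
    {in v &, {mono s : x y / x < y}} ->
    (forall x y, x < y -> y < s x -> ~~ neg_pt z y) ->
  signed_atom z' pi (map s v) -> signed_atom z (fun x => if s x != x then s x else pi x) v.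
Proof.
move=> so si zi sN z'E sv adj [[M NC] D A].
have sinj : injective s := inv_inj si.
have N'P x : neg_pt z' x = neg_pt z x && (s x == x).
  have [e|ne] := eqVneq (s x) x; first by rewrite /neg_pt z'E e andbT.
  rewrite andbF /neg_pt z'E; apply/negP => /andP [x0 /eqP].
  have := sN (s x); rewrite si eq_sym => /(_ ne) /andP [_ /eqP ->] e.
  by move: ne; rewrite (oppr_inj e) eqxx.
have sDx x : (s (s x) != s x) = (s x != x) by rewrite si eq_sym.
set pi' := fun x => _.
have N_pi x : neg_pt z x -> neg_pt z (pi' x).
  move=> Nx; rewrite /pi'; case: ifP => [ne|/negbFE e].
    by apply: sN; rewrite sDx.
  by have := M x; rewrite !N'P Nx e => /(_ isT) [/andP []].
split.
- split=> [x Nx|x y Nx Ny].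
    split; first exact: N_pi.
    + rewrite {2}/pi'; case: ifP => [ne|/negbFE e]; first by rewrite /pi' sDx ne si.
      have := M x; rewrite !N'P Nx e => /(_ isT) [/andP [_ sp] pp _ _].
      by rewrite /pi' sp.
    + rewrite /pi'; case: ifP => [/eqP //|/negbFE e].
      by have := M x; rewrite !N'P Nx e => /(_ isT) [].
    + rewrite /pi' so eqr_opp; case: ifP => // /negbFE e.
      by have := M x; rewrite !N'P Nx e => /(_ isT) [].
  have Npx := N_pi _ Nx; have [/eqP sx|sx] := boolP (s x == x); last first.
    by rewrite {1}/pi' sx => xy ysx; move: (adj _ _ xy ysx); rewrite Ny.
  have pxE : pi' x = pi x by rewrite /pi' sx eqxx.
  have [/eqP sy|sy] := boolP (s y == y); last first.
    by rewrite {3}/pi' sy => xy ypx pxsy; move: (adj _ _ ypx pxsy); rewrite Npx.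
  have pyE : pi' y = pi y by rewrite /pi' sy eqxx.
  rewrite pxE pyE; move/eqP in sx; move/eqP in sy.
  by apply: NC; rewrite N'P ?Nx ?Ny.
- move=> x xv; have := D _ (map_f s xv); rewrite N'P si z'E si /pi'.
  have [e|ne] := eqVneq (s x) x; first by rewrite e ?eqxx ?andbT.
  by have /andP [_ /eqP ->] := sN _ ne; rewrite ?(eq_sym x) ?(negPf ne) andbF (sN _ ne) /=; lia.
- have zE x : fold_invol z' pi (s x) = s (fold_invol z pi' x).
    rewrite /fold_invol N'P si z'E si.
    have [e|ne] := eqVneq (s x) x.
      rewrite e ?eqxx ?andbT; case: ifP => Nx.
        rewrite so /pi' e eqxx /=; have := M x; rewrite !N'P Nx e eqxx.
        by move=> /(_ isT) [/andP [_ /eqP ->]].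
      apply/esym/eqP; apply/negPn/negP => /sN /andP [z0 /eqP].
      rewrite zi => xE; move: z0 (negbT Nx); rewrite /neg_pt -oppr_eq0 -xE => -> /=.
      by rewrite {2}xE opprK eqxx.
    have Nx := sN _ ne; rewrite ?(eq_sym x) ?(negPf ne) andbF Nx /pi' ne so si.
    by have /andP [_ /eqP ->] := Nx.
  have [_ I _] := A.
  have cl : {in v, forall x, fold_invol z pi' x \in v}.
    move=> x xv; have [+ _] := I _ (map_f s xv); rewrite zE.
    by move=> /mapP [y yv /sinj ->].
  by apply/(atom_word_map sv cl _) => // x _; apply: zE.
Qed.

End SignedAtoms.

(** * The order-preserving descents of type B *)

Section SignedSteps.
Local Open Scope ring_scope.
Implicit Types (z pi : int -> int) (v : seq int) (i x y : int).

(** The generators [t_0] and, below, [t_i] as maps on all of [int], so that case distinctions end in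
    linear arithmetic. *)
Definition neg_one (x : int) : int := if (x == 1) || (x == -1) then - x else x.

Definition swap_abs (i x : int) : int :=
  if x == i then i + 1 else if x == i + 1 then i else
  if x == - i then - (i + 1) else if x == - (i + 1) then - i else x.

Lemma neg_oneP x : (x = 1 /\ neg_one x = -1) \/ (x = -1 /\ neg_one x = 1) \/
  (x <> 1 /\ x <> -1 /\ neg_one x = x).
Proof. by rewrite /neg_one; case: ifP; lia. Qed.

Lemma neg_oneN x : neg_one (- x) = - neg_one x.
Proof. by have := neg_oneP x; have := neg_oneP (- x); lia. Qed.

Lemma neg_oneK : involutive neg_one.
Proof. by move=> x; have := neg_oneP x; have := neg_oneP (neg_one x); lia. Qed.

Lemma swap_absP i x : 0 < i ->
  (x = i /\ swap_abs i x = i + 1) \/ (x = i + 1 /\ swap_abs i x = i) \/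
  (x = - i /\ swap_abs i x = - (i + 1)) \/ (x = - (i + 1) /\ swap_abs i x = - i) \/
  (x <> i /\ x <> i + 1 /\ x <> - i /\ x <> - (i + 1) /\ swap_abs i x = x).
Proof. by rewrite /swap_abs; do 4?[case: ifP]; lia. Qed.

Lemma swap_absN i x : 0 < i -> swap_abs i (- x) = - swap_abs i x.
Proof. by move=> i0; have := swap_absP x i0; have := swap_absP (- x) i0; lia. Qed.

Lemma swap_absK i : 0 < i -> involutive (swap_abs i).
Proof.
by move=> i0 x; have := swap_absP x i0; have := swap_absP (swap_abs i x) i0; lia.
Qed.

(** Two distinct opposite blocks that both straddle zero would cross. *)
Lemma nc_matching_opp (N : pred int) pi x :
  nc_matching N pi -> (forall y, N y -> N (- y)) -> N x ->
  x < 0 -> 0 < pi x -> pi x = - x.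
Proof.
move=> [M NC] NN Nx x0 px0; have [Np pp px po] := M _ Nx.
have ppo : pi (- pi x) = - x by have [_ _ _ ->] := M _ Np; rewrite pp.
case: (ltgtP (pi x) (- x)) => // lt; exfalso.
  apply: (NC x (- pi x)); rewrite ?NN // ?ppo; lia.
apply: (NC (- pi x) x); rewrite ?NN // ?ppo; lia.
Qed.

(** Since [1] is not a letter, [neg_one] is increasing on the letters of [v]. If [z] negates 1, the
    block [{-1, 1}] is removed; otherwise the matching is conjugated, or both sides fail. *)
Lemma signed_atom_neg_one z z' v :
    (forall x, z (- x) = - z x) -> involutive z ->
    {in v, forall x, - x \notin v} -> -1 \in v ->
    ((forall x, neg_one (z x) = z (neg_one x)) -> forall x, z' x = z (neg_one x)) ->
    (~ (forall x, neg_one (z x) = z (neg_one x)) -> forall x, z' (neg_one x) = neg_one (z x)) ->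
  (exists pi, signed_atom z pi v) <->
  z 1 < 0 /\ exists pi, signed_atom z' pi (map neg_one v).
Proof.
move=> zo zi vN v1 zc zn.
have z0 : z 0 = 0 by move: (zo 0); rewrite oppr0; move: (z 0) => c; lia.
have zinj : injective z := inv_inj zi.
have vn0 : 0 \notin v by apply/negP => /[dup] /vN; rewrite oppr0 => /negP.
have vn1 : 1 \notin v by have := vN _ v1; rewrite opprK.
have vne x : x \in v -> x <> 0 /\ x <> 1.
  by move=> xv; split=> e; [move: vn0|move: vn1]; rewrite -e xv.
have mono : {in v &, {mono neg_one : x y / x < y}}.
  by move=> x y /vne ? /vne ?; have := neg_oneP x; have := neg_oneP y; lia.
have z1N : z (-1) = - z 1 by rewrite zo.
have [z1|z1] := eqVneq (z 1) (-1).
  have comm x : neg_one (z x) = z (neg_one x).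
    have [[-> ->]|[[-> ->]|[x1 [x2 ->]]]] := neg_oneP x; rewrite ?z1N ?z1 //.
    have := neg_oneP (z x); have : z x <> 1 by move/(congr1 z); rewrite zi z1.
    have : z x <> -1 by move/(congr1 z); rewrite zi z1N z1 opprK.
    by lia.
  have z'E := zc comm.
  have sN x : neg_one x != x -> neg_pt z x.
    by have := neg_oneP x => -[[-> _]|[[-> _]|[_ [_ ->]]]]; rewrite ?eqxx // /neg_pt ?z1N z1.
  have adj x y : x < y -> y < neg_one x -> ~~ neg_pt z y.
    move=> xy yx; have -> : y = 0 by have := neg_oneP x; lia.
    by rewrite /neg_pt eqxx.
  split=> [[pi piP]|[_ [pi /(signed_atom_uncomm neg_oneN neg_oneK zi sN z'E mono adj) A]]];
    last by eexists; exact: A.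
  rewrite z1; split=> //; exists pi.
  apply: (signed_atom_comm neg_oneN neg_oneK zi sN z'E mono _ piP).
  have [MM D _] := piP; have N1 : neg_pt z (-1) by rewrite /neg_pt z1N z1.
  have [Np pp px po] := MM.1 _ N1.
  (* The letter [-1] opens its block, so its partner is positive, and a block straddling zero is its
     own opposite. *)
  have pi1 : pi (-1) = 1.
    have NN y : neg_pt z y -> neg_pt z (- y) by rewrite /neg_pt zo oppr_eq0 eqr_opp.
    apply: (nc_matching_opp MM NN) => //; have := D _ v1; rewrite N1.
    by move: Np; rewrite /neg_pt => /andP [/eqP]; lia.
  move=> x; have := neg_oneP x => -[[-> ->]|[[-> ->]|[_ [_ ->]]]]; rewrite ?eqxx //.
  by rewrite -[1]opprK po opprK pi1.
(* The other way to commute with [neg_one] is to fix 1. Then the letter [-1] violates [0 < x + z x]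
   and [z 1 < 0] is false, so both sides fail. *)
have ncomm : ~ (forall x, neg_one (z x) = z (neg_one x)) \/ z 1 = 1.
  have [|z11] := eqVneq (z 1) 1; [by right|left=> /(_ 1)].
  have z1n0 : z 1 <> 0 by move/(congr1 z); rewrite zi z0.
  by rewrite [neg_one 1]/= z1N; have := neg_oneP (z 1); lia.
case: ncomm => [ncomm|z11]; last first.
  split=> [[pi [_ D _]]|[]]; last by rewrite z11.
  by have := D _ v1; rewrite /neg_pt z1N z11.
have z'E := zn ncomm.
have n1 x : neg_pt z x -> x <> 1 /\ x <> -1.
  move=> /andP [_ /eqP e]; split=> xE; move: e; rewrite xE ?z1N; lia.
have sN : {in neg_pt z &, {homo neg_one : x y / x < y}}.
  move=> x y /n1 ? /n1 ?; have := neg_oneP x; have := neg_oneP y; lia.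
have pos : {in v, forall x, ~~ neg_pt z x -> 0 < x + z x -> 0 < neg_one x + neg_one (z x)}.
  by move=> x /vne ? _; have := neg_oneP x; have := neg_oneP (z x); lia.
split=> [[pi piP]|[zneg [pi piP]]].
  split; last by eexists; apply: (signed_atom_conj neg_oneN neg_oneK z'E sN mono pos piP).
  have [_ /(_ _ v1) + _] := piP; case: ifP => [/n1 []//|_]; rewrite z1N; lia.
have z'E' x : z (neg_one x) = neg_one (z' x).
  by rewrite -[x in RHS]neg_oneK z'E neg_oneK.
have N' x : neg_pt z' x -> x <> 1 /\ x <> -1.
  move=> /andP [/eqP x0 /eqP e].
  have : neg_pt z (neg_one x).
    rewrite /neg_pt z'E' e neg_oneN eqxx andbT; apply/eqP.
    by have := neg_oneP x; lia.
  by move/n1; have := neg_oneP x; lia.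
eexists; rewrite -[v](mapK neg_oneK).
apply: (signed_atom_conj neg_oneN neg_oneK z'E' _ _ _ piP).
- move=> x y /N' ? /N' ?; have := neg_oneP x; have := neg_oneP y; lia.
- move=> _ _ /mapP [x xv ->] /mapP [y yv ->]; rewrite !neg_oneK.
  by rewrite mono.
- move=> _ /mapP [x /vne ? ->] _; rewrite z'E !neg_oneK.
  have zx : x = -1 -> z x = - z 1 by move->.
  by move/eqP in z1; have := neg_oneP x; have := neg_oneP (z x); lia.
Qed.

(** As [- i] and [i + 1] are not letters, [swap_abs i] is increasing on [v]. If [z] negates both [i]
    and [i + 1], the block [{i, i + 1}] and its opposite are removed; otherwise the matching is
    conjugated, or both sides fail. *)
Lemma signed_atom_swap_abs z z' i v :
    0 < i -> (forall x, z (- x) = - z x) -> involutive z ->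
    {in v, forall x, - x \notin v} -> i \in v -> - (i + 1) \in v ->
    ((forall x, swap_abs i (z x) = z (swap_abs i x)) ->
      forall x, z' x = z (swap_abs i x)) ->
    (~ (forall x, swap_abs i (z x) = z (swap_abs i x)) ->
      forall x, z' (swap_abs i x) = swap_abs i (z x)) ->
  (exists pi, signed_atom z pi v) <->
  z (i + 1) < z i /\ exists pi, signed_atom z' pi (map (swap_abs i) v).
Proof.
move=> i0 zo zi vN vi vi1 zc zn; set s := swap_abs i in zc zn *.
have sP x := swap_absP x i0; rewrite -/s in sP.
have so x : s (- x) = - s x := swap_absN x i0.
have sK : involutive s := swap_absK i0.
have zinj : injective z := inv_inj zi.
have si : s i = i + 1 by have := sP i; lia.
have si1 : s (i + 1) = i by have := sP (i + 1); lia.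
have vne x : x \in v -> x <> - i /\ x <> i + 1.
  move=> xv; split=> e; first by have := vN _ vi; rewrite -e xv.
  by have := vN _ vi1; rewrite opprK -e xv.
have mono : {in v &, {mono s : x y / x < y}}.
  by move=> x y /vne ? /vne ?; have := sP x; have := sP y; lia.
have D1 pi : signed_atom z pi v -> z (i + 1) < z i.
  case=> MM D [_ A _]; have := D _ vi; have := D _ vi1.
  by rewrite /neg_pt zo; do 2![case: ifP]; lia.
have [[zi' zi1']|nN] : (z i = - i /\ z (i + 1) = - (i + 1)) \/
    ~ (z i = - i /\ z (i + 1) = - (i + 1)) by lia.
  have comm x : s (z x) = z (s x).
    have zx c : z x = c -> x = z c by move=> <-; rewrite zi.
    have := zx i; have := zx (i + 1); have := zx (- i); have := zx (- (i + 1)).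
    rewrite !zo zi' zi1'; have := sP (z x).
    have [[-> ->]|[[-> ->]|[[-> ->]|[[-> ->]|[? [? [? [? ->]]]]]]]] := sP x;
      rewrite ?zo ?zi' ?zi1'; have := sP i; have := sP (i + 1); have := sP (- i);
      have := sP (- (i + 1)); lia.
  have z'E := zc comm.
  have sN x : s x != x -> neg_pt z x.
    rewrite /neg_pt.
    have [[-> ->]|[[-> ->]|[[-> ->]|[[-> ->]|[? [? [? [? ->]]]]]]]] := sP x;
      rewrite ?zo ?zi' ?zi1'; lia.
  have adj x y : x < y -> y < s x -> ~~ neg_pt z y.
    by move=> xy yx; have := sP x; lia.
  split=> [[pi piP]|[_ [pi /(signed_atom_uncomm so sK zi sN z'E mono adj) A]]];
    last by eexists; exact: A.
  split; first exact: D1 piP.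
  exists pi; apply: (signed_atom_comm so sK zi sN z'E mono _ piP).
  have [MM D _] := piP.
  have Ni : neg_pt z i by apply: sN; rewrite si; lia.
  have Ni1 : neg_pt z (i + 1) by apply: sN; rewrite si1; lia.
  have [Np pp px po] := MM.1 _ Ni.
  have [Np1 pp1 px1 po1] := MM.1 _ Ni1.
  (* The letters [i] and [- (i + 1)] say that [i] opens a block and [i + 1] closes one; two
     different blocks would cross here. *)
  have pi1 : pi i = i + 1.
    have := D _ vi; have := D _ vi1; rewrite Ni po1.
    have -> : neg_pt z (- (i + 1)) by rewrite /neg_pt zo zi1'; lia.
    move=> h1 h2; have [//|ne] := eqVneq (pi i) (i + 1); exfalso.
    have ne2 : pi (i + 1) <> i by move=> e; move: pp1; rewrite e; lia.
    by apply: (MM.2 (pi (i + 1)) i); rewrite // ?pp1; lia.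
  have pi2 : pi (i + 1) = i by rewrite -pi1.
  move=> x.
  have [[-> ->]|[[-> ->]|[[-> ->]|[[-> ->]|[? [? [? [? ->]]]]]]]] := sP x; rewrite ?eqxx //.
    by rewrite po pi1.
  by rewrite po1 pi2.
(* In the remaining commuting cases both sides fail. If [z i = i + 1], the left side would make
   [i + 1] a letter, and on the right the letter [- i] is a negative fixed point of [z']. *)
have [[comm z10]|ncomm] : ((forall x, s (z x) = z (s x)) /\ (z i = i + 1 \/ ~ z (i + 1) < z i))
     \/ ~ (forall x, s (z x) = z (s x)).
  have [comm|] := pselect (forall x, s (z x) = z (s x)); last by right.
  left; split=> //; have := comm i; rewrite si; have := sP (z i); lia.
  have z'E := zc comm.
  split=> [[pi piP]|[zd [pi piP]]].
    have zii : z i = i + 1 by case: z10 => // /(_ (D1 _ piP)).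
    have [_ _ [_ I _]] := piP; have [+ _] := I _ vi.
    rewrite /fold_invol /neg_pt zii; case: ifP; first by lia.
    by move=> _ /vne; lia.
  have zii : z i = i + 1 by case: z10.
  have zii1 : z (i + 1) = i by rewrite -zii.
  have [_ D _] := piP; have := D _ (map_f s vi1).
  have -> : s (- (i + 1)) = - i by have := sP (- (i + 1)); lia.
  rewrite /neg_pt z'E (_ : s (- i) = - (i + 1)); last by have := sP (- i); lia.
  by rewrite zo zii1; case: ifP; lia.
have z'E := zn ncomm.
have n1 x : neg_pt z x -> neg_pt z (s x) -> s x = x.
  rewrite /neg_pt.
  by have [[-> ->]|[[-> ->]|[[-> ->]|[[-> ->]|[? [? [? [? ->]]]]]]]] := sP x;
    rewrite ?zo; lia.
have slt x y : x < y -> (y = s x -> s x = x) -> s x < s y.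
  by have := sP x; have := sP y; lia.
have sN : {in neg_pt z &, {homo s : x y / x < y}}.
  by move=> x y Nx Ny xy; apply: slt => // e; apply: n1; rewrite // -e.
split=> [[pi piP]|[zneg [pi piP]]].
  split; first exact: D1 piP.
  eexists; apply: (signed_atom_conj so sK z'E sN mono _ piP).
  have := D1 _ piP; have zii : z i = - (i + 1) -> z (i + 1) = - i.
    by move/(congr1 z); rewrite zi zo; lia.
  move=> lt x /vne ? _; have := sP x; have := sP (z x).
  have zx : x = i -> z x = z i by move->.
  by lia.
have z'E' x : z (s x) = s (z' x) by rewrite -[x in RHS]sK z'E sK.
eexists; rewrite -[v](mapK sK).
apply: (signed_atom_conj so sK z'E' _ _ _ piP).
- have N' x : neg_pt z' x -> neg_pt z (s x).
    rewrite /neg_pt z'E' -so (inj_eq (inv_inj sK)) => /andP [x0 ->].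
    by rewrite andbT; have := sP x; lia.
  move=> x y /N' Nx /N' Ny xy; apply: slt => // e.
  by have := n1 _ Nx; rewrite sK -{1}[x]sK -e => /(_ Ny).
- move=> _ _ /mapP [x xv ->] /mapP [y yv ->]; rewrite !sK.
  by rewrite mono.
- move=> _ /mapP [x /vne ? ->]; rewrite /neg_pt z'E !sK -so (inj_eq (inv_inj sK)).
  have zii : z i = - (i + 1) -> z (i + 1) = - i.
    by move/(congr1 z); rewrite zi zo; lia.
  have zx : x = i -> z x = z i by move->.
  have zx1 : x = - (i + 1) -> z x = - z (i + 1) by move=> ->; rewrite zo.
  have zii1 : z (i + 1) = - i -> z i = - (i + 1).
    by move/(congr1 z); rewrite zi zo; lia.
  by have := sP x; have := sP (z x); lia.
Qed.

End SignedSteps.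

(** * The Demazure product and the descent recursion for atoms *)

Section CoxeterLength.
Local Open Scope group_scope.
Variables (gT : finGroupType) (S : {set gT}).
Implicit Types s t u v w x y z : gT.

(* Products are MathComp's, so that [w * s] is the composite "s after w". *)
Record coxeter_length (len : gT -> nat) : Prop := CoxeterLength {
  cl_1 : len 1 = 0;
  cl_V : forall w, len w^-1 = len w;
  cl_gen : forall s, s \in S -> s * s = 1;
  cl_step : forall w s, s \in S ->
    len (w * s) = (len w).+1 \/ len w = (len (w * s)).+1;
  cl_descent : forall w, w != 1 -> exists2 s, s \in S & len (w * s) < len w;
  cl_exchange : forall w s t, s \in S -> t \in S -> len w < len (s * w) ->
    len w < len (w * t) -> len (s * w * t) < len (s * w) -> s * w = w * t }.

Variable len : gT -> nat.
Hypothesis lenP : coxeter_length len.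

Let mulA x y z : x * (y * z) = x * y * z. Proof. exact: mulgA. Qed.
Let invM x y : (x * y)^-1 = y^-1 * x^-1. Proof. exact: invMg. Qed.

Let len1 := cl_1 lenP.
Let lenV := cl_V lenP.
Let lenS := cl_step lenP.
Let lenE := cl_descent lenP.
Let exch := cl_exchange lenP.
Let sV s : s \in S -> s^-1 = s.
Proof. by move=> /(cl_gen lenP) e; rewrite -[RHS]mulg1 -(mulgV s) mulA e mul1g. Qed.
Let ssK s w : s \in S -> w * s * s = w.
Proof. by move=> sS; rewrite -mulA (cl_gen lenP sS) mulg1. Qed.
Let ssK' s w : s \in S -> s * (s * w) = w.
Proof. by move=> sS; rewrite mulA (cl_gen lenP sS) mul1g. Qed.
Let lenS' s w : s \in S -> len (s * w) = (len w).+1 \/ len w = (len (s * w)).+1.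
Proof. by move=> sS; rewrite -lenV -(lenV w) invM (sV sS); apply: lenS. Qed.
Let len_s s : s \in S -> len s = 1%N.
Proof. by move=> sS; have := lenS 1 sS; rewrite mul1g len1; lia. Qed.

Let len_ind (P : gT -> Prop) : P 1 ->
  (forall w s, s \in S -> len w < len (w * s) -> P w -> P (w * s)) -> forall w, P w.
Proof.
move=> P1 PS w; have [m] := ubnP (len w); elim: m w => // m IH w lw.
have [-> //|/lenE [s sS lt]] := eqVneq w 1.
by have := PS (w * s) s sS; rewrite ssK //; apply=> //; apply: IH; lia.
Qed.

Lemma cl_subadd v w : len (v * w) <= len v + len w.
Proof.
elim/len_ind: w => [|w s sS lt IH]; first by rewrite mulg1 len1 addn0.
by rewrite mulA; have := lenS (v * w) sS; have := lenS w sS; lia.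
Qed.

(** Beyond minimality one needs that the bounded search of [cox_length] reaches far enough. *)
Lemma cox_lengthE w : cox_length S w = len w.
Proof.
have in_le k u : u \in (S ^+ k) -> len u <= k.
  elim: k u => [|k IH] u; first by rewrite expg0 inE => /eqP ->; rewrite len1.
  rewrite expgSr => /mulsgP [v s /IH vk sS ->].
  have [->//|e] := lenS v sS; apply: leq_trans (leqW vk).
  by rewrite e leqnSn.
have len_in u : u \in (S ^+ len u).
  elim/len_ind: u => [|u s sS lt IH]; first by rewrite len1 expg0 inE.
  have -> : len (u * s) = (len u).+1 by have := lenS u sS; lia.
  by rewrite expgSr; apply: mem_mulg.
have mid u k : k <= len u -> exists v, len v = k.
  elim/len_ind: u => [|u s sS lt IH] ku; first by exists 1; rewrite len1 in ku *; lia.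
  have [/IH //|] := leqP k (len u); exists (u * s); have := lenS u sS; lia.
(* Every length up to [len w] is attained, so the group has more than [len w] elements. *)
have lt_card : len w < #|gT|.
  have /choice [g gP] : forall k : 'I_(len w).+1, exists v, len v = k.
    by move=> k; apply: (mid w); have := ltn_ord k; lia.
  have ginj : injective g by move=> i j e; apply/val_inj; rewrite -[LHS]gP e gP.
  by have := leq_card g ginj; rewrite card_ord.
rewrite /cox_length; set a := fun k => _.
have ha : has a (iota 0 #|gT|).
  by apply/hasP; exists (len w); [rewrite mem_iota|exact: len_in].
have k_lt := ha; rewrite has_find size_iota in k_lt.
have := nth_find 0 ha; rewrite nth_iota // add0n => /in_le le.
apply/eqP; rewrite eqn_leq le andbT leqNgt; apply/negP => lt.
have := before_find 0 lt; rewrite nth_iota; last exact: ltn_trans lt k_lt.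
by rewrite add0n /a len_in.
Qed.

(** In functional notation, [lmul s w] is the Demazure product of [s] and [w], and [rmul s w] that
    of [w] and [s]. *)
Definition lmul (s w : gT) := if len w < len (w * s) then w * s else w.
Definition rmul (s w : gT) := if len w < len (s * w) then s * w else w.

(** The critical case is that [w * s] and [t * w] are both longer than [w] while [t * w * s] is
    shorter than they are; the exchange property then gives [t * w = w * s]. *)
Lemma lmulC s t w : s \in S -> t \in S -> lmul s (rmul t w) = rmul t (lmul s w).
Proof.
move=> sS tS; rewrite /lmul /rmul.
have h1 := lenS w sS; have h2 := lenS' w tS.
have h3 := lenS (t * w) sS; have h4 := lenS' (w * s) tS; rewrite mulA in h4.
have [a|a] := ltnP (len w) (len (w * s)); have [b|b] := ltnP (len w) (len (t * w)); rewrite ?mulA.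
- have e := exch tS sS b a.
  have -> : (len (w * s) < len (t * w * s)) = (len (t * w) < len (t * w * s)) by lia.
  by case: ifP => // /negbT; rewrite -leqNgt => h; apply: e; lia.
- by rewrite a; case: ltnP => // ?; lia.
- by case: (ltnP (len (t * w))) => // ?; lia.
- by rewrite ltnNge a.
Qed.

Lemma lmulV s w : s \in S -> (lmul s w)^-1 = rmul s w^-1.
Proof.
move=> sS; have e : s * w^-1 = (w * s)^-1 by rewrite invM (sV sS).
by rewrite /lmul /rmul e !lenV; case: ifP.
Qed.

Lemma rmulV s w : s \in S -> (rmul s w)^-1 = lmul s w^-1.
Proof. by move=> sS; rewrite -[w in LHS]invgK -lmulV // invgK. Qed.

Lemma foldr_lmulC us vs w : all (mem S) us -> all (mem S) vs ->
  foldr lmul (foldr rmul w vs) us = foldr rmul (foldr lmul w us) vs.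
Proof.
move=> + vsS; elim: us => //= s us IH /andP [sS usS]; rewrite IH //.
elim: vs vsS {IH} => //= t vs IH /andP [tS vsS].
by rewrite lmulC // IH.
Qed.

Lemma lmul_word u : exists us, all (mem S) us && (foldr lmul 1 us == u).
Proof.
elim/len_ind: u => [|u s sS lt [us /andP [usS /eqP e]]]; first by exists [::]; rewrite eqxx.
by exists (s :: us); rewrite /= sS usS e /lmul lt eqxx.
Qed.

Lemma rmul_word u : exists us, all (mem S) us && (foldr rmul 1 us == u).
Proof.
have [us /andP [usS /eqP e]] := lmul_word u^-1; exists us; rewrite usS -[u]invgK -e /=.
elim: us {e} usS => [|s us IH /= /andP [sS /IH /eqP ->]]; first by rewrite invg1.
by rewrite lmulV.
Qed.

(* Associative and independent of the chosen word because the operators [lmul s]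
   and [rmul t] commute. *)
Definition hecke_mul (u v : gT) : gT := foldr lmul v (xchoose (lmul_word u)).

Lemma hecke_mulE u v us vs :
    all (mem S) us -> foldr lmul 1 us = u -> all (mem S) vs -> foldr rmul 1 vs = v ->
  hecke_mul u v = foldr lmul v us /\ hecke_mul u v = foldr rmul u vs.
Proof.
move=> usS ue vsS ve; have /andP [chS /eqP che] := xchooseP (lmul_word u).
by rewrite /hecke_mul -ve !foldr_lmulC // che ue.
Qed.

(** Existence of a Demazure product, which guarantees that [demazure] is not its default value. *)
Lemma hecke_mul_demazure : is_demazure_product S hecke_mul.
Proof.
have mulL s u v : s \in S -> len u < len (u * s) -> hecke_mul (u * s) v = lmul s (hecke_mul u v).
  move=> sS lt; have [us /andP [usS /eqP ue]] := lmul_word u.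
  have [vs /andP [vsS /eqP ve]] := rmul_word v.
  have [-> _] := hecke_mulE usS ue vsS ve.
  have ue' : foldr lmul 1 (s :: us) = u * s by rewrite /= ue /lmul lt.
  have usS' : all (mem S) (s :: us) by rewrite /= sS.
  by have [-> _] := hecke_mulE usS' ue' vsS ve.
have mul1 v : hecke_mul 1 v = v.
  have [vs /andP [vsS /eqP ve]] := rmul_word v.
  by have [] := @hecke_mulE 1 v [::] vs isT erefl vsS ve.
split.
(* Both bracketings apply the left operators of [u] and the right operators of [w] to [v], in
   different orders. *)
- move=> u v w.
  have [us /andP [usS /eqP ue]] := lmul_word u.
  have [vs /andP [vsS /eqP ve]] := rmul_word v.
  have [vs' /andP [vsS' /eqP ve']] := lmul_word v.
  have [ws /andP [wsS /eqP we]] := rmul_word w.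
  have [vw /andP [vwS /eqP vwe]] := rmul_word (hecke_mul v w).
  have [uv /andP [uvS /eqP uve]] := lmul_word (hecke_mul u v).
  rewrite (hecke_mulE usS ue vwS vwe).1 (hecke_mulE uvS uve wsS we).2.
  by rewrite (hecke_mulE usS ue vsS ve).1 (hecke_mulE vsS' ve' wsS we).2 foldr_lmulC.
- move=> s sS; have := mulL s 1 s sS; rewrite mul1g len1 (len_s sS) mul1 => ->//.
  by rewrite /lmul (cl_gen lenP sS) len1.
- move=> u v; rewrite !cox_lengthE /comp_mul.
  elim/len_ind: u => [_|u s sS lt IH e]; first by rewrite mul1 mulg1.
  rewrite mulL // IH; last first.
    by have := cl_subadd v u; rewrite mulA in e; have := lenS (v * u) sS; have := lenS u sS; lia.
  rewrite mulA in e *; rewrite /lmul; case: ifP => //.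
  by have := cl_subadd v u; have := lenS (v * u) sS; have := lenS u sS; lia.
Qed.

(** From here on [demazure] is handled through the axioms alone, whichever operation [pick]
    returns. *)
Lemma demazureP : is_demazure_product S (demazure S).
Proof.
rewrite /demazure; case: pickP => [op /asboolP //|none].
have [A I M] := hecke_mul_demazure.
suff : is_demazure_product S (fun u v => [ffun u => [ffun v => hecke_mul u v]] u v).
  by move=> /asboolP; have := none [ffun u => [ffun v => hecke_mul u v]] => /= ->.
split=> [u v w|s sS|u v e]; rewrite !ffunE.
- exact: A.
- exact: I.
- exact: M.
Qed.

Lemma demazureA u v w : demazure S u (demazure S v w) = demazure S (demazure S u v) w.
Proof. by case: demazureP. Qed.

Lemma demazure_mul u v : len (v * u) = (len u + len v)%N -> demazure S u v = v * u.
Proof. by case: demazureP => _ _ M e; apply: M; rewrite !cox_lengthE. Qed.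

Lemma demazure_lmul s w : s \in S -> demazure S s w = lmul s w.
Proof.
move=> sS; rewrite /lmul; have h := lenS w sS; case: ltnP => lt.
  by apply: demazure_mul; rewrite (len_s sS); lia.
have e : demazure S s (w * s) = w.
  rewrite demazure_mul; rewrite ssK // (len_s sS) add1n.
    by case: h => [h|->//]; rewrite h ltnn in lt.
by rewrite -{1}e demazureA; case: demazureP => _ -> // _; exact: e.
Qed.

Lemma demazure_rmul s w : s \in S -> demazure S w s = rmul s w.
Proof.
move=> sS; rewrite /rmul; have h := lenS' w sS; case: ltnP => lt.
  by apply: demazure_mul; rewrite (len_s sS); lia.
have e : demazure S (s * w) s = w.
  rewrite demazure_mul; rewrite ssK' // (len_s sS) addn1.
    by case: h => [h|->//]; rewrite h ltnn in lt.
by rewrite -{1}e -demazureA; case: demazureP => _ -> // _; exact: e.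
Qed.

(** For [v = w^-1] this is the product that defines the atoms [w]. *)
Definition hecke_square (v : gT) := demazure S v v^-1.

Lemma hecke_square1 : hecke_square 1 = 1.
Proof. by rewrite /hecke_square invg1 demazure_mul ?mulg1 // len1. Qed.

Lemma hecke_squareS v s : s \in S -> len v < len (v * s) ->
  hecke_square (v * s) = lmul s (rmul s (hecke_square v)).
Proof.
move=> sS lt; have h := lenS v sS.
have e1 : v * s = demazure S s v by rewrite demazure_lmul // /lmul lt.
have e2 : (v * s)^-1 = demazure S v^-1 s.
  by rewrite demazure_rmul // -lmulV // /lmul lt.
by rewrite /hecke_square e2 e1 -demazureA (demazureA v) (demazure_rmul _ sS) (demazure_lmul _ sS).
Qed.

Lemma hecke_squareV v : (hecke_square v)^-1 = hecke_square v.
Proof.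
elim/len_ind: v => [|v s sS lt IH]; first by rewrite hecke_square1 invg1.
by rewrite hecke_squareS // lmulV // rmulV // IH lmulC.
Qed.

(** For a descent [s] of an involution [z], this is the involution [y] below [z] from which Demazure
    multiplication by [s] on both sides gives back [z]. *)
Definition inv_down (z s : gT) := if s * z == z * s then z * s else s * z * s.

Let inv_len s y : s \in S -> y^-1 = y -> len (s * y) = len (y * s).
Proof. by move=> sS yV; rewrite -lenV invM yV (sV sS). Qed.

Lemma inv_up s y : s \in S -> y^-1 = y -> len y < len (y * s) ->
  let z := lmul s (rmul s y) in
  [/\ len (z * s) < len z, inv_down z s = y &
      (s * y = y * s /\ z = y * s) \/ (z = s * y * s /\ len z = (len y).+2)].
Proof.
move=> sS yV lt; have e := inv_len sS yV.
have h := lenS y sS; have h2 := lenS (s * y) sS.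
rewrite /=; have -> : rmul s y = s * y by rewrite /rmul e lt.
rewrite /lmul; have [lt2|lt2] := ltnP (len (s * y)) (len (s * y * s)).
  rewrite ssK //; split; [lia| |by right; split=> //; lia].
  have E1 : s * (s * y * s) = y * s by rewrite mulA ssK'.
  rewrite /inv_down E1 ssK //; case: eqP => [c|_]; last by rewrite ssK.
  by rewrite -c ssK // in lt2; lia.
have c : s * y = y * s by apply: exch => //; lia.
by rewrite c ssK //; split; [lia|rewrite /inv_down mulA c !ssK // eqxx|left].
Qed.

Lemma inv_downP s z : s \in S -> z^-1 = z -> len (z * s) < len z ->
  let y := inv_down z s in
  [/\ y^-1 = y, len y < len (y * s) & lmul s (rmul s y) = z].
Proof.
move=> sS zV lt; have e := inv_len sS zV; have h := lenS z sS.
rewrite /= /inv_down; case: eqP => [c|nc].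
  rewrite invM zV (sV sS) c ssK //; split=> //.
  by rewrite /rmul mulA c ssK // lt /lmul ltnNge ltnW.
have h2 := lenS (s * z) sS.
have lt2 : len (s * z * s) < len (s * z).
  rewrite ltnNge; apply/negP => le; apply: nc.
  have := @exch (s * z) s s sS sS; rewrite ssK' // => h3.
  by rewrite {2}h3 ?ssK //; lia.
rewrite !invM zV (sV sS) mulA ssK //; split=> //.
rewrite /rmul -!mulA ssK' // mulA -e lt2 /lmul.
by rewrite ssK // lt.
Qed.

(** * Rank of involutions and the recursion for inverse atoms *)

Section Rank.

(* [kappa] is a multiple of the absolute length of an involution: it makes
   [c * len + kappa] a rank function, whence all atoms have the same length. *)
Record coxeter_rank (c : nat) (kappa : gT -> nat) : Prop := CoxeterRank {
  cr_pos : 0 < c;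
  cr_1 : kappa 1 = 0;
  cr_conj : forall s y, s \in S -> kappa (s * y * s) = kappa y;
  cr_comm : forall s y, s \in S -> y^-1 = y -> s * y = y * s ->
    len y < len (y * s) -> kappa (y * s) = (kappa y + c)%N }.

Variables (c : nat) (kappa : gT -> nat).
Hypothesis kappaP : coxeter_rank c kappa.

Let rk y := (c * len y + kappa y)%N.

Let c_gt0 := cr_pos kappaP.

(** Either the length grows by 1 and [kappa] by [c], or the length grows by 2 and [kappa] stays; the
    total is [2 * c] in both cases. *)
Let rk_up s y : s \in S -> y^-1 = y -> len y < len (y * s) ->
  rk (lmul s (rmul s y)) = (rk y + c.*2)%N.
Proof.
move=> sS yV lt; have [_ _] := inv_up sS yV lt; have h := lenS y sS.
case=> [[comm ->]|[-> e]]; rewrite /rk.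
  by rewrite (cr_comm kappaP) // (_ : len (y * s) = (len y).+1) ?mulnS; lia.
by rewrite e (cr_conj kappaP) // !mulnS; lia.
Qed.

Let square_desc s y : s \in S -> y^-1 = y -> len (y * s) < len y -> lmul s (rmul s y) = y.
Proof.
move=> sS yV lt; rewrite /rmul inv_len // ltnNge ltnW //= /lmul.
by rewrite ltnNge ltnW.
Qed.

Let rk_le v : rk (hecke_square v) <= c.*2 * len v.
Proof.
elim/len_ind: v => [|v s sS lt IH]; first by rewrite hecke_square1 /rk len1 (cr_1 kappaP); lia.
have h := lenS v sS; rewrite hecke_squareS //; have yV := hecke_squareV v.
have [l|l] : len (hecke_square v) < len (hecke_square v * s) \/
    len (hecke_square v * s) < len (hecke_square v).
  by have := lenS (hecke_square v) sS; lia.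
  by rewrite rk_up // (_ : len (v * s) = (len v).+1) ?mulnS; lia.
by rewrite square_desc // (_ : len (v * s) = (len v).+1) ?mulnS; lia.
Qed.

Let rk_ex z : z^-1 = z -> exists v, hecke_square v = z /\ rk z = (c.*2 * len v)%N.
Proof.
have [m] := ubnP (len z); elim: m z => // m IH z lz zV.
have [->|/lenE [s sS lt]] := eqVneq z 1.
  by exists 1; rewrite hecke_square1 /rk len1 (cr_1 kappaP); split=> //; lia.
have [yV ly zE] := inv_downP sS zV lt; set y := inv_down z s in yV ly zE.
have rz := rk_up sS yV ly; rewrite zE in rz.
have ylt : len y < len z.
  have [_ _] := inv_up sS yV ly; rewrite zE => -[[_ e]|[_ ->]]; last exact: leqnSn.
  by rewrite [X in _ < len X]e.
have [v [vy vr]] := IH y (leq_trans ylt (ltnSE lz)) yV.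
have [lv|lv] : len v < len (v * s) \/ len (v * s) < len v by have := lenS v sS; lia.
  have lvs : len (v * s) = (len v).+1 by have := lenS v sS; lia.
  by exists (v * s); rewrite hecke_squareS // vy zE rz vr lvs mulnS addnC.
(* A descent [s] of [v] is impossible: either [s] would be a descent of [y], or [v * s] would have
   the same square [y] and violate [rk_le]. *)
have e : hecke_square v = lmul s (rmul s (hecke_square (v * s))).
  by rewrite -hecke_squareS // ssK.
have h := lenS v sS; have := rk_le (v * s).
have y'V := hecke_squareV (v * s).
have [l|l] : len (hecke_square (v * s)) < len (hecke_square (v * s) * s) \/
    len (hecke_square (v * s) * s) < len (hecke_square (v * s)).
  by have := lenS (hecke_square (v * s)) sS; lia.
  have [] := inv_up sS y'V l; rewrite -e vy; lia.
rewrite square_desc // in e; rewrite -e vy vr (_ : len v = (len (v * s)).+1) ?mulnS; lia.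
Qed.

(** The bound [rk_le] is attained over every involution by [rk_ex], so minimal length means equality
    in it. *)
Lemma atoms_invP z v : z^-1 = z ->
  reflect (hecke_square v = z /\ rk z = (c.*2 * len v)%N) (v \in atoms_inv S z).
Proof.
move=> zV; have vE : (v \in atoms_inv S z) = (v^-1 \in atoms S z).
  apply/imsetP/idP => [[w wa ->]|va]; first by rewrite invgK.
  by exists v^-1; rewrite // invgK.
rewrite vE inE invgK; apply: (iffP andP) => [[/eqP vz /forallP min]|[vz vr]].
  split=> //; have [u [uz ur]] := rk_ex zV.
  have := min u^-1; rewrite invgK -/(hecke_square u) uz eqxx /= !cox_lengthE !lenV.
  have := rk_le v; rewrite /hecke_square vz => h1 h2; apply/eqP; rewrite eqn_leq h1 ur.
  by rewrite leq_pmul2l //; lia.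
split; first exact/eqP; apply/forallP => u; apply/implyP => /eqP uz.
rewrite !cox_lengthE lenV; have := rk_le u^-1; rewrite /hecke_square invgK uz vr lenV.
by rewrite leq_pmul2l //; lia.
Qed.

Lemma atoms_inv1 z : z^-1 = z -> (1 \in atoms_inv S z) = (z == 1).
Proof.
move=> zV; apply/(atoms_invP _ zV)/eqP => [[<- _]|->]; first by rewrite hecke_square1.
by rewrite hecke_square1 /rk len1 (cr_1 kappaP); split=> //; lia.
Qed.

(** Equality in [rk_le] persists exactly when the stripped generator changes the rank by the full
    [2 * c], that is, when it is a descent of [z]. *)
Lemma atoms_inv_step z v s : z^-1 = z -> s \in S -> len (v * s) < len v ->
  (v \in atoms_inv S z) = (len (z * s) < len z) && (v * s \in atoms_inv S (inv_down z s)).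
Proof.
move=> zV sS lt; have h := lenS v sS.
have e : hecke_square v = lmul s (rmul s (hecke_square (v * s))).
  by rewrite -hecke_squareS // ssK.
have yV := hecke_squareV (v * s).
have lv : len v = (len (v * s)).+1 by lia.
apply/(atoms_invP _ zV)/andP => [[vz vr]|[zs]].
  have [l|l] : len (hecke_square (v * s)) < len (hecke_square (v * s) * s) \/
      len (hecke_square (v * s) * s) < len (hecke_square (v * s)).
    by have := lenS (hecke_square (v * s)) sS; lia.
    have := rk_up sS yV l; have [] := inv_up sS yV l.
    rewrite -e vz => zs zd _ rz; split=> //; apply/atoms_invP; rewrite zd //.
    by split=> //; move: vr; rewrite rz lv mulnS; lia.
  rewrite square_desc // in e; have := rk_le (v * s).
  by rewrite -e vz vr lv mulnS; lia.
have [yV' ly zE] := inv_downP sS zV zs; have rz := rk_up sS yV' ly; rewrite zE in rz.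
move=> /(atoms_invP _ yV') [vy vr]; rewrite e vy zE; split=> //.
by rewrite rz vr lv mulnS; lia.
Qed.

End Rank.

End CoxeterLength.

(** * Length by inversions in [S_n] and [W_n] *)

Section InversionSets.
Local Open Scope group_scope.
Variables (gT : finGroupType) (S : {set gT}) (T : finType).
Variables (val : T -> int) (act : gT -> T -> T) (wt : T -> T -> nat).
Implicit Types (s t u v w : gT) (x y : T) (p q : T * T).

Definition inverts w p : bool :=
  (val p.1 < val p.2)%R && (val (act w p.2) < val (act w p.1))%R.

(* The weights absorb the fact that a root of type B corresponds to one or to
   two pairs of points. *)
Record inversion_system (r : T -> T -> gT) : Prop := InversionSystem {
  is_val : injective val;
  is_1 : forall x, act 1 x = x;
  is_M : forall u v x, act (u * v) x = act v (act u x);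
  is_faithful : forall w, (forall x, act w x = x) -> w = 1;
  is_wt : forall w x y, wt (act w x) (act w y) = wt x y;
  is_sym : forall x y, wt x y = wt y x;
  is_gen : forall s, s \in S -> s * s = 1;
  is_two : forall s, s \in S -> \sum_(p | inverts s p) wt p.1 p.2 = 2;
  is_unif : forall w s p q, s \in S -> inverts s p -> inverts s q ->
    inverts w p = inverts w q;
  is_refl : forall s x y, s \in S -> inverts s (x, y) -> s = r x y;
  is_conj : forall w x y, r (act w x) (act w y) = w^-1 * r x y * w;
  is_adj : forall x y, (val x < val y)%R ->
    (forall z, ~~ (val x < val z < val y)%R) ->
    exists2 s, s \in S & inverts s (x, y) }.

Variable r : T -> T -> gT.
Hypothesis H : inversion_system r.

Definition inversion_weight w := (\sum_(p | inverts w p) wt p.1 p.2)%N.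

(** Multiplication by a generator changes the weight by exactly 2, whence the half. *)
Definition inversion_length w := (inversion_weight w)./2.

Let valI := is_val H.
Let actK w : cancel (act w) (act w^-1).
Proof. by move=> x; rewrite -(is_M H) mulgV (is_1 H). Qed.
Let actKV w : cancel (act w^-1) (act w).
Proof. by move=> x; rewrite -(is_M H) mulVg (is_1 H). Qed.
Let act_inj w : injective (act w) := can_inj (actK w).

Lemma inversion_weightV w : inversion_weight w^-1 = inversion_weight w.
Proof.
rewrite /inversion_weight; pose h p := (act w p.2, act w p.1).
rewrite (reindex h); last first.
  exists (fun p => (act w^-1 p.2, act w^-1 p.1)) => -[x y] _; rewrite /h /=.
    by rewrite !actK.
  by rewrite !actKV.
apply: eq_big => -[x y] /=; last by rewrite (is_wt H) (is_sym H).
by rewrite /inverts /= !actK andbC.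
Qed.

(** After reindexing by [s], the inversions of [s * w] become the symmetric difference of those of
    [w] and of [s], up to reversal of pairs. *)
Lemma inversion_weight_mul s w : s \in S ->
  inversion_weight (s * w) =
    (\sum_(p | inverts w p && ~~ inverts s p) wt p.1 p.2 +
     \sum_(p | inverts s p && ~~ inverts w p) wt p.1 p.2)%N.
Proof.
move=> sS; have ssK x : act s (act s x) = x by rewrite -(is_M H) (is_gen H sS) (is_1 H).
rewrite /inversion_weight (reindex (fun p => (act s p.1, act s p.2))); last first.
  by exists (fun p => (act s p.1, act s p.2)) => -[x y] _ /=; rewrite !ssK.
rewrite (bigID (fun p : T * T => (val p.1 < val p.2)%R)) /=; congr addn.
  apply: eq_big => -[x y]; last by rewrite /= (is_wt H).
  rewrite /inverts /= !(is_M H) !ssK.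
  have [xy|//] := ltP (val x) (val y); last by rewrite !andbF.
  have : val (act s x) != val (act s y).
    by apply/eqP => /valI/act_inj e; rewrite e ltxx in xy.
  by case: ltgtP; rewrite ?andbF ?andbT.
rewrite (reindex (fun p => (p.2, p.1))); last first.
  by exists (fun p => (p.2, p.1)) => -[x y].
apply: eq_big => -[x y]; last by rewrite /= (is_wt H) (is_sym H).
rewrite /inverts /= !(is_M H) !ssK.
have [xy|yx] := ltP (val x) (val y) => /=.
  rewrite (ltNge (val y)) (ltW xy) /= andbT; congr andb.
  have : val (act w x) != val (act w y).
    by apply/eqP => /valI/act_inj e; rewrite e ltxx in xy.
  by case: (ltgtP (val (act w x))).
move: yx; rewrite le_eqVlt => /orP [/eqP/valI ->|->]; last by rewrite andbF.
by rewrite !ltxx.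
Qed.

Lemma inversion_weight_step s w p : s \in S -> inverts s p ->
  if inverts w p then inversion_weight w = (inversion_weight (s * w)).+2
  else inversion_weight (s * w) = (inversion_weight w).+2.
Proof.
move=> sS sp; have two := is_two H sS.
have eqw q : inverts s q -> inverts w q = inverts w p.
  by move=> sq; apply: is_unif H _ _ _ _ sS sq sp.
rewrite inversion_weight_mul // [inversion_weight w]/inversion_weight.
rewrite (bigID (inverts s) (inverts w)) /=.
set W0 := (\sum_(q | inverts w q && ~~ _) _)%N.
have big0 (P : pred (T * T)) : P =1 xpred0 -> (\sum_(q | P q) wt q.1 q.2 = 0)%N.
  exact: big_pred0.
have big2 (P : pred (T * T)) : P =1 inverts s -> (\sum_(q | P q) wt q.1 q.2 = 2)%N.
  by move=> e; rewrite -two; apply: eq_bigl.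
case wp : (inverts w p); [rewrite big2 ?[X in (W0 + X)%N]big0 ?addn0 //|
  rewrite [X in (W0 + X)%N]big2 ?[X in (X + W0)%N]big0 ?addn2 //] => q /=;
  by case sq: (inverts s q); rewrite ?andbF // eqw // wp.
Qed.

Lemma inversion_pair s : s \in S -> exists x y, inverts s (x, y).
Proof.
move=> sS; have := is_two H sS; case: (pickP (inverts s)) => [[x y] sp _|none].
  by exists x, y.
by rewrite big_pred0.
Qed.

Lemma inversion_lengthE s w p : s \in S -> inverts s p ->
  (inversion_length (w * s) < inversion_length w)%N = inverts w^-1 p.
Proof.
move=> sS sp; have sV : s^-1 = s.
  by rewrite -[RHS]mulg1 -(mulgV s) mulgA (is_gen H sS) mul1g.
have := inversion_weight_step w^-1 sS sp.
rewrite inversion_weightV -[s in s * _]sV -invMg inversion_weightV /inversion_length.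
by case: ifP => _ ->; rewrite /= ?ltnSn // ltnNge leqnSn.
Qed.

(** Without inversions on neighbouring points [w] is increasing, and an increasing map would push a
    moved point in one direction forever, against the finite order of [w]. *)
Lemma inversion_monotone w :
  (forall s x y, s \in S -> inverts s (x, y) -> ~~ inverts w (x, y)) -> w = 1.
Proof.
move=> noinv.
have adj x y : (val x < val y)%R -> (forall z, ~~ (val x < val z < val y)%R) ->
    (val (act w x) < val (act w y))%R.
  move=> xy nz; have [s sS sp] := is_adj H xy nz.
  have := noinv _ _ _ sS sp; rewrite /inverts /= xy /= -leNgt le_eqVlt => /orP [|//].
  by move=> /eqP/valI/act_inj e; rewrite e ltxx in xy.
have mono x y : (val x < val y)%R -> (val (act w x) < val (act w y))%R.
  have [m] := ubnP `|val y - val x|%N; elim: m x y => // m IH x y lm xy.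
  case: (pickP (fun z => (val x < val z < val y)%R)) => [z /andP [xz zy]|nz].
    by apply: (@lt_trans _ _ (val (act w z))); apply: IH => //; lia.
  by apply: adj => // z; rewrite nz.
apply: is_faithful H _ _ => x; apply: valI.
have actX k z : act (w ^+ k.+1) z = act w (act (w ^+ k) z) by rewrite expgSr (is_M H).
case: (ltgtP (val (act w x)) (val x)) => // lt; exfalso.
  have dec k : (val (act (w ^+ k.+1) x) < val x)%R.
    elim: k => [|k IH]; first by rewrite expg1.
    by rewrite actX; apply: lt_trans (mono _ _ IH) lt.
  by have := dec #[w].-1; rewrite prednK ?order_gt0 // expg_order (is_1 H) ltxx.
have inc k : (val x < val (act (w ^+ k.+1) x))%R.
  elim: k => [|k IH]; first by rewrite expg1.
  by rewrite actX; apply: lt_trans lt (mono _ _ IH).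
by have := inc #[w].-1; rewrite prednK ?order_gt0 // expg_order (is_1 H) ltxx.
Qed.

Lemma inversion_coxeter_length : coxeter_length S inversion_length.
Proof.
split.
- rewrite /inversion_length /inversion_weight big_pred0 // => -[x y].
  by rewrite /inverts !(is_1 H) /=; case: ltgtP.
- by move=> w; rewrite /inversion_length inversion_weightV.
- exact: is_gen H.
- move=> w s sS; have [x [y sp]] := inversion_pair sS.
  have sV : s^-1 = s.
    by rewrite -[RHS]mulg1 -(mulgV s) mulgA (is_gen H sS) mul1g.
  have := inversion_weight_step w^-1 sS sp.
  rewrite inversion_weightV -[s in s * _]sV -invMg inversion_weightV /inversion_length.
  by case: ifP => _ ->; [right|left].
- move=> w wn1; have [[s [x [y [sS sp wp]]]]|no] :=
    pselect (exists s x y, [/\ s \in S, inverts s (x, y) & inverts w^-1 (x, y)]).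
    by exists s => //; rewrite (inversion_lengthE w sS sp).
  exfalso; move/eqP: wn1; apply; apply: invg_inj; rewrite invg1.
  apply: inversion_monotone => s x y sS sp; apply/negP => wp.
  by apply: no; exists s, x, y.
(* Exchange: [w^-1] keeps the pair of [t] in order and [s] inverts its image, so [s] is the
   reflection in that image, namely [w * t * w^-1]. *)
- move=> w s t sS tS _ wt_asc swt; have [x [y tp]] := inversion_pair tS.
  have h1 : ~~ inverts w^-1 (x, y).
    by rewrite -(inversion_lengthE w tS tp) -leqNgt ltnW.
  move: swt; rewrite (inversion_lengthE _ tS tp) => /andP [/= xy].
  have sV : s^-1 = s.
    by rewrite -[RHS]mulg1 -(mulgV s) mulgA (is_gen H sS) mul1g.
  rewrite invMg sV !(is_M H) => sxy.
  have uxy : (val (act w^-1 x) < val (act w^-1 y))%R.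
    move: h1; rewrite /inverts /= xy /= -leNgt le_eqVlt => /orP [|//].
    by move=> /eqP/valI/act_inj e; rewrite e ltxx in xy.
  have := is_refl H sS (x := act w^-1 x) (y := act w^-1 y).
  rewrite /inverts /= uxy sxy => /(_ isT); rewrite (is_conj H) -(is_refl H tS tp) invgK.
  by move=> ->; rewrite -!mulgA mulVg mulg1.
Qed.

End InversionSets.

Lemma val_tperm (T : finType) (val : T -> int) (x y z : T) : injective val ->
  val (tperm x y z) =
    if val z == val x then val y else if val z == val y then val x else val z.
Proof.
by move=> vI; rewrite !(inj_eq vI) permE /=; do !case: ifP.
Qed.

(** * Signed points and the generators of [W_n] *)

Section SignedPoints.
Variable n : nat.
Implicit Types (x y : pm n) (u v w : W n).

Lemma pm_valN x : pm_val (pm_opp x) = (- pm_val x)%R.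
Proof. by case: x => [[] i]; rewrite /pm_val /= ?opprK. Qed.

Lemma pm_oppK : involutive (@pm_opp n).
Proof. by case=> [[] i]. Qed.

Lemma pm_val_inj : injective (@pm_val n).
Proof.
case=> b i [c j]; rewrite /pm_val /= => e.
have -> : b = c by case: b c e => [] [] //; lia.
by congr pair; apply/val_inj => /=; case: b c e => [] []; lia.
Qed.

Lemma pm_val_range x : pm_val x <> 0%R /\ (`|pm_val x| <= n)%N.
Proof. by case: x => b i; have := ltn_ord i; rewrite /pm_val /=; case: b; lia. Qed.

Lemma pm_val_surj (x : int) : x <> 0%R -> (`|x| <= n)%N -> exists p : pm n, pm_val p = x.
Proof.
move=> x0 xn; have h : (`|x|.-1 < n)%N by lia.
by exists ((x < 0)%R, Ordinal h); rewrite /pm_val /=; case: ifP; lia.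
Qed.

Lemma W_funM u v x : W_fun (u * v)%g x = W_fun v (W_fun u x).
Proof. by rewrite /W_fun -permM -morphM ?inE. Qed.

Lemma W_fun1 x : W_fun 1%g x = x.
Proof. by rewrite /W_fun morph1 perm1. Qed.

Lemma W_funN w x : W_fun w (pm_opp x) = pm_opp (W_fun w x).
Proof. by have := subgP w; rewrite inE => /forallP/(_ x)/eqP. Qed.

Lemma W_fun_inj w : injective (W_fun w).
Proof. exact: perm_inj. Qed.

Lemma W_eqP u v : (forall x, W_fun u x = W_fun v x) -> u = v.
Proof. by move=> e; apply/val_inj/permP => x; apply: e. Qed.

Definition is_neg_one (s : W n) : Prop :=
  forall x, pm_val (W_fun s x) = neg_one (pm_val x).

Definition is_swap_abs (k : int) (s : W n) : Prop :=
  forall x, pm_val (W_fun s x) = swap_abs k (pm_val x).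

Lemma W_gensP s : s \in W_gens n ->
  (0 < n)%N /\ is_neg_one s \/
  exists k : int, [/\ (0 < k)%R, (k + 1 <= Posz n)%R & is_swap_abs k s].
Proof.
rewrite inE => /orP [/existsP [i /andP [/eqP i0 /eqP e]]|].
  have := ltn_ord i; rewrite i0 => n0; left; split=> // x.
  rewrite /W_fun e (val_tperm _ _ _ pm_val_inj) [pm_val (true, i)]/pm_val.
  rewrite [pm_val (false, i)]/pm_val /= i0.
  by have := neg_oneP (pm_val x); case: eqP => ?; [|case: eqP => ?]; lia.
move=> /existsP [i /existsP [j /andP [/eqP ij /eqP e]]]; right; exists (Posz i.+1).
have := ltn_ord j; split=> [//||x]; first by lia.
rewrite /W_fun e permM !(val_tperm _ _ _ pm_val_inj).
rewrite ![pm_val (_, _)]/pm_val /= ij.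
have := @swap_absP (Posz i.+1) (pm_val x) isT; have [x0 _] := pm_val_range x.
by case: (pm_val x =P (- (Posz i.+1))%R) => ?;
  [|case: (pm_val x =P (- (Posz i.+2))%R) => ?]; do 2?[case: eqP => ?]; lia.
Qed.

Lemma W_gen_neg_one : (0 < n)%N -> exists2 s, s \in W_gens n & is_neg_one s.
Proof.
move=> n0; pose i := Ordinal n0; pose t := tperm (true, i) (false, i).
have tW : t \in signed_perms n.
  rewrite inE; apply/forallP => x; apply/eqP/pm_val_inj.
  rewrite pm_valN !(val_tperm _ _ _ pm_val_inj) pm_valN ![pm_val (_, _)]/pm_val /=.
  by do 4?[case: eqP => ?]; lia.
exists (subg _ t); last first.
  move=> x; rewrite /W_fun subgK // (val_tperm _ _ _ pm_val_inj) ![pm_val (_, _)]/pm_val /=.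
  by have := neg_oneP (pm_val x); case: eqP => ?; [|case: eqP => ?]; lia.
by rewrite inE; apply/orP; left; apply/existsP; exists i; rewrite /= subgK // eqxx.
Qed.

Lemma W_gen_swap_abs (k : int) : (0 < k)%R -> (k + 1 <= Posz n)%R ->
  exists2 s, s \in W_gens n & is_swap_abs k s.
Proof.
case: k => [[|k]|k] // _ kn; have ki : (k < n)%N by lia.
have kj : (k.+1 < n)%N by lia.
pose i := Ordinal ki; pose j := Ordinal kj.
pose t := (tperm (true, i) (true, j) * tperm (false, i) (false, j))%g.
have tE x : pm_val (t x) = swap_abs (Posz k.+1) (pm_val x).
  rewrite permM !(val_tperm _ _ _ pm_val_inj) ![pm_val (_, _)]/pm_val /=.
  have := @swap_absP (Posz k.+1) (pm_val x) isT; have [x0 _] := pm_val_range x.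
  by case: (pm_val x =P (- (Posz k.+1))%R) => ?;
    [|case: (pm_val x =P (- (Posz k.+2))%R) => ?]; do 2?[case: eqP => ?]; lia.
have tW : t \in signed_perms n.
  rewrite inE; apply/forallP => x; apply/eqP/pm_val_inj.
  by rewrite pm_valN !tE pm_valN swap_absN.
exists (subg _ t); last by move=> x; rewrite /W_fun subgK.
rewrite inE; apply/orP; right; apply/existsP; exists i; apply/existsP; exists j.
by rewrite /= subgK // !eqxx.
Qed.

Lemma W_inverts_neg_one s p : is_neg_one s ->
  inverts (@pm_val n) (@W_fun n) s p = (pm_val p.1 == -1)%R && (pm_val p.2 == 1)%R.
Proof.
move=> sE; rewrite /inverts !sE.
have := neg_oneP (pm_val p.1); have := neg_oneP (pm_val p.2).
have := pm_val_range p.1; have := pm_val_range p.2.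
move: (pm_val p.1) (pm_val p.2) => a b; lia.
Qed.

Lemma W_inverts_swap_abs s k p : (0 < k)%R -> is_swap_abs k s ->
  inverts (@pm_val n) (@W_fun n) s p =
    ((pm_val p.1 == k) && (pm_val p.2 == k + 1) ||
     (pm_val p.1 == - (k + 1)) && (pm_val p.2 == - k))%R.
Proof.
move=> k0 sE; rewrite /inverts !sE.
have := swap_absP (pm_val p.1) k0; have := swap_absP (pm_val p.2) k0.
move: (pm_val p.1) (pm_val p.2) => a b; lia.
Qed.

End SignedPoints.

(** * The inversion system of [W_n] *)

Section SignedInstance.
Variable n : nat.
Implicit Types (x y : pm n) (u v w s : W n).

(** The pairs [(x, y)] and [(- y, - x)] belong to one root and coincide exactly when [y = - x]; with
    these weights every root counts twice. *)
Definition pm_wt x y : nat := if y == pm_opp x then 2 else 1.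

Definition W_refl x y : W n :=
  subg _ (if y == pm_opp x then tperm x y
          else tperm x y * tperm (pm_opp x) (pm_opp y))%g.

Lemma pm_opp_inj : injective (@pm_opp n).
Proof. exact: inv_inj (@pm_oppK n). Qed.

Lemma W_reflE x y z : W_fun (W_refl x y) z =
  (if y == pm_opp x then tperm x y
   else tperm x y * tperm (pm_opp x) (pm_opp y))%g z.
Proof.
have zE : (y == pm_opp x) = (pm_val y == - pm_val x)%R.
  by rewrite -pm_valN (inj_eq (@pm_val_inj n)).
rewrite /W_fun /W_refl subgK // inE; apply/forallP => {}z; apply/eqP/pm_val_inj.
have [x0 _] := pm_val_range x; have [y0 _] := pm_val_range y.
have [z0 _] := pm_val_range z; rewrite pm_valN zE.
case: (pm_val y =P - pm_val x)%R => [yx|yx].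
  rewrite !(val_tperm _ _ _ (@pm_val_inj n)) pm_valN; move: x0 y0 z0 yx; clear.
  by do 4?[case: eqP => ?]; lia.
rewrite !permM !(val_tperm _ _ _ (@pm_val_inj n)) !pm_valN; move: x0 y0 z0 yx; clear.
move: (pm_val x) (pm_val y) (pm_val z) => a b c.
have sw c' : exists d, (if c' == a then b else if c' == b then a else c') = d /\
   (c' = a /\ d = b \/ c' = b /\ d = a \/ c' <> a /\ c' <> b /\ d = c').
  by eexists; split; first reflexivity; do 2?[case: eqP => ?]; lia.
have [d [-> dP]] := sw c; have [e [-> eP]] := sw (- c)%R.
by move=> a0 b0 c0 ba; do 4?[case: eqP => ?]; lia.
Qed.

Lemma sum_pred2 (T : finType) (P : pred T) (F : T -> nat) a b :
  a != b -> P =1 [pred z | (z == a) || (z == b)] -> (\sum_(z | P z) F z = F a + F b)%N.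
Proof.
move=> ab PE; rewrite (bigD1 a) /=; last by rewrite PE /= eqxx.
congr addn; rewrite (big_pred1 b) // => z /=; rewrite PE /=.
by have [->|_] := eqVneq z a; rewrite /= ?andbT // (negPf ab).
Qed.

End SignedInstance.

Section SignedInstance.
Variable n : nat.
Implicit Types (x y : pm n) (u v w s : W n).

Lemma W_inversion_system : (0 < n)%N ->
  inversion_system (W_gens n) (@pm_val n) (@W_fun n) (@pm_wt n) (@W_refl n).
Proof.
move=> n0; have vI := @pm_val_inj n; split.
- exact: vI.
- exact: W_fun1.
- exact: W_funM.
- by move=> w wE; apply: W_eqP => x; rewrite wE W_fun1.
- by move=> w x y; rewrite /pm_wt -W_funN (inj_eq (@W_fun_inj n w)).
- by move=> x y; rewrite /pm_wt -(inj_eq (@pm_opp_inj n)) pm_oppK eq_sym.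
- move=> s /W_gensP [[_ sE]|[k [k0 kn sE]]]; apply: W_eqP => x; rewrite W_funM W_fun1;
    by apply: (vI); rewrite !sE ?neg_oneK ?swap_absK.
- move=> s /W_gensP [[_ sE]|[k [k0 kn sE]]].
    have [//|//|a aE] := @pm_val_surj n (-1)%R; have [//|//|b bE] := @pm_val_surj n 1.
    rewrite (big_pred1 (a, b)) => [|[x y]]; last first.
      by rewrite (W_inverts_neg_one _ sE) /= -aE -bE !(inj_eq vI) -pair_eqE.
    by rewrite /= /pm_wt -(inj_eq vI) pm_valN aE bE.
  have [||a aE] := @pm_val_surj n k; [lia..|].
  have [||b bE] := @pm_val_surj n (k + 1); [lia..|].
  have opp_eq x c : (pm_val x == - pm_val c)%R = (x == pm_opp c).
    by rewrite -pm_valN (inj_eq vI).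
  rewrite (@sum_pred2 _ _ _ (a, b) (pm_opp b, pm_opp a)) => [||[x y]]; last first.
  + rewrite (W_inverts_swap_abs _ k0 sE) /= -bE -{1 2}aE !opp_eq !(inj_eq vI) -!pair_eqE.
    by [].
  + by rewrite -pair_eqE /pair_eq /= -!(inj_eq vI) !pm_valN aE bE; lia.
  + by rewrite /= /pm_wt -!(inj_eq vI) !pm_valN aE bE; do 2?[case: eqP => ?]; lia.
- move=> w s p q /W_gensP [[_ sE]|[k [k0 kn sE]]].
    rewrite !(W_inverts_neg_one _ sE) => /andP [/eqP p1 /eqP p2] /andP [/eqP q1 /eqP q2].
    by congr (inverts _ _ _ _); case: p q p1 p2 q1 q2 => [a b] [c d] /= <- <- /vI -> /vI ->.
  rewrite !(W_inverts_swap_abs _ k0 sE).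
  have opp_inv a b c d : (pm_val c = - pm_val b)%R -> (pm_val d = - pm_val a)%R ->
      inverts (@pm_val n) (@W_fun n) w (a, b) = inverts (@pm_val n) (@W_fun n) w (c, d).
    rewrite -!pm_valN => /vI -> /vI ->.
    by rewrite /inverts /= !W_funN !pm_valN !ltrN2.
  case: p q => [a b] [c d] /= /orP [] /andP [/eqP a1 /eqP b1] /orP [] /andP [/eqP c1 /eqP d1].
  + by rewrite -c1 in a1; rewrite -d1 in b1; rewrite (vI _ _ a1) (vI _ _ b1).
  + by apply: opp_inv; lia.
  + by apply: opp_inv; lia.
  + by rewrite -c1 in a1; rewrite -d1 in b1; rewrite (vI _ _ a1) (vI _ _ b1).
- move=> s x y /W_gensP [[_ sE]|[k [k0 kn sE]]].
    rewrite (W_inverts_neg_one _ sE) /= => /andP [/eqP x1 /eqP y1].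
    apply: W_eqP => z; apply: (vI); rewrite sE W_reflE -(inj_eq vI) pm_valN x1 y1 /=.
    rewrite (val_tperm _ _ _ vI) x1 y1.
    by have := neg_oneP (pm_val z); do 2?[case: eqP => ?]; lia.
  rewrite (W_inverts_swap_abs _ k0 sE) /= => xyE.
  have nyx : (y == pm_opp x) = false by rewrite -(inj_eq vI) pm_valN; lia.
  apply: W_eqP => z; apply: (vI); rewrite sE W_reflE nyx permM !(val_tperm _ _ _ vI) !pm_valN.
  have := swap_absP (pm_val z) k0; move: (swap_abs k (pm_val z)) (pm_val z) => d c dP.
  have [z0 _] := pm_val_range z.
  case/orP: xyE => /andP [/eqP -> /eqP ->].
    case: (c =P k) => ?; [|case: (c =P (k + 1)%R) => ?]; do 2?[case: eqP => ?]; lia.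
  case: (c =P (- (k + 1))%R) => ?; [|case: (c =P (- k)%R) => ?]; do 2?[case: eqP => ?]; lia.
- move=> w x y; apply: W_eqP => z; rewrite !W_funM !W_reflE -W_funN (inj_eq (@W_fun_inj n w)).
  have [a ->] : exists a, z = W_fun w a.
    by exists (W_fun w^-1%g z); rewrite -W_funM mulVg W_fun1.
  rewrite -[W_fun w^-1%g _]W_funM mulgV W_fun1.
  have tw b c d : tperm (W_fun w b) (W_fun w c) (W_fun w d) = W_fun w (tperm b c d).
    by rewrite /W_fun -tpermJ permJ.
  by case: ifP => _; rewrite ?permM -?W_funN !tw.
- move=> x y xy nz.
  have [x0 xn] := pm_val_range x; have [y0 yn] := pm_val_range y.
  have nb c : c <> 0%R -> ~~ (pm_val x < c < pm_val y)%R.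
    move=> c0; apply/negP => cP; have [|p pE] := @pm_val_surj n c c0; first by lia.
    by have := nz p; rewrite pE cP.
  have h1 := nb (pm_val x + 1)%R; have h2 := nb (pm_val x + 2)%R.
  (* Zero is not a point, so neighbours are [-1, 1] or consecutive integers of the same sign. *)
  have [k|[k|k]] : (pm_val x = -1 /\ pm_val y = 1)%R \/
    (0 < pm_val x /\ pm_val y = pm_val x + 1)%R \/
    (0 < - pm_val y /\ pm_val x = pm_val y - 1)%R by lia.
  + have [s sS sE] := W_gen_neg_one n0; exists s => //.
    by rewrite (W_inverts_neg_one _ sE) /= k.1 k.2.
  + have [||s sS sE] := @W_gen_swap_abs n (pm_val x); [lia..|].
    by exists s => //; rewrite (W_inverts_swap_abs _ k.1 sE) /= k.2 !eqxx.
  + have [||s sS sE] := @W_gen_swap_abs n (- pm_val y)%R; [lia..|].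
    by exists s => //; rewrite (W_inverts_swap_abs _ k.1 sE) /= k.2; lia.
Qed.


End SignedInstance.

(** * The inversion system and the rank function of [S_n] *)

Section SymmetricInstance.
Variable n : nat.
Implicit Types (s w y : 'S_n) (i j : 'I_n).

Definition ord_val i : int := Posz i.+1.

Definition swap_int (k x : int) : int :=
  (if x == k then k + 1 else if x == k + 1 then k else x)%R.

Definition is_swap_int (k : int) (s : 'S_n) : Prop :=
  forall i, ord_val (s i) = swap_int k (ord_val i).

Lemma ord_val_inj : injective ord_val.
Proof. by move=> i j [/val_inj]. Qed.

Lemma ord_val_surj (x : int) : (0 < x)%R -> (x <= Posz n)%R -> exists i, ord_val i = x.
Proof.
case: x => [[|k]|k] // _ kn; have h : k < n by lia.
by exists (Ordinal h).
Qed.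

Lemma swap_intP k x : (x = k /\ swap_int k x = k + 1 \/ x = k + 1 /\ swap_int k x = k \/
  x <> k /\ x <> k + 1 /\ swap_int k x = x)%R.
Proof. by rewrite /swap_int; do 2?[case: eqP => ?]; lia. Qed.

Lemma swap_intK k : involutive (swap_int k).
Proof. by move=> x; have := swap_intP k x; have := swap_intP k (swap_int k x); lia. Qed.

Lemma S_gensP s : s \in S_gens n ->
  exists k : int, [/\ (0 < k)%R, (k + 1 <= Posz n)%R & is_swap_int k s].
Proof.
rewrite inE => /existsP [i /existsP [j /andP [/eqP ij /eqP ->]]].
exists (Posz i.+1); have := ltn_ord j; split=> [//||x]; first by lia.
by rewrite (val_tperm _ _ _ ord_val_inj) /ord_val /swap_int ij; do 4?[case: eqP => ?]; lia.
Qed.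

Lemma S_gen_swap_int (k : int) : (0 < k)%R -> (k + 1 <= Posz n)%R ->
  exists2 s, s \in S_gens n & is_swap_int k s.
Proof.
case: k => [[|k]|k] // _ kn; have ki : (k < n)%N by lia.
have kj : (k.+1 < n)%N by lia.
pose i := Ordinal ki; pose j := Ordinal kj.
exists (tperm i j).
  by rewrite inE; apply/existsP; exists i; apply/existsP; exists j; rewrite /= !eqxx.
move=> x; rewrite (val_tperm _ _ _ ord_val_inj) /ord_val /swap_int /=.
by do 4?[case: eqP => ?]; lia.
Qed.

Lemma S_inverts s k p : is_swap_int k s ->
  inverts ord_val (fun w i => w i) s p = ((ord_val p.1 == k) && (ord_val p.2 == k + 1))%R.
Proof.
move=> sE; rewrite /inverts !sE.
have := swap_intP k (ord_val p.1); have := swap_intP k (ord_val p.2).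
move: (ord_val p.1) (ord_val p.2) => a b; lia.
Qed.

Lemma S_inversion_system :
  inversion_system (S_gens n) ord_val (fun w i => w i) (fun _ _ => 2) (@tperm _).
Proof.
have vI := ord_val_inj; split.
- exact: vI.
- exact: perm1.
- exact: permM.
- by move=> w wE; apply/permP => x; rewrite wE perm1.
- by [].
- by [].
- move=> s /S_gensP [k [k0 kn sE]]; apply/permP => x; rewrite permM perm1.
  by apply: (vI); rewrite !sE swap_intK.
- move=> s /S_gensP [k [k0 kn sE]].
  have [||a aE] := @ord_val_surj k; [lia..|].
  have [||b bE] := @ord_val_surj (k + 1)%R; [lia..|].
  rewrite (big_pred1 (a, b)) // => -[x y].
  by rewrite (S_inverts _ sE) /= -bE -{1}aE !(inj_eq vI) -pair_eqE.
- move=> w s p q /S_gensP [k [k0 kn sE]].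
  rewrite !(S_inverts _ sE) => /andP [/eqP p1 /eqP p2] /andP [/eqP q1 /eqP q2].
  by case: p q p1 p2 q1 q2 => [a b] [c d] /= <- <- /vI -> /vI ->.
- move=> s x y /S_gensP [k [k0 kn sE]].
  rewrite (S_inverts _ sE) /= => /andP [/eqP x1 /eqP y1].
  apply/permP => z; apply: (vI); rewrite sE (val_tperm _ _ _ vI) x1 y1.
  by rewrite /swap_int.
- by move=> w x y; rewrite -tpermJ conjgE mulgA.
- move=> x y xy nz.
  have [||z zE] := @ord_val_surj (ord_val x + 1)%R.
  + by rewrite /ord_val; lia.
  + by have := ltn_ord y; move: xy; rewrite /ord_val; lia.
  have := nz z; rewrite zE => h.
  have [||s sS sE] := @S_gen_swap_int (ord_val x).
  + by rewrite /ord_val; lia.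
  + by have := ltn_ord y; move: xy; rewrite /ord_val; lia.
  by exists s => //; rewrite (S_inverts _ sE) /= eqxx /=; lia.
Qed.

(** For an involution, twice the number of 2-cycles. A commuting ascent creates one 2-cycle, which
    explains the constant 2 below. *)
Definition S_moved w : nat := \sum_i (w i != i).

Lemma S_coxeter_rank :
  coxeter_rank (S_gens n) (inversion_length ord_val (fun w i => w i) (fun _ _ => 2)) 2 S_moved.
Proof.
have SS := S_inversion_system; split=> //.
- by rewrite /S_moved big1 // => i _; rewrite perm1 eqxx.
- move=> s y sS; rewrite /S_moved (reindex_inj (@perm_inj _ s)) /=.
  apply: eq_bigr => i _; rewrite !permM -[s (s i)]permM (is_gen SS sS) perm1.
  by rewrite (inj_eq perm_inj).
- move=> s y sS yV comm lt; have [k [k0 kn sE]] := S_gensP sS.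
  have [||a aE] := @ord_val_surj k; [lia..|].
  have [||b bE] := @ord_val_surj (k + 1)%R; [lia..|].
  have sab : inverts ord_val (fun w i => w i) s (a, b).
    by rewrite (S_inverts _ sE) /= aE bE !eqxx.
  have /negP : ~~ inverts ord_val (fun w i => w i) y^-1%g (a, b).
    by rewrite -(inversion_lengthE SS y sS sab) -leqNgt ltnW.
  rewrite yV /inverts /= aE bE; have -> : (k < k + 1)%R by lia.
  move=> /negP; rewrite /= -leNgt => yab.
  have cE i : y (s i) = s (y i) by rewrite -!permM comm.
  have sa : s a = b by apply: ord_val_inj; rewrite sE aE bE; have := swap_intP k k; lia.
  have yb : y b = s (y a) by rewrite -cE sa.
  (* An ascent excludes that [y] exchanges [a] and [b]; if [y a] were outside [{a, b}], commutation
     would give [y b = y a]. *)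
  have [ya|ya] : y a = a \/ y a <> a by have [|/eqP] := eqVneq (y a) a; [left|right].
    have yb' : y b = b by rewrite yb ya sa.
    have moved i : (s i != i) = (i == a) || (i == b).
      rewrite -!(inj_eq ord_val_inj) sE aE bE.
      by have := swap_intP k (ord_val i); lia.
    have -> : 2 = \sum_i (s i != i).
      have -> : \sum_i (s i != i) = \sum_(i | s i != i) 1.
        by rewrite [RHS]big_mkcond /=; apply: eq_bigr => i _; case: ifP.
      by rewrite (@sum_pred2 _ _ _ a b) // -(inj_eq ord_val_inj) aE bE; lia.
    rewrite /S_moved -big_split /=; apply: eq_bigr => i _; rewrite permM.
    have [e|/[dup] ne] := eqVneq (s i) i.
      by rewrite addn0 -{2}e -cE e.
    rewrite moved => /orP [] /eqP e; move: ne; rewrite e ?ya ?yb' => ne.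
      by rewrite ne eqxx.
    by rewrite ne eqxx.
  have vya : ord_val (y a) <> k by rewrite -aE => /ord_val_inj.
  have : ord_val (y b) = ord_val (y a).
    by have := swap_intP k (ord_val (y a)); have := sE (y a); rewrite -yb; lia.
  by move=> /ord_val_inj/perm_inj ba; move: bE; rewrite ba aE; lia.
Qed.

End SymmetricInstance.

(** * The rank function of [W_n] *)

Section SignedRank.
Variable n : nat.
Hypothesis n0 : (0 < n)%N.
Implicit Types (x a b : pm n) (y w s : W n).

(** For an involution, four times the reflection length: a negated pair [{x, - x}] contributes 2 +
    2, and a 2-cycle with its distinct opposite contributes 4. *)
Definition W_moved w : nat :=
  \sum_x ((W_fun w x != x) + (W_fun w x == pm_opp x)).

Notation W_len := (inversion_length (@pm_val n) (@W_fun n) (@pm_wt n)).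

Let SS := W_inversion_system n0.

Lemma W_moved_gen s : s \in W_gens n -> W_moved s = 4.
Proof.
have vI := @pm_val_inj n; have nopp x : (pm_opp x == x) = false by case: x => [[] i]; apply/eqP.
move=> /W_gensP [[_ sE]|[k [k0 kn sE]]].
  have [//|//|b bE] := @pm_val_surj n 1; pose a := pm_opp b.
  have aE : pm_val a = (-1)%R by rewrite pm_valN bE.
  have mv x : (W_fun s x != x) = (x == a) || (x == b).
    rewrite -!(inj_eq vI) sE aE bE; have := neg_oneP (pm_val x).
    by have := pm_val_range x; lia.
  rewrite /W_moved (bigID (fun x => (x == a) || (x == b))) /=.
  rewrite [X in (_ + X)%N]big1 ?addn0 => [|x]; last first.
    by rewrite -mv negbK => /eqP ->; rewrite eqxx eq_sym nopp.
  rewrite (@sum_pred2 _ _ _ a b) //; last by rewrite nopp.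
  rewrite !mv !eqxx orbT /= -!(inj_eq vI) !sE !pm_valN ?aE bE.
  by [].
have [||a aE] := @pm_val_surj n k; [lia..|].
have [||b bE] := @pm_val_surj n (k + 1)%R; [lia..|].
have mv x : (W_fun s x != x) = [|| x == a, x == b, x == pm_opp a | x == pm_opp b].
  rewrite -!(inj_eq vI) sE !pm_valN aE bE; have := swap_absP (pm_val x) k0; lia.
have no x : (W_fun s x == pm_opp x) = false.
  rewrite -!(inj_eq vI) sE !pm_valN; have := swap_absP (pm_val x) k0.
  by have := pm_val_range x; lia.
have -> : W_moved s = \sum_(x | [|| x == a, x == b, x == pm_opp a | x == pm_opp b]) 1.
  by rewrite [RHS]big_mkcond /=; apply: eq_bigr => x _; rewrite mv no addn0; case: ifP.
rewrite (bigD1 a) /= ?eqxx // (bigD1 b) /=; last first.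
  by rewrite eqxx orbT /= -(inj_eq vI) aE bE; lia.
rewrite (@sum_pred2 _ _ _ (pm_opp a) (pm_opp b)) // => [|x].
  by rewrite -!(inj_eq vI) !pm_valN aE bE; lia.
by rewrite /= -!(inj_eq vI) !pm_valN aE bE; lia.
Qed.

(** The identity holds point by point. At a point moved by [s], either [y] fixes it, or [y] sends it
    to the opposite of its image under [s] and the product negates it; the double weight of negated
    points makes the second case balance. *)
Lemma W_moved_comm s y : s \in W_gens n -> y^-1%g = y -> (s * y = y * s)%g ->
  W_len y < W_len (y * s)%g -> W_moved (y * s)%g = W_moved y + W_moved s.
Proof.
move=> sS yV comm lt; have vI := @pm_val_inj n.
have nopp x : (pm_opp x == x) = false by case: x => [[] i]; apply/eqP.
have cE x : W_fun y (W_fun s x) = W_fun s (W_fun y x) by rewrite -!W_funM comm.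
have ssK x : W_fun s (W_fun s x) = x by rewrite -W_funM (is_gen SS sS) W_fun1.
rewrite /W_moved -big_split /=; apply: eq_bigr => x _; rewrite W_funM.
have [e|ne] := eqVneq (W_fun s x) x.
  by rewrite -cE e [x == _]eq_sym nopp !addn0.
suff : W_fun y x = x \/ W_fun y x = pm_opp (W_fun s x) /\ W_fun s x != pm_opp x.
  case=> [->|[-> nsx]]; first by rewrite ne eqxx [x == _]eq_sym nopp.
  rewrite W_funN ssK nopp eqxx (inj_eq (@pm_opp_inj n)) ?(negPf ne) (negPf nsx).
  by rewrite -(inj_eq (@pm_opp_inj n)) pm_oppK (negPf nsx).
have asc a b : inverts (@pm_val n) (@W_fun n) s (a, b) -> (pm_val a < pm_val b)%R ->
    (pm_val (W_fun y a) <= pm_val (W_fun y b))%R.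
  move=> sab ab; have : ~~ inverts (@pm_val n) (@W_fun n) y^-1%g (a, b).
    by rewrite -(inversion_lengthE SS y sS sab) -leqNgt ltnW.
  by rewrite yV /inverts /= ab /= -leNgt.
case: (W_gensP sS) => [[_ sE]|[k [k0 kn sE]]].
  left; have [//|//|b bE] := @pm_val_surj n 1.
  have obE : pm_val (pm_opp b) = (-1)%R by rewrite pm_valN bE.
  have sb : W_fun s b = pm_opp b by apply: (vI); rewrite sE bE obE.
  have sab : inverts (@pm_val n) (@W_fun n) s (pm_opp b, b).
    by rewrite (W_inverts_neg_one _ sE) /= obE bE.
  have := asc _ _ sab; rewrite obE bE W_funN pm_valN => /(_ isT) yb0.
  have yb : W_fun y b = b.
    apply: (vI); rewrite bE; have := cE b; rewrite sb W_funN.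
    move=> /(congr1 (@pm_val n)); rewrite pm_valN sE; have := neg_oneP (pm_val (W_fun y b)).
    by have := pm_val_range (W_fun y b); lia.
  have [->//|->] : x = b \/ x = pm_opp b.
    move: ne; rewrite -(inj_eq vI) sE => ne.
    have [xE|xE] : pm_val x = 1%R \/ pm_val x = (-1)%R.
      by have := neg_oneP (pm_val x); lia.
    + by left; apply: (vI); rewrite bE.
    + by right; apply: (vI); rewrite obE.
  by rewrite W_funN yb.
have [||a aE] := @pm_val_surj n k; [lia..|].
have [||b bE] := @pm_val_surj n (k + 1)%R; [lia..|].
have sab : inverts (@pm_val n) (@W_fun n) s (a, b).
  by rewrite (W_inverts_swap_abs _ k0 sE) /= aE bE !eqxx.
have kk : (k < k + 1)%R by lia.
have := asc _ _ sab; rewrite aE bE => /(_ kk) yab.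
have sa : W_fun s a = b by apply: (vI); rewrite sE aE bE; have := swap_absP k k0; lia.
have sb : W_fun s b = a by rewrite -sa ssK.
have yb : W_fun y b = W_fun s (W_fun y a) by rewrite -cE sa.
have nab : pm_val (W_fun y b) <> pm_val (W_fun y a).
  by move=> /(vI)/(@W_fun_inj n y) e; move: bE; rewrite e aE; lia.
have nsx : W_fun s x != pm_opp x.
  rewrite -(inj_eq vI) sE pm_valN; have := swap_absP (pm_val x) k0.
  by have := pm_val_range x; lia.
have ya : pm_val (W_fun y a) = k \/ pm_val (W_fun y a) = (- (k + 1))%R.
  move: nab yab; rewrite yb sE.
  by have := swap_absP (pm_val (W_fun y a)) k0; lia.
have xP : [\/ x = a, x = b, x = pm_opp a | x = pm_opp b].
  move: ne; rewrite -(inj_eq vI) sE => ne.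
  have : pm_val x = k \/ pm_val x = (k + 1)%R \/ pm_val x = (- k)%R \/ pm_val x = (- (k + 1))%R.
    by have := swap_absP (pm_val x) k0; lia.
  by case=> [|[|[|]]] e; [constructor 1|constructor 2|constructor 3|constructor 4];
    apply: (vI); rewrite ?pm_valN ?aE ?bE.
case: ya => yaE.
  have ya : W_fun y a = a by apply: (vI); rewrite yaE aE.
  left; rewrite ya sa in yb.
  by case: xP => ->; rewrite ?W_funN ?ya ?yb.
have ya : W_fun y a = pm_opp b by apply: (vI); rewrite yaE pm_valN bE.
right; split=> //; rewrite ya W_funN sb in yb.
by case: xP => ->; rewrite ?W_funN ?ya ?yb ?sa ?sb.
Qed.

Lemma W_coxeter_rank : coxeter_rank (W_gens n) W_len 4 W_moved.
Proof.
split=> //.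
- rewrite /W_moved big1 // => x _; rewrite W_fun1 eqxx.
  by have -> : (x == pm_opp x) = false by case: x => [[] i]; apply/eqP.
- move=> s y sS; rewrite /W_moved (reindex_inj (@W_fun_inj n s)) /=.
  apply: eq_bigr => x _; rewrite !W_funM -[W_fun s (W_fun s x)]W_funM (is_gen SS sS) W_fun1.
  by rewrite -W_funN !(inj_eq (@W_fun_inj n s)).
- by move=> s y sS yV c lt; rewrite W_moved_comm // (W_moved_gen sS).
Qed.

End SignedRank.

(** * One-line words of inverse atoms *)

Section IntExtension.
Variables (T : finType) (val : T -> int).
Hypothesis valI : injective val.
Implicit Types g h : T -> T.

(** The conditions on words speak of maps on [int]; extension by the identity respects composition,
    hence involutions and commutation. *)
Definition int_ext g (x : int) : int :=
  if [pick p | val p == x] is Some p then val (g p) else x.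

Lemma int_extE g p : int_ext g (val p) = val (g p).
Proof.
rewrite /int_ext; case: pickP => [q /eqP/valI -> //|/(_ p)].
by rewrite eqxx.
Qed.

Lemma int_ext_out g x : (forall p, val p <> x) -> int_ext g x = x.
Proof. by rewrite /int_ext => nx; case: pickP => // p /eqP/nx. Qed.

Lemma int_ext_ind (P : int -> Prop) :
  (forall p, P (val p)) -> (forall x, (forall p, val p <> x) -> P x) -> forall x, P x.
Proof.
move=> Pv Px x; have [[p <-]|np] := pselect (exists p, val p = x); first exact: Pv.
by apply: Px => p pE; apply: np; exists p.
Qed.

Lemma int_ext_comp g h k : (forall p, k p = h (g p)) ->
  forall x, int_ext k x = int_ext h (int_ext g x).
Proof.
move=> kE; elim/int_ext_ind => [p|x nx]; first by rewrite !int_extE kE.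
by rewrite !int_ext_out.
Qed.

Lemma int_ext_id g : (forall p, g p = p) -> forall x, int_ext g x = x.
Proof.
by move=> gE; elim/int_ext_ind => [p|x nx]; rewrite ?int_extE ?gE ?int_ext_out.
Qed.

Lemma int_ext_eq g h : int_ext g =1 int_ext h -> g =1 h.
Proof. by move=> e p; apply: valI; rewrite -!int_extE e. Qed.

End IntExtension.

Lemma inv_downV (gT : finGroupType) (z s : gT) :
  (s * s = 1 -> z^-1 = z -> (inv_down z s)^-1 = inv_down z s)%g.
Proof.
move=> ss zV; have sV : (s^-1 = s)%g by rewrite -[RHS]mulg1 -(mulgV s) mulgA ss mul1g.
by rewrite /inv_down; case: eqP => [c|_]; rewrite !invMg zV sV ?mulgA // c.
Qed.

(** The counterpart of [atoms_inv_step] on words, with [z'] in the role of [inv_down z s]. *)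
Lemma atom_word_step (z z' s : int -> int) (k : int) (v : seq int) :
    involutive z -> involutive s -> uniq v -> k \in v -> (k + 1)%R \in v ->
    swap_on (fun x => x \in v) k s -> (index (k + 1)%R v < index k v)%N ->
    (z k = (k + 1)%R -> forall x, s (z x) = z (s x)) ->
    ((forall x, s (z x) = z (s x)) -> forall x, z' x = z (s x)) ->
    (~ (forall x, s (z x) = z (s x)) -> forall x, z' (s x) = s (z x)) ->
  atom_word z v <-> (z (k + 1) < z k)%R /\ atom_word z' (map s v).
Proof.
move=> zi si uv vk vk1 sP kd zkc zc zn.
have sk : s k = (k + 1)%R by case: (sP _ vk) => [[]|[]|[]]; lia.
have sv x : x \in v -> s x \in v.
  by move=> xv; case: (sP _ xv) => [[_ ->]|[_ ->]|[_ _ ->]].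
have svE x : (x \in map s v) = (x \in v).
  apply/mapP/idP => [[y yv ->]|xv]; first exact: sv.
  by exists (s x); rewrite ?sv ?si.
have pinj x y : x \in v -> y \in v -> index x v = index y v -> x = y.
  by move=> xv yv; apply: index_inj.
suff E : (z (k + 1) < z k)%R -> invol_on (fun x => x \in v) z ->
    (atom_word z v <-> atom_word z' (map s v)).
  split=> [A|[d A]].
    have [_ I A'] := A; have d := atom_order_descent I vk vk1 sP kd A'.
    by split=> //; apply/E.
  apply/E => // x xv; split=> //; have [_ I _] := A.
  have := I (s x); rewrite !svE => /(_ (sv _ xv)) [+ _].
  have [c|nc] := pselect (forall x, s (z x) = z (s x)).
    by rewrite zc // si.
  by rewrite zn // => /sv; rewrite si.
move=> d I; apply: (atom_word_swap uv I vk vk1 sP kd d) => [zk|zk x xv].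
  have c := zkc zk; have zk1 : z (k + 1)%R = k by rewrite -zk zi.
  have sk1 : s (k + 1)%R = k by rewrite -sk si.
  split=> [||x xv x1 x2]; rewrite zc //; first by rewrite sk zk1.
    by rewrite sk1.
  by case: (sP _ xv) => [[]|[]|[_ _ ->]].
have [c|nc] := pselect (forall x, s (z x) = z (s x)); last by rewrite zn.
exfalso; have := c k; rewrite sk; case: (sP _ (I _ vk).1) => [[]|[]|[]]; lia.
Qed.

(** A positive negated letter [x] would be in the same cycle as [- pi x], which is negative because
    [x < pi x]. So there are no negated points, and the empty matching is the only datum. *)
Lemma signed_atom_pos (z : int -> int) (v : seq int) :
    (forall x, z (- x) = - z x)%R -> {in v, forall x, 0 < x}%R ->
    (forall x, neg_pt z x -> (x \in v) || (- x \in v)%R) ->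
  (exists pi, signed_atom z pi v) <-> atom_word z v.
Proof.
move=> zo vp vN; split=> [[pi [MM D A]]|A].
  have [_ I _] := A; apply: eq_atom_word A => x xv; rewrite /fold_invol; case: ifP => // Nx.
  have := D _ xv; rewrite Nx => lt; have [+ _] := I _ xv.
  by rewrite /fold_invol Nx => /vp; have := vp _ xv; lia.
have [_ I _] := A; have noN x : neg_pt z x = false.
  apply/negP => Nx; have /orP [xv|xv] := vN _ Nx; have := vp _ xv; have := vp _ (I _ xv).1;
    have /andP [_ /eqP e] := Nx; rewrite ?zo e; lia.
exists id; split.
- by split=> x; rewrite noN.
- by move=> x xv; rewrite noN; have := vp _ xv; have := vp _ (I _ xv).1; lia.
- by apply: eq_atom_word A => x _; rewrite /fold_invol noN.
Qed.

Section FinWords.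
Variables (n : nat) (f : 'I_n -> int).
Hypothesis fI : injective f.

Lemma size_ord_word : size [seq f i | i : 'I_n] = n.
Proof. by rewrite size_map size_enum_ord. Qed.

Lemma uniq_ord_word : uniq [seq f i | i : 'I_n].
Proof. by rewrite map_inj_uniq // enum_uniq. Qed.

Lemma index_ord_word i : index (f i) [seq f i | i : 'I_n] = i.
Proof. by rewrite index_map // index_enum_ord. Qed.

Lemma mem_ord_word x : reflect (exists i, x = f i) (x \in [seq f i | i : 'I_n]).
Proof.
apply: (iffP mapP) => [[i _ ->]|[i ->]]; first by exists i.
by exists i; rewrite // mem_enum.
Qed.

End FinWords.

Section InversionExtension.
Local Open Scope group_scope.
Variables (gT : finGroupType) (S : {set gT}) (T : finType).
Variables (val : T -> int) (act : gT -> T -> T) (wt : T -> T -> nat) (r : T -> T -> gT).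
Hypothesis H : inversion_system S val act wt r.
Implicit Types s z u v w : gT.

Let ext w := int_ext val (act w).

Let extM u v x : ext (u * v) x = ext v (ext u x).
Proof. by apply: (int_ext_comp (is_val H)) => p; rewrite (is_M H). Qed.

Let ext_inj u v : ext u =1 ext v -> u = v.
Proof.
move=> e; apply: (mulIg v^-1); rewrite mulgV; apply: (is_faithful H) => x.
rewrite (is_M H) ((int_ext_eq (is_val H)) _ _ e) -(is_M H) mulgV.
exact: is_1 H x.
Qed.

Lemma ext_involutive z : z^-1 = z -> involutive (ext z).
Proof.
move=> zV x; rewrite -extM -{1}zV mulVg.
by apply: (int_ext_id (is_val H)) => p; apply: is_1 H p.
Qed.

Lemma ext_commute s z (sg : int -> int) : ext s =1 sg ->
  (forall x, sg (ext z x) = ext z (sg x)) <-> s * z = z * s.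
Proof.
move=> sE; split=> [c|c x]; last by rewrite -!sE -!extM c.
by apply: ext_inj => x; rewrite !extM !sE c.
Qed.

Lemma ext_inv_down s z (sg : int -> int) :
    s \in S -> ext s =1 sg -> involutive sg ->
  ((forall x, sg (ext z x) = ext z (sg x)) ->
     forall x, ext (inv_down z s) x = ext z (sg x)) /\
  (~ (forall x, sg (ext z x) = ext z (sg x)) ->
     forall x, ext (inv_down z s) (sg x) = sg (ext z x)).
Proof.
move=> sS sE si; have cE := ext_commute z sE; rewrite /inv_down.
split=> [/[dup] c0 /cE c x|c x]; case: eqP => // c1.
  by rewrite extM sE c0.
  by case: c; apply/cE.
by rewrite !extM !sE si.
Qed.

(** Both [z] and [s] reverse the pair [(a, b)], so conjugation by [z] preserves the reflection [s]
    in it. *)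
Lemma ext_exchange s z a b : s \in S -> inverts val act s (a, b) ->
  act s a = b -> act s b = a -> act z a = b -> act z b = a -> s * z = z * s.
Proof.
move=> sS sab sa sb za zb.
have e1 : s = r a b := is_refl H sS sab.
have := is_conj H s a b; rewrite sa sb -e1 mulVg mul1g => e2.
have := is_conj H z a b; rewrite za zb e2 -e1 => e3.
by rewrite {2}e3 !mulgA mulgV mul1g.
Qed.

End InversionExtension.

(** * Inverse atoms of [S_n] by their words *)

Section SymmetricAtoms.
Variable n : nat.
Implicit Types (s u w z : 'S_n) (i : 'I_n).

Notation S_act := (fun (w : 'S_n) i => w i).
Notation S_len := (inversion_length (@ord_val n) S_act (fun _ _ => 2)).
Definition S_int w : int -> int := int_ext (@ord_val n) (S_act w).

Let SS := S_inversion_system n.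

Let wI w : injective (fun i => ord_val (w i)).
Proof. by move=> i j /ord_val_inj/perm_inj. Qed.

Lemma S_word_uniq w : uniq (S_word w).
Proof. exact: uniq_ord_word (@wI w). Qed.

Lemma mem_S_word w x : (x \in S_word w) = (0 < x <= Posz n)%R.
Proof.
apply/(mem_ord_word (fun i => ord_val (w i)))/andP => [[i ->]|[x0 xn]].
  by have := ltn_ord (w i); rewrite /ord_val; lia.
have [i <-] := ord_val_surj x0 xn; exists (w^-1%g i).
by rewrite permKV.
Qed.

Lemma index_S_word w i : index (ord_val i) (S_word w) = w^-1%g i.
Proof.
by rewrite -{1}[i](permKV w); apply: (index_ord_word (@wI w)).
Qed.

Lemma S_wordM w s k : is_swap_int k s -> S_word (w * s)%g = map (swap_int k) (S_word w).
Proof.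
by move=> sE; rewrite /S_word -map_comp; apply: eq_map => i; rewrite permM; apply: sE.
Qed.

Lemma S_int_swap s k : (0 < k)%R -> (k + 1 <= Posz n)%R -> is_swap_int k s ->
  S_int s =1 swap_int k.
Proof.
move=> k0 kn sE; apply: (int_ext_ind (val := @ord_val n)) => [i|x nx].
  by rewrite /S_int int_extE ?sE //; apply: ord_val_inj.
rewrite /S_int int_ext_out //; have := swap_intP k x.
have : x <> k by move=> e; have [||i iE] := @ord_val_surj n k; [lia..|apply: (nx i); rewrite iE].
have : x <> (k + 1)%R.
  by move=> e; have [||i iE] := @ord_val_surj n (k + 1)%R; [lia..|apply: (nx i); rewrite iE].
lia.
Qed.

(** Both sides agree at the identity and obey the same recursion along any descent of [u]. *)
Lemma S_atomP z u : z^-1%g = z ->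
  u \in atoms_inv (S_gens n) z <-> atom_word (S_int z) (S_word u).
Proof.
have lenP := inversion_coxeter_length SS; have rkP := S_coxeter_rank n.
have [m] := ubnP (S_len u); elim: m u z => // m IH u z lu zV.
have [->|un1] := eqVneq u 1%g.
  rewrite (atoms_inv1 lenP rkP zV).
  set w1 : seq int := S_word _.
  have srt x y : x \in w1 -> y \in w1 -> (x < y)%R -> index x w1 < index y w1.
    rewrite !mem_S_word => /andP [x0 xn] /andP [y0 yn].
    have [i <-] := ord_val_surj x0 xn; have [j <-] := ord_val_surj y0 yn.
    by rewrite !index_S_word invg1 !perm1 /ord_val; lia.
  split=> [/eqP ->|A].
    apply: atom_word_id => //; first exact: S_word_uniq.
    by move=> x _; apply: int_ext_id => [|i]; [exact: ord_val_inj|rewrite perm1].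
  apply/eqP/permP => i; rewrite perm1; apply: ord_val_inj.
  rewrite -(int_extE (@ord_val_inj n) (fun i => z i)).
  apply: (atom_word_sorted srt A); rewrite mem_S_word.
  by have := ltn_ord i; rewrite /ord_val; lia.
have [s sS lt] := cl_descent lenP un1.
have [k [k0 kn sE]] := S_gensP sS.
have [||a aE] := @ord_val_surj n k; [lia..|].
have [||b bE] := @ord_val_surj n (k + 1)%R; [lia..|].
have sab : inverts (@ord_val n) S_act s (a, b) by rewrite (S_inverts _ sE) /= aE bE !eqxx.
have sa : s a = b by apply: ord_val_inj; rewrite sE aE bE; have := swap_intP k k; lia.
have sb : s b = a.
  by apply: ord_val_inj; rewrite sE aE bE; have := swap_intP k (k + 1)%R; lia.
rewrite (atoms_inv_step lenP rkP zV sS lt) (inversion_lengthE SS _ sS sab) zV.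
have sint := S_int_swap k0 kn sE.
have [zc zn] := ext_inv_down SS z sS sint (@swap_intK k).
have yV := inv_downV (is_gen SS sS) zV.
have extz := int_extE (@ord_val_inj n) (fun i => z i).
have step : atom_word (S_int z) (S_word u) <->
    (S_int z (k + 1) < S_int z k)%R /\
    atom_word (S_int (inv_down z s)) (map (swap_int k) (S_word u)).
  apply: atom_word_step => //.
  - exact: (ext_involutive SS zV).
  - exact: swap_intK.
  - exact: S_word_uniq.
  - by rewrite mem_S_word; lia.
  - by rewrite mem_S_word; lia.
  - by move=> x _; case: (swap_intP k x) => [|[|]] ?;
      [constructor 1|constructor 2|constructor 3; split]; lia.
  - rewrite -bE -aE !index_S_word.
    by move: lt; rewrite (inversion_lengthE SS u sS sab) => /andP [_].
  - rewrite -bE -{1}aE /S_int extz => /ord_val_inj za; apply/(ext_commute SS _ sint).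
    by apply: (ext_exchange SS sS sab) => //; rewrite -za -permM -{1}zV mulVg perm1.
rewrite step -(S_wordM _ sE) /S_int -{1}bE -{1}aE !extz -(IH _ _ _ yV);
  last exact: leq_trans lt (ltnSE lu).
split=> [/andP [/andP [_ h1] h2]|[h1 h2]]; first by split.
by rewrite /inverts /= h1 h2 aE bE; lia.
Qed.

End SymmetricAtoms.

(** * Inverse atoms of [W_n] by their words *)

Section SignedAtomSets.
Variable n : nat.
Hypothesis n0 : 0 < n.
Implicit Types (s u w v z : W n) (p q : pm n) (i : 'I_n).

Notation W_len := (inversion_length (@pm_val n) (@W_fun n) (@pm_wt n)).
Definition W_int w : int -> int := int_ext (@pm_val n) (W_fun w).

Let WS := W_inversion_system n0.
Let vI := @pm_val_inj n.

Let wI w : injective (fun i => pm_val (W_fun w (false, i))).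
Proof. by move=> i j /vI/(@W_fun_inj n w) [] . Qed.

Lemma W_intE w p : W_int w (pm_val p) = pm_val (W_fun w p).
Proof. exact: int_extE. Qed.

Lemma W_intN w x : W_int w (- x)%R = (- W_int w x)%R.
Proof.
move: x; apply: (int_ext_ind (val := @pm_val n)) => [p|x nx].
  by rewrite -pm_valN !W_intE W_funN pm_valN.
rewrite /W_int !int_ext_out // => p e; apply: (nx (pm_opp p)).
by rewrite pm_valN e opprK.
Qed.

Lemma W_word_uniq w : uniq (W_word w).
Proof. exact: uniq_ord_word (@wI w). Qed.

Lemma mem_W_word w p : (pm_val p \in W_word w) = ~~ (W_fun w^-1%g p).1.
Proof.
apply/(mem_ord_word (fun i => pm_val (W_fun w (false, i))))/idP => [[i /vI ->]|].
  by rewrite -W_funM mulgV W_fun1.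
case e : (W_fun w^-1%g p) => [[] i] // _; exists i.
by rewrite -e -W_funM mulVg W_fun1.
Qed.

Lemma W_word_val w x : x \in W_word w -> exists p, pm_val p = x.
Proof.
move=> /(mem_ord_word (fun i => pm_val (W_fun w (false, i)))) [i ->].
by exists (W_fun w (false, i)).
Qed.

Lemma index_W_word w p : pm_val p \in W_word w ->
  pm_val (W_fun w^-1%g p) = Posz (index (pm_val p) (W_word w)).+1.
Proof.
rewrite mem_W_word; case e : (W_fun w^-1%g p) => [[] i] // _.
have -> : p = W_fun w (false, i) by rewrite -e -W_funM mulVg W_fun1.
by rewrite (index_ord_word (@wI w)).
Qed.

Lemma mem_W_wordN w p : (- pm_val p \in W_word w)%R = (pm_val p \notin W_word w).
Proof. by rewrite -pm_valN !mem_W_word W_funN /=. Qed.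

Lemma W_wordN w : {in W_word w, forall x, (- x)%R \notin W_word w}.
Proof. by move=> x xv; have [p pE] := W_word_val xv; rewrite -pE mem_W_wordN pE negbK. Qed.

Lemma W_word_pos w p : (0 < pm_val (W_fun w^-1%g p))%R = (pm_val p \in W_word w).
Proof. by rewrite mem_W_word /pm_val; case: (W_fun _ _) => [[] i]. Qed.

Lemma W_wordM w s (sg : int -> int) : W_int s =1 sg -> W_word (w * s)%g = map sg (W_word w).
Proof.
move=> sE; rewrite /W_word -map_comp; apply: eq_map => i /=.
by rewrite W_funM -sE W_intE.
Qed.

Lemma W_int_neg_one s : is_neg_one s -> W_int s =1 neg_one.
Proof.
move=> sE; apply: (int_ext_ind (val := @pm_val n)) => [i|x nx]; first by rewrite W_intE sE.
rewrite /W_int int_ext_out //; have := neg_oneP x.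
have : x <> 1%R by move=> e; have [||p pE] := @pm_val_surj n 1; [lia..|apply: (nx p); rewrite pE].
have : x <> (-1)%R.
  by move=> e; have [||p pE] := @pm_val_surj n (-1)%R; [lia..|apply: (nx p); rewrite pE].
lia.
Qed.

Lemma W_int_swap_abs s k : (0 < k)%R -> (k + 1 <= Posz n)%R -> is_swap_abs k s ->
  W_int s =1 swap_abs k.
Proof.
move=> k0 kn sE; apply: (int_ext_ind (val := @pm_val n)) => [i|x nx]; first by rewrite W_intE sE.
rewrite /W_int int_ext_out //; have := swap_absP x k0.
have out c : c <> 0%R -> (`|c| <= n)%N -> x <> c.
  by move=> c0 cn e; have [//|//|p pE] := @pm_val_surj n c; apply: (nx p); rewrite pE.
by have := out k; have := out (k + 1)%R; have := out (- k)%R; have := out (- (k + 1))%R; lia.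
Qed.

Lemma W_neg_pt_mem z w x : neg_pt (W_int z) x -> (x \in W_word w) || (- x \in W_word w)%R.
Proof.
move=> /andP [/eqP x0 /eqP zx].
have [[p <-]|np] := pselect (exists p : pm n, pm_val p = x).
  by rewrite mem_W_wordN orbN.
move: zx; rewrite /W_int int_ext_out; first by lia.
by move=> p e; apply: np; exists p.
Qed.

Lemma W_atomP z v : z^-1%g = z ->
  v \in atoms_inv (W_gens n) z <-> exists pi, signed_atom (W_int z) pi (W_word v).
Proof.
have lenP := inversion_coxeter_length WS; have rkP := W_coxeter_rank n0.
have [m] := ubnP (W_len v); elim: m v z => // m IH v z lv zV.
have zi := ext_involutive WS zV; have zo := W_intN z.
have step s a b sg : s \in W_gens n -> inverts (@pm_val n) (@W_fun n) s (a, b) ->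
    W_int s =1 sg -> (pm_val (W_fun v^-1%g b) < pm_val (W_fun v^-1%g a))%R ->
    v \in atoms_inv (W_gens n) z <->
    (W_int z (pm_val b) < W_int z (pm_val a))%R /\
    exists pi, signed_atom (W_int (inv_down z s)) pi (map sg (W_word v)).
  move=> sS sab sE vab; have /andP [ab _] := sab.
  have lt : W_len (v * s)%g < W_len v.
    by rewrite (inversion_lengthE WS v sS sab) /inverts ab vab.
  rewrite (atoms_inv_step lenP rkP zV sS lt) (inversion_lengthE WS _ sS sab) zV.
  rewrite -(W_wordM _ sE) -(IH _ _ _ (inv_downV (is_gen WS sS) zV));
    last exact: leq_trans lt (ltnSE lv).
  rewrite !W_intE /inverts ab /=.
  by split=> [/andP [h1 h2]|[h1 h2]]; rewrite ?h1 ?h2.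
have [[k0 kv]|pos] := pselect (exists k : nat, (- Posz k.+1)%R \in W_word v).
  (* The negative letter of least absolute value is [- (k + 1)]; it determines the order-preserving
     descent. *)
  have [k {k0}kv kmin] := ex_minnP (ex_intro (fun k : nat => (- Posz k.+1)%R \in W_word v) k0 kv).
  have kn : k < n by have [p pE] := W_word_val kv; have := pm_val_range p; rewrite pE; lia.
  case: k kv kmin kn => [|k] kv kmin kn.
    have [s sS sE] := W_gen_neg_one n0; have sint := W_int_neg_one sE.
    have [//|//|b bE] := @pm_val_surj n 1.
    have oE : pm_val (pm_opp b) = (-1)%R by rewrite pm_valN bE.
    have sab : inverts (@pm_val n) (@W_fun n) s (pm_opp b, b).
      by rewrite (W_inverts_neg_one _ sE) /= oE bE.
    have vb : pm_val (pm_opp b) \in W_word v by rewrite oE.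
    have vab : (pm_val (W_fun v^-1%g b) < pm_val (W_fun v^-1%g (pm_opp b)))%R.
      by move: vb; rewrite -W_word_pos W_funN pm_valN; lia.
    have [zc zn] := ext_inv_down WS z sS sint neg_oneK.
    rewrite (step _ _ _ _ sS sab sint vab) oE bE zo.
    have -> (c : int) : (c < - c)%R = (c < 0)%R by lia.
    by rewrite (signed_atom_neg_one zo zi (@W_wordN v) kv zc zn).
  have k1n : ((Posz k.+1 + 1)%R <= Posz n)%R by lia.
  have [//|//|s sS sE] := @W_gen_swap_abs n (Posz k.+1).
  have sint := W_int_swap_abs (k := Posz k.+1) isT k1n sE.
  have [||a aE] := @pm_val_surj n (Posz k.+1); [lia..|].
  have [||b bE] := @pm_val_surj n (Posz k.+1 + 1)%R; [lia..|].
  have sab : inverts (@pm_val n) (@W_fun n) s (a, b).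
    by rewrite (W_inverts_swap_abs _ _ sE) //= aE bE !eqxx.
  (* By minimality its negative is not a letter. *)
  have va : Posz k.+1 \in W_word v.
    rewrite -aE -[_ \in _]negbK -mem_W_wordN aE; apply/negP => /kmin; lia.
  have vb : (- (Posz k.+1 + 1))%R \in W_word v by have -> : (Posz k.+1 + 1)%R = Posz k.+2 by lia.
  have vab : (pm_val (W_fun v^-1%g b) < pm_val (W_fun v^-1%g a))%R.
    move: (va) (vb); rewrite -bE -aE -pm_valN -!W_word_pos W_funN pm_valN; lia.
  have [zc zn] := ext_inv_down WS z sS sint (swap_absK (i := Posz k.+1) isT).
  rewrite (step _ _ _ _ sS sab sint vab) aE bE.
  by rewrite (signed_atom_swap_abs (i := Posz k.+1) isT zo zi (@W_wordN v) va vb zc zn).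
have vpos : {in W_word v, forall x, 0 < x}%R.
  move=> x xv; have [p pE] := W_word_val xv; have [x0 _] := pm_val_range p.
  rewrite ltNge; apply/negP => le; apply: pos; exists `|x|.-1.
  by have -> : (- Posz `|x|.-1.+1)%R = x by lia.
have vmem p : (pm_val p \in W_word v) = (0 < pm_val p)%R.
  apply/idP/idP => [/vpos //|p0]; rewrite -[_ \in _]negbK -mem_W_wordN.
  by apply/negP => /vpos; lia.
have negm := @W_neg_pt_mem z v.
rewrite (signed_atom_pos zo vpos negm).
have [v1|vn1] := eqVneq v 1%g.
  rewrite v1 (atoms_inv1 lenP rkP zV) -v1.
  have srt x y : x \in W_word v -> y \in W_word v -> (x < y)%R ->
      index x (W_word v) < index y (W_word v).
    move=> xv yv; have [p pE] := W_word_val xv; have [q qE] := W_word_val yv.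
    rewrite -pE -qE in xv yv *; have := index_W_word xv; have := index_W_word yv.
    have e r : W_fun v^-1%g r = r by rewrite v1 invg1 W_fun1.
    by rewrite !e; move: (index _ _) (index _ _) => c d; lia.
  split=> [/eqP ->|A].
    apply: atom_word_id => //; first exact: W_word_uniq.
    by move=> x _; apply: int_ext_id => [|i]; [exact: vI|rewrite v1 W_fun1].
  have fixz := atom_word_sorted srt A.
  apply/eqP/W_eqP => p; rewrite v1 W_fun1; apply: (vI); rewrite -W_intE.
  have [pv|npv] := boolP (pm_val p \in W_word v); first exact: fixz.
  by rewrite -[pm_val p]opprK zo fixz // mem_W_wordN.
have [s sS lt] := cl_descent lenP vn1.
have [[_ sE]|[k [k0 kn sE]]] := W_gensP sS.
  (* [t_0] is a descent only if [-1] is a letter. *)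
  exfalso; have [//|//|b bE] := @pm_val_surj n 1.
  have oE : pm_val (pm_opp b) = (-1)%R by rewrite pm_valN bE.
  have sab : inverts (@pm_val n) (@W_fun n) s (pm_opp b, b).
    by rewrite (W_inverts_neg_one _ sE) /= oE bE.
  move: lt; rewrite (inversion_lengthE WS v sS sab) => /andP [_] /=.
  have : pm_val b \in W_word v by rewrite vmem bE.
  by rewrite -W_word_pos W_funN pm_valN; lia.
have sint := W_int_swap_abs k0 kn sE.
have [||a aE] := @pm_val_surj n k; [lia..|].
have [||b bE] := @pm_val_surj n (k + 1)%R; [lia..|].
have sab : inverts (@pm_val n) (@W_fun n) s (a, b).
  by rewrite (W_inverts_swap_abs _ k0 sE) //= aE bE !eqxx.
have va : pm_val a \in W_word v by rewrite vmem aE.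
have vb : pm_val b \in W_word v by rewrite vmem bE; lia.
have vab : (pm_val (W_fun v^-1%g b) < pm_val (W_fun v^-1%g a))%R.
  by move: lt; rewrite (inversion_lengthE WS v sS sab) => /andP [_].
have [zc zn] := ext_inv_down WS z sS sint (swap_absK k0).
rewrite (step _ _ _ _ sS sab sint vab) aE bE.
have sp x : (0 < x)%R -> (0 < swap_abs k x)%R by have := swap_absP x k0; lia.
have pos' : {in map (swap_abs k) (W_word v), forall x, 0 < x}%R.
  by move=> _ /mapP [x /vpos/sp xv ->].
have negm' x : neg_pt (W_int (inv_down z s)) x ->
    (x \in map (swap_abs k) (W_word v)) || (- x \in map (swap_abs k) (W_word v))%R.
  by rewrite -(W_wordM v sint); apply: W_neg_pt_mem.
rewrite (signed_atom_pos (W_intN _) pos' negm').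
have va' : k \in W_word v by rewrite -aE.
have vb' : (k + 1)%R \in W_word v by rewrite -bE.
apply: iff_sym; apply: (@atom_word_step _ _ (swap_abs k)) => //.
- exact: swap_absK.
- exact: W_word_uniq.
- by move=> x /vpos x0; case: (swap_absP x k0) => [|[|]] ?;
    [constructor 1|constructor 2|constructor 3; split]; lia.
- by move: vab; rewrite -bE -aE !index_W_word // ltz_nat.
- have sa : W_fun s a = b by apply: (vI); rewrite sE aE bE; have := swap_absP k k0; lia.
  have sb : W_fun s b = a.
    by apply: (vI); rewrite sE aE bE; have := swap_absP (k + 1)%R k0; lia.
  rewrite -bE -{1}aE W_intE => /(vI) za; apply/(ext_commute WS _ sint).
  by apply: (ext_exchange WS sS sab) => //; rewrite -za -W_funM -{1}zV mulVg W_fun1.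
Qed.

End SignedAtomSets.

(** * Noncrossing matchings and ballot sequences *)

Fixpoint ballot (b : seq bool) : bool :=
  if b is c :: t then ballot t && (count id b <= count negb b) else true.

Fixpoint sign_seqs (m : nat) : seq (seq bool) :=
  if m is k.+1 then map (cons true) (sign_seqs k) ++ map (cons false) (sign_seqs k)
  else [:: [::]].

Lemma mem_sign_seqs m b : (b \in sign_seqs m) = (size b == m).
Proof.
elim: m b => [|m IH] [|c b] //=; rewrite mem_cat.
  by apply/orP => -[] /mapP [].
rewrite eqSS -IH; apply/orP/idP => [[] /mapP [t tm [_ ->]] //|bm].
by case: c; [left|right]; apply: map_f.
Qed.

Lemma sign_seqs_uniq m : uniq (sign_seqs m).
Proof.
elim: m => //= m IH; rewrite cat_uniq !map_inj_uniq ?IH ?andbT /=; try by move=> ? ? [].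
by apply/hasPn => _ /mapP [t _ ->]; apply/mapP => -[].
Qed.

Lemma ballot_count b : ballot b -> 2 * count id b <= size b.
Proof.
have h : count id b + count negb b = size b := count_predC id b.
by case: b h => // c b h /= /andP [_]; move: h => /=; lia.
Qed.

(* The bound on the number of plus signs makes the recursion Pascal's rule. *)
Lemma count_ballot m k : 2 * k <= m ->
  count (fun b => ballot b && (count id b <= k)) (sign_seqs m) = 'C(m, k).
Proof.
elim: m k => [|m IH] k km; first by have -> : k = 0 by lia.
rewrite /= count_cat !count_map.
have sz b : b \in sign_seqs m -> count id b + count negb b = m.
  by rewrite mem_sign_seqs => /eqP <-; apply: count_predC.
(* Beyond the induction hypothesis this includes [2 * j = m + 1]. There a ballot sequence of length
   [m] has fewer than [j] plus signs, so the bound drops to [j - 1], in agreement with the symmetry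
   of binomial coefficients. *)
have F j : 2 * j <= m.+1 ->
    count (fun b => ballot b && (count id b <= j)) (sign_seqs m) = 'C(m, j).
  rewrite leq_eqVlt => /orP [/eqP e|lt]; last by apply: IH; lia.
  case: j e => // j e; rewrite (_ : 'C(m, j.+1) = 'C(m, j)); last first.
    by rewrite -[LHS]bin_sub; [congr binomial; lia|lia].
  rewrite -IH; last by lia.
  apply: eq_in_count => b; rewrite mem_sign_seqs => /eqP bm /=.
  by case bb: (ballot b) => //=; have := ballot_count bb; rewrite bm; lia.
case: k km => [|k] km.
  rewrite bin0 -(bin0 m) -(F 0) // -[RHS]add0n; congr addn.
    by apply/eqP; rewrite -leqn0 leqNgt -has_count; apply/hasPn => b _ /=; rewrite andbF.
  by apply: eq_in_count => b /sz bm /=; case: (ballot b) => //=; lia.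
rewrite binS addnC -(F k); last by lia.
rewrite -(F k.+1); last by lia.
congr addn; apply: eq_in_count => b /[dup] bs /sz bm /=; case bb: (ballot b) => //=.
  by have := ballot_count bb; move: bs; rewrite mem_sign_seqs => /eqP ->; lia.
by have := ballot_count bb; move: bs; rewrite mem_sign_seqs => /eqP ->; lia.
Qed.

Lemma count_ballot_all m : count ballot (sign_seqs m) = 'C(m, m./2).
Proof.
rewrite -count_ballot; last by lia.
apply: eq_in_count => b; rewrite mem_sign_seqs => /eqP bm.
by case bb: (ballot b) => //=; have := ballot_count bb; rewrite bm; lia.
Qed.

Section BallotMatching.
Local Open Scope ring_scope.
Implicit Types (g : int -> bool) (s t : seq int) (pi : int -> int).

Definition pm_mem s (x : int) : bool := (x \in s) || (- x \in s).

Lemma pm_memN s x : pm_mem s (- x) = pm_mem s x.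
Proof. by rewrite /pm_mem opprK orbC. Qed.

(** The left endpoints determine a noncrossing matching. Going from right to left, suppose
    [q x < q' x] at an opener [x]. Under the block [{x, q' x}] the closer [q x] must be matched by
    [q'] to an opener after [x], where both matchings already agree, whereas [q] matches it to
    [x]. *)
Lemma nc_matching_unique (N : pred int) (n : nat) pi pi' :
    (forall x, N x -> x <= Posz n) -> nc_matching N pi -> nc_matching N pi' ->
    (forall x, N x -> (x < pi x) = (x < pi' x)) ->
  forall x, N x -> pi x = pi' x.
Proof.
move=> Nn MM MM' op.
have key q q' x : nc_matching N q -> nc_matching N q' ->
    (forall y, N y -> (y < q y) = (y < q' y)) ->
    (forall y, N y -> x < y -> y < q' y -> q y = q' y) ->
    N x -> x < q x -> q x < q' x -> False.
  move=> [M NC] [M' NC'] oq IH Nx xq qq'.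
  have [Nq qq qx _] := M _ Nx; have [Nq' qq'' qx' _] := M' _ Nx.
  have [Ny yy yx _] := M' _ Nq.
  have cl : ~~ (q x < q' (q x)) by rewrite -oq // qq -leNgt ltW.
  case: (ltgtP (q' (q x)) x) => [lt|gt|e].
  - by apply: (NC' (q' (q x)) x); rewrite // ?yy //; lia.
  - have lt : q' (q x) < q' (q' (q x)) by rewrite yy lt_neqAle leNgt cl andbT; apply/eqP.
    have := IH _ Ny gt lt; rewrite yy => /(congr1 q).
    by have [_ -> _ _] := M _ Ny; rewrite qq => e; rewrite e ltxx in gt.
  - by move: yy; rewrite e; lia.
have opener m x : (`|Posz n - x| < m)%N -> N x -> x < pi x -> pi x = pi' x.
  elim: m x => // m IH x xm Nx xp.
  have IH' y : N y -> x < y -> y < pi y -> pi y = pi' y.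
    by move=> Ny xy yp; apply: IH => //; have := Nn _ Ny; have := Nn _ Nx; lia.
  case: (ltgtP (pi x) (pi' x)) => // lt; exfalso.
    by apply: (key pi pi' x) => // y Ny xy; rewrite -op //; apply: IH'.
  have op' y : N y -> (y < pi' y) = (y < pi y) by move/op.
  apply: (key pi' pi x) => //; last by rewrite op'.
  by move=> y Ny xy yp; rewrite IH'.
move=> x Nx; have [Np pp px _] := MM.1 _ Nx.
have [lt|] := ltP x (pi x); first exact: (opener (`|Posz n - x|.+1)%N).
move=> le; have lt : pi x < pi (pi x) by rewrite pp lt_neqAle le andbT; apply/eqP.
have := opener (`|Posz n - pi x|.+1)%N _ (ltnSn _) Np lt; rewrite pp => e.
by have [_ <- _ _] := MM'.1 _ Np; rewrite -e.
Qed.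

(** The partner of a positive opener is a larger positive closer, so [pi] injects the openers of
    each suffix of [s] into its closers. *)
Lemma nc_matching_ballot s pi g :
    sorted <%R s -> {in s, forall x, 0 < x} -> nc_matching (pm_mem s) pi ->
    {in s, forall x, g x = (x < pi x)} ->
  ballot (map g s).
Proof.
move=> srt pos MM gE.
suff sfx a b : s = a ++ b -> ballot (map g b) by apply: (sfx [::]).
elim: b a => //= x t IH a sE; rewrite (IH (rcons a x)) ?cat_rcons //=.
have sub y : y \in x :: t -> y \in s by rewrite sE mem_cat orbC => ->.
have srt_t : sorted <%R (x :: t).
  by move: srt; rewrite sE; apply: subseq_sorted; [exact: lt_trans|exact: suffix_subseq].
have up y z : y \in x :: t -> z \in s -> y <= z -> z \in x :: t.
  rewrite sE mem_cat => yt /orP [za|//] yz.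
  have : y \in x :: t by [].
  have := srt; rewrite sE sorted_pairwise; last exact: lt_trans.
  by rewrite pairwise_cat => /and3P [/allrelP/(_ z y za yt)]; lia.
have -> : (g x + count id (map g t) = count g (x :: t))%N by rewrite count_map.
have -> : (~~ g x + count negb (map g t) = count (predC g) (x :: t))%N.
  by rewrite count_map.
rewrite -!size_filter -(size_map pi); apply: uniq_leq_size.
  rewrite map_inj_in_uniq ?filter_uniq ?(sorted_uniq lt_trans ltxx) //.
  move=> y z; rewrite !mem_filter => /andP [_ /sub ys] /andP [_ /sub zs] e.
  have Ny : pm_mem s y by rewrite /pm_mem ys.
  have Nz : pm_mem s z by rewrite /pm_mem zs.
  by have [_ <- _ _] := MM.1 _ Ny; rewrite e; have [_ -> _ _] := MM.1 _ Nz.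
move=> _ /mapP [y + ->]; rewrite !mem_filter => /andP [gy yt]; have ys := sub _ yt.
have Ny : pm_mem s y by rewrite /pm_mem ys.
rewrite gE // in gy; have [Npy ppy _ _] := MM.1 _ Ny; have y0 := pos _ ys.
have pys : pi y \in s.
  move: Npy; rewrite /pm_mem => /orP [//|/pos]; lia.
by rewrite /= gE // ppy -leNgt ltW //= (up _ _ yt) // ltW.
Qed.

(** The least point [x] is added last. As a closer it is matched to [- x], innermost of all. As an
    opener it takes over the closer [y] of the innermost block [{- y, y}], giving the blocks
    [{x, y}] and [{- y, - x}]. *)
Lemma ballot_nc_matching s g :
    sorted <%R s -> {in s, forall x, 0 < x} -> ballot (map g s) ->
  exists pi, nc_matching (pm_mem s) pi /\ {in s, forall x, (x < pi x) = g x}.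
Proof.
elim: s => [|x t IH] srt pos /=.
  by move=> _; exists id; split=> //; split=> x; rewrite /pm_mem.
have xt : {in t, forall y, x < y}.
  move=> y yt; have /= := srt; rewrite path_sortedE; last exact: lt_trans.
  by case/andP => /allP/(_ _ yt).
have x0 : 0 < x by apply: pos; rewrite mem_head.
have srt_t : sorted <%R t := path_sorted srt.
have pos_t : {in t, forall y, 0 < y} by move=> y yt; have := xt _ yt; lia.
move=> /andP [/(IH srt_t pos_t) [pi [MM op]] cnt]; have [M NC] := MM.
have NN y : pm_mem t y -> pm_mem t (- y) by rewrite pm_memN.
have far y : pm_mem t y -> x < y \/ y < - x.
  by move=> /orP [/xt|/xt]; [left|right; lia].
have pin y : 0 < y -> pm_mem t y -> y \in t.
  by move=> y0 /orP [//|/pos_t]; lia.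
case gx : (g x); last first.
  pose pi' y := if (y == x) || (y == - x) then - y else pi y.
  have pi'P y : (y = x \/ y = - x) /\ pi' y = - y \/ (y <> x /\ y <> - x) /\ pi' y = pi y.
    by rewrite /pi'; case: eqP => ?; [|case: eqP => ?] => /=; [left|left|right]; split=> //; auto.
  have N'P y : pm_mem (x :: t) y -> (y = x \/ y = - x) \/ pm_mem t y.
    by rewrite /pm_mem !inE => /orP [/orP [/eqP|]|/orP [/eqP|]]; 
      [left; left|move=> ->; right|left; right; lia|move=> ->; right; rewrite orbT].
  have tN y : pm_mem t y -> pm_mem (x :: t) y.
    by rewrite /pm_mem !inE => /orP [->|->]; rewrite !orbT.
  have xN : pm_mem (x :: t) x by rewrite /pm_mem mem_head.
  have Mt y : pm_mem t y -> pi' y = pi y.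
    by move=> /far yf; have := pi'P y; lia.
  exists pi'; split; [split|].
  - move=> y /N'P [yx|yt].
      have py : pi' y = - y by rewrite /pi'; case: yx => ->; rewrite eqxx ?orbT.
      have py' : pi' (- y) = y by rewrite /pi'; case: yx => ->; rewrite ?opprK eqxx ?orbT ?opprK.
      rewrite py py' opprK; split=> //; last by case: yx; lia.
      by rewrite pm_memN; case: yx => ->; rewrite ?pm_memN.
    have [Np pp px po] := M _ yt.
    by rewrite (Mt _ yt) (Mt _ Np) (Mt _ (NN _ yt)); split=> //; apply: tN.
  - move=> y1 y2 /N'P N1 /N'P N2.
    case: N1 => [y1x|N1]; case: N2 => [y2x|N2].
    + by have := pi'P y1; have := pi'P y2; lia.
    + by have := pi'P y1; have := far _ N2; lia.
    + rewrite (Mt _ N1); have [Np _ _ _] := M _ N1; have := far _ N1; have := far _ Np.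
      by have := pi'P y2; lia.
    + by rewrite !Mt //; apply: NC.
  - move=> y; rewrite inE => /orP [/eqP ->|yt]; first by rewrite gx; have := pi'P x; lia.
    by rewrite Mt ?op // /pm_mem yt.
(* Without such a [y], every closer in [t] would be matched to an opener in [t], but the ballot
   condition at [x] provides more closers than openers. *)
have [y [yt yy ymin]] : exists y, [/\ y \in t, pi y = - y &
    forall u, u \in t -> pi u = - u -> y <= u].
  have [/hasP [y0 y0t /eqP y0P]|/hasPn no] := boolP (has (fun u => pi u == - u) t).
    pose c := [seq u <- t | pi u == - u].
    have cn : c != [::] by rewrite -has_filter; apply/hasP; exists y0 => //; apply/eqP.
    have [y yc ymin] := seq_min cn; move: yc; rewrite mem_filter => /andP [/eqP yP yt].
    by exists y; split=> // u ut uP; apply: ymin; rewrite mem_filter uP eqxx.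
  exfalso; move: cnt; rewrite gx /= !count_map -!size_filter => cnt.
  suff le : (size [seq u <- t | ~~ g u] <= size [seq u <- t | g u])%N.
    by have := leq_trans cnt le; rewrite add1n ltnn.
  rewrite -(size_map pi); apply: uniq_leq_size.
    rewrite map_inj_in_uniq ?filter_uniq ?(sorted_uniq lt_trans ltxx) //.
    move=> u w; rewrite !mem_filter => /andP [_ ut] /andP [_ wt] e.
    have Nu : pm_mem t u by rewrite /pm_mem ut.
    have Nw : pm_mem t w by rewrite /pm_mem wt.
    by have [_ <- _ _] := M _ Nu; rewrite e; have [_ -> _ _] := M _ Nw.
  move=> _ /mapP [u + ->]; rewrite !mem_filter => /andP [gu ut].
  have Nu : pm_mem t u by rewrite /pm_mem ut.
  have [Np pp px _] := M _ Nu; have u0 := pos_t _ ut.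
  rewrite -op // -leNgt in gu; have nu := no _ ut.
  have p0 : 0 < pi u.
    rewrite ltNge; apply/negP => le; have := far _ Np => pf.
    have pneg : pi u < 0 by lia.
    have := nc_matching_opp MM NN Np pneg; rewrite pp => /(_ u0) e.
    by move/eqP: nu; lia.
  have put := pin _ p0 Np; rewrite put andbT -op // pp lt_neqAle gu andbT.
  exact/eqP.
have xy := xt _ yt; have y0 := pos_t _ yt.
have yN : pm_mem t y by rewrite /pm_mem yt.
have nyy : pi (- y) = y by have [_ _ _ ->] := M _ yN; rewrite yy opprK.
(* Every block straddling zero encloses [{- y, y}] or equals it; the new blocks therefore cross none
   of them. *)
have min' u : pm_mem t u -> u < 0 -> 0 < pi u -> y <= - u.
  move=> uN u0 pu0; have e := nc_matching_opp MM NN uN u0 pu0.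
  have [_ _ _ po] := M _ uN; apply: ymin; last by rewrite po e.
  by apply: pin; rewrite ?pm_memN // oppr_gt0.
pose pi' u := if u == x then y else if u == y then x else
  if u == - x then - y else if u == - y then - x else pi u.
have pi'P u : (u = x /\ pi' u = y) \/ (u = y /\ pi' u = x) \/ (u = - x /\ pi' u = - y) \/
   (u = - y /\ pi' u = - x) \/
   (u <> x /\ u <> y /\ u <> - x /\ u <> - y) /\ pi' u = pi u.
  by rewrite /pi'; do 4?[case: eqP => ?]; lia.
have px' : pi' x = y by have := pi'P x; clear -x0 y0 xy; lia.
have py' : pi' y = x by have := pi'P y; clear -x0 y0 xy; lia.
have pnx : pi' (- x) = - y by have := pi'P (- x); clear -x0 y0 xy; lia.
have pny : pi' (- y) = - x by have := pi'P (- y); clear -x0 y0 xy; lia.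
have N'P u : pm_mem (x :: t) u -> (u = x \/ u = - x) \/ pm_mem t u.
  by rewrite /pm_mem !inE => /orP [/orP [/eqP|]|/orP [/eqP|]]; 
      [left; left|move=> ->; right|left; right; lia|move=> ->; right; rewrite orbT].
have tN u : pm_mem t u -> pm_mem (x :: t) u.
  by rewrite /pm_mem !inE => /orP [->|->]; rewrite !orbT.
have xN : pm_mem (x :: t) x by rewrite /pm_mem mem_head.
have Mt u : pm_mem t u -> u <> y -> u <> - y ->
    pi' u = pi u /\ pi u <> y /\ pi u <> - y.
  move=> uN u1 u2; have [_ ppu _ _] := M _ uN; split.
    by have := far _ uN; have := pi'P u; lia.
  by split=> e; move: ppu; rewrite e ?nyy ?yy; lia.
have cases u : pm_mem (x :: t) u ->
    (u = x \/ u = - x \/ u = y \/ u = - y) \/ (pm_mem t u /\ u <> y /\ u <> - y).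
  move=> /N'P [[|] ?|uN]; [by left; left|by left; right; left|].
  have [->|/eqP ?] := eqVneq u y; first by left; auto.
  by have [->|/eqP ?] := eqVneq u (- y); [left; auto|right].
exists pi'; split; [split|].
- move=> u /cases [uE|[uN [u1 u2]]].
    have yN' := tN _ yN.
    by case: uE => [|[|[|]]] ->; rewrite ?opprK ?px' ?py' ?pnx ?pny ?opprK ?px' ?py' ?pnx ?pny
      ?pm_memN; split=> //; lia.
  have [-> [pu1 pu2]] := Mt _ uN u1 u2; have [Np pp px po] := M _ uN.
  have [-> _] := Mt _ Np pu1 pu2.
  have [||-> _] := Mt (- u) (NN _ uN); try lia.
  by split=> //; apply: tN.
- move=> u w /cases Nu /cases Nw.
  case: Nu => [uE|[uN [u1 u2]]]; case: Nw => [wE|[wN [w1 w2]]].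
  + by case: uE => [|[|[|]]] ->; case: wE => [|[|[|]]] ->; 
      rewrite ?px' ?py' ?pnx ?pny; clear -xy x0 y0; lia.
  + have [-> [pw1 pw2]] := Mt _ wN w1 w2; have fw := far _ wN; have [Np pp px po] := M _ wN.
    have fp := far _ Np; case: uE => [|[|[|]]] ->; rewrite ?px' ?py' ?pnx ?pny => h1 h2 h3.
    * by apply: (NC (- y) w); rewrite ?NN ?nyy //; clear -xy x0 y0 h1 h2 h3; lia.
    * by move: fw h1 h2; clear -xy x0 y0; lia.
    * by move: fw h1 h2; clear -xy x0 y0; lia.
    * have wneg : w < 0 by move: h2; clear -x0; lia.
      have ppos : 0 < pi w by case: fp => //; move: h3; clear -x0; lia.
      by have := min' _ wN wneg ppos; move: h1; clear; lia.
  + have [-> [pu1 pu2]] := Mt _ uN u1 u2; have fu := far _ uN; have [Np pp px po] := M _ uN.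
    have fp := far _ Np; case: wE => [|[|[|]]] ->; rewrite ?px' ?py' ?pnx ?pny => h1 h2 h3.
    * have uneg : u < 0 by case: fu => // ; move: h1; clear -x0; lia.
      have ppos : 0 < pi u by move: h2; clear -x0; lia.
      have := min' _ uN uneg ppos; have e := nc_matching_opp MM NN uN uneg ppos.
      by move: e h3; clear; lia.
    * by move: h2 h3; clear -xy x0 y0; lia.
    * by move: h2 h3; clear -xy x0 y0; lia.
    * by apply: (NC u (- y)); rewrite ?NN ?nyy //; move: h2 h3; clear -xy x0 y0; lia.
  + have [-> [pu1 pu2]] := Mt _ uN u1 u2; have [-> [pw1 pw2]] := Mt _ wN w1 w2.
    exact: NC.
- move=> u; rewrite inE => /orP [/eqP ->|ut]; first by rewrite gx; have := pi'P x; lia.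
  have uN : pm_mem t u by rewrite /pm_mem ut.
  have u0 := pos_t _ ut; have xu := xt _ ut.
  have [uy|/eqP uy] := eqVneq u y.
    by rewrite uy -op // yy; have := pi'P y; lia.
  have [|-> _] := Mt _ uN uy; first by lia.
  exact: op.
Qed.

End BallotMatching.

(** * Connected components *)

Section Components.
Variables (T : finType) (lt : rel T) (X : {set T}).
Hypothesis lt_tr : transitive lt.
Hypothesis lt_irr : irreflexive lt.

(** A single move need not be a cover inside [X], so it is refined, by induction on the number of
    elements strictly between. *)
Lemma lt_connect x y : x \in X -> y \in X -> lt x y -> connect (hasse lt X) x y.
Proof.
have [m] := ubnP #|[set u in X | lt x u && lt u y]|.
elim: m x y => // m IH x y lm xX yX xy.
have [cov|] := boolP (covers lt X x y).
  by apply: connect1; rewrite /hasse xX yX cov.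
rewrite /covers xy /= => /forall_inPn [u uX]; rewrite negbK => /andP [xu uy].
have smaller a b : (a == x) && (b == u) || (a == u) && (b == y) ->
    #|[set w in X | lt a w && lt w b]| < m.
  move=> ab; apply: leq_trans _ (ltnSE lm); apply: proper_card; apply/properP; split.
    apply/subsetP => w; rewrite !inE => /and3P [-> aw wb] /=.
    case/orP: ab aw wb => /andP [/eqP -> /eqP ->] aw wb.
      by rewrite aw (lt_tr wb uy).
    by rewrite wb (lt_tr xu aw).
  exists u; rewrite !inE ?uX ?xu ?uy //=.
  by case/orP: ab => /andP [/eqP -> /eqP ->]; rewrite lt_irr ?andbF.
apply: (@connect_trans _ _ u); apply: IH => //; apply: smaller; rewrite !eqxx ?orbT //.
Qed.

Lemma hasse_connect_sym : connect_sym (hasse lt X).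
Proof.
apply: sym_connect_sym => x y.
by rewrite /hasse; case: (x \in X); case: (y \in X) => //=; rewrite orbC.
Qed.

Variables (U : finType) (F : T -> U) (x0 : T).
Hypothesis FP : {in X &, forall x y, connect (hasse lt X) x y = (F x == F y)}.

Lemma componentsE C x : C \in components lt X -> x \in C ->
  C = [set y in X | F x == F y] /\ x \in X.
Proof.
move=> /imsetP [y yX ->]; rewrite inE => /andP [xX yx]; split=> //.
apply/setP => u; rewrite !inE; case uX: (u \in X) => //=.
by rewrite !FP // in yx *; rewrite (eqP yx).
Qed.

Lemma component_ex C : C \in components lt X -> exists x, x \in C.
Proof. by move=> /imsetP [y yX ->]; exists y; rewrite inE yX connect0. Qed.

(** Used with two invariants whose fibres are the components: signs for the count, matchings for the
    bijection. *)
Lemma components_image : set_bijection (components lt X) (F @: X).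
Proof.
pose f (C : {set T}) := F (odflt x0 [pick x in C]).
have fE C x : C \in components lt X -> x \in C -> f C = F x.
  move=> CX xC; have [CE xX] := componentsE CX xC.
  rewrite /f; case: pickP => [y yC|/(_ x)]; last by rewrite xC.
  by move: yC; rewrite CE inE => /andP [_ /eqP ->].
exists f; split.
  move=> C D CX DX e; have [x xC] := component_ex CX; have [y yD] := component_ex DX.
  have [-> _] := componentsE CX xC; have [-> _] := componentsE DX yD.
  by rewrite (fE _ _ CX xC) (fE _ _ DX yD) in e; rewrite e.
apply/setP => u; apply/imsetP/imsetP => [[C CX ->]|[x xX ->]].
  have [x xC] := component_ex CX; have [_ xX] := componentsE CX xC.
  by exists x; rewrite // (fE _ _ CX xC).
have CX : [set y in X | connect (hasse lt X) x y] \in components lt X by apply: imset_f.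
by exists [set y in X | connect (hasse lt X) x y]; rewrite // (fE _ x) // inE xX connect0.
Qed.

End Components.

(** * The order on words *)

Section WordOrder.
Local Open Scope ring_scope.
Implicit Types u v w : seq int.

(** Each move decreases the word lexicographically, which makes [ltA] irreflexive. *)
Fixpoint lexlt v w : bool :=
  match v, w with
  | x :: v', y :: w' => (x < y) || (x == y) && lexlt v' w'
  | _, _ => false
  end.

Lemma lexlt_irr v : lexlt v v = false.
Proof. by elim: v => //= x v ->; rewrite ltxx eqxx. Qed.

Lemma lexlt_trans u v w : lexlt u v -> lexlt v w -> lexlt u w.
Proof.
elim: u v w => [|x u IH] [|y v] [|z w] //= /orP [xy|/andP [/eqP -> uv]] /orP [yz|/andP [/eqP e vw]].
- by rewrite (lt_trans xy yz).
- by rewrite -e xy.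
- by rewrite yz.
- by rewrite e eqxx (IH _ _ uv vw) orbT.
Qed.

Lemma triA_lexlt v w : triA v w -> lexlt w v.
Proof.
case=> p [q [a [b [c [/andP [ab bc] -> ->]]]]].
by elim: p => /= [|x p ->]; rewrite ?bc // eqxx orbT.
Qed.

Lemma ltA_trans : transitive ltA.
Proof. by move=> v u w /asboolP uv /asboolP vw; apply/asboolP; apply: t_trans vw. Qed.

Lemma ltA_irr : irreflexive ltA.
Proof.
move=> v; apply/negP => /asboolP.
suff lex u w : clos_trans (seq int) triA u w -> lexlt w u by move/lex; rewrite lexlt_irr.
elim=> {u w} [u w|u v' w _ uv _ vw]; first exact: triA_lexlt.
exact: lexlt_trans vw uv.
Qed.

Lemma ltA_perm v w : ltA v w -> perm_eq v w.
Proof.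
move=> /asboolP; elim=> {v w} [v w|v u w _ vu _ uw]; first exact: triA_perm.
exact: perm_trans vu uw.
Qed.

Lemma ltA_map (h : int -> int) v w :
  {in v &, {homo h : x y / x < y}} -> ltA v w -> ltA (map h v) (map h w).
Proof.
move=> + /asboolP vw; rewrite /ltA => hm; apply/asboolP.
elim: vw hm => {v w} [v w vw|v u w vu IH1 uw IH2] hm.
  case: vw hm => p [q [a [b [c [/andP [ab bc] vE ->]]]]] hm; apply: t_step.
  exists (map h p), (map h q), (h a), (h b), (h c); rewrite vE !map_cat.
  by split=> //; rewrite !hm // vE !mem_cat !inE eqxx ?orbT.
apply: t_trans (IH1 hm) (IH2 _) => x y xu yu; apply: hm.
  have : ltA v u by apply/asboolP.
  by move/ltA_perm/perm_mem ->.
have : ltA v u by apply/asboolP.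
by move/ltA_perm/perm_mem ->.
Qed.

End WordOrder.

Lemma eq_nc_matching (N N' : pred int) pi :
  N =1 N' -> nc_matching N pi -> nc_matching N' pi.
Proof.
move=> e [M NC]; split=> [x|x y]; rewrite -!e; last exact: NC.
exact: M.
Qed.

Lemma S_word_surj n (v : seq int) : uniq v -> size v = n ->
  {in v, forall x, (0 < x <= Posz n)%R} -> exists u : 'S_n, S_word u = v.
Proof.
move=> uv sv vn.
have /choice [g gP] : forall i : 'I_n, exists j : 'I_n, ord_val j = nth 0%R v i.
  move=> i; have /andP [x0 xn] : (0 < nth 0 v i <= Posz n)%R.
    by apply/vn/mem_nth; rewrite sv.
  by have [j] := ord_val_surj x0 xn; exists j.
have gI : injective g.
  move=> i j /(congr1 (@ord_val n)); rewrite !gP => /eqP.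
  by rewrite nth_uniq ?sv // => /eqP/val_inj.
exists (perm gI); apply: (@eq_from_nth _ 0%R); first by rewrite size_map size_enum_ord.
move=> k; rewrite size_map size_enum_ord => kn.
rewrite (nth_map (Ordinal kn)) ?size_enum_ord //.
by rewrite permE [LHS](gP _) nth_enum_ord.
Qed.

(** * Letters, matchings and connectivity of inverse atoms *)

Section SignedWords.
Variable n : nat.
Hypothesis n0 : 0 < n.
Implicit Types (u v w : W n) (p q : pm n).

Lemma W_word_surj (v : seq int) : uniq v -> size v = n ->
    {in v, forall x, [/\ x <> 0%R, (`|x| <= n)%N & (- x)%R \notin v]} ->
  exists w : W n, W_word w = v.
Proof.
move=> uv sv vn.
have vi (i : 'I_n) : nth 0%R v i \in v by rewrite mem_nth ?sv.
have /choice [g gP] : forall i : 'I_n, exists q : pm n, pm_val q = nth 0%R v i.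
  by move=> i; have [x0 xn _] := vn _ (vi i); apply: pm_val_surj.
pose f p := if p.1 then pm_opp (g p.2) else g p.2.
have gI i j : g i = g j -> i = j.
  move=> /(congr1 (@pm_val n)); rewrite !gP => /eqP.
  by rewrite nth_uniq ?sv // => /eqP/val_inj.
have gN i j : g i <> pm_opp (g j).
  move=> /(congr1 (@pm_val n)); rewrite pm_valN !gP => e.
  by have [_ _] := vn _ (vi j); rewrite -e vi.
have fI : injective f.
  case=> [[] i] [[] j]; rewrite /f /=.
  - by move=> /(@pm_opp_inj n)/gI ->.
  - by move=> /esym/gN.
  - by move=> /gN.
  - by move=> /gI ->.
have fW : perm fI \in signed_perms n.
  by rewrite inE; apply/forallP => -[[] i]; rewrite !permE /f /= ?pm_oppK.
exists (subg _ (perm fI)); apply: (@eq_from_nth _ 0%R).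
  by rewrite size_map size_enum_ord.
move=> k; rewrite size_map size_enum_ord => kn.
rewrite (nth_map (Ordinal kn)) ?size_enum_ord //.
by rewrite /W_fun subgK // permE /f /= gP nth_enum_ord.
Qed.

Lemma W_word_inj : injective (@W_word n).
Proof.
move=> v w e; apply: W_eqP => -[b i].
have ei : W_fun v (false, i) = W_fun w (false, i).
  by apply: (@pm_val_inj n); have /eq_in_map := e; apply; rewrite mem_enum.
have [-> //|->] : (b, i) = (false, i) \/ (b, i) = pm_opp (false, i).
  by case: b; [right|left].
by rewrite !W_funN ei.
Qed.

Lemma W_word_size w : size (W_word w) = n.
Proof. by rewrite size_map size_enum_ord. Qed.

Lemma W_word_props w :
  {in W_word w, forall x, [/\ x <> 0%R, (`|x| <= n)%N & (- x)%R \notin W_word w]}.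
Proof.
move=> x xw; have [p pE] := W_word_val xw; have [? ?] := pm_val_range p.
by rewrite -pE; split=> //; rewrite pE; apply: W_wordN.
Qed.

Lemma W_word_perm w (v : seq int) : perm_eq v (W_word w) -> exists u : W n, W_word u = v.
Proof.
move=> vw; have m := perm_mem vw; apply: W_word_surj.
- by rewrite (perm_uniq vw) W_word_uniq.
- by rewrite (perm_size vw) W_word_size.
- by move=> x; rewrite m => /W_word_props; rewrite m.
Qed.

Variable z : W n.
Hypothesis zV : z^-1%g = z.

Notation X := (atoms_inv (W_gens n) z).
Notation zi := (W_int z).
Notation N := (neg_pt zi).

Lemma W_neg_pt_le x : N x -> (`|x| <= n)%N.
Proof.
move=> /andP [/eqP x0 /eqP zx].
have [[p <-]|np] := pselect (exists p : pm n, pm_val p = x).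
  by case: (pm_val_range p).
move: zx; rewrite /W_int int_ext_out; first by lia.
by move=> p e; apply: np; exists p.
Qed.

Definition letter_cond (pi : int -> int) (x : int) : bool :=
  if N x then (x < pi x)%R else (0 < x + zi x)%R.

Lemma W_int_inv : involutive zi.
Proof. exact: (ext_involutive (W_inversion_system n0) zV). Qed.

Lemma neg_ptN x : N (- x)%R = N x.
Proof. by rewrite /neg_pt W_intN oppr_eq0 eqr_opp. Qed.

(** Exactly one of [x] and [- x] satisfies the condition, as it does for being a letter. Hence [pi]
    determines the letters. *)
Lemma letter_condN pi x : nc_matching N pi -> x <> 0%R ->
  letter_cond pi (- x)%R = ~~ letter_cond pi x.
Proof.
move=> [M _] x0; rewrite /letter_cond neg_ptN W_intN; case: ifP => Nx.
  by have [_ _ px ->] := M _ Nx; lia.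
by move: Nx; rewrite /neg_pt; lia.
Qed.

Lemma mem_signed_atom pi w p : signed_atom zi pi (W_word w) ->
  (pm_val p \in W_word w) = letter_cond pi (pm_val p).
Proof.
case=> MM D _; have [p0 _] := pm_val_range p; apply/idP/idP => [/D //|h].
rewrite -[_ \in _]negbK -mem_W_wordN; apply/negP => /D.
by rewrite -/(letter_cond pi _) letter_condN // h.
Qed.

Lemma signed_atom_perm pi v w : signed_atom zi pi (W_word v) ->
    atom_word (fold_invol zi pi) (W_word w) -> perm_eq (W_word v) (W_word w) ->
  w \in X.
Proof.
move=> [MM D _] A vw; apply/(W_atomP n0 w zV); exists pi; split=> // x.
by rewrite -(perm_mem vw); apply: D.
Qed.

(** The negated letters are the left endpoints of the blocks, and these determine a noncrossing
    matching. *)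
Lemma signed_atom_unique pi pi' v w :
    signed_atom zi pi (W_word v) -> signed_atom zi pi' (W_word w) ->
    perm_eq (W_word v) (W_word w) ->
  forall x, N x -> pi x = pi' x.
Proof.
move=> A A' vw; have [MM _ _] := A; have [MM' _ _] := A'.
apply: (@nc_matching_unique N n) => // [x /W_neg_pt_le|x Nx]; first by lia.
have [[p pE]|np] := pselect (exists p : pm n, pm_val p = x).
  have := mem_signed_atom p A; have := mem_signed_atom p A'.
  by rewrite (perm_mem vw) => ->; rewrite /letter_cond pE Nx.
have /andP [/eqP x0 _] := Nx; have [p pE] := pm_val_surj x0 (W_neg_pt_le Nx).
by case: np; exists p.
Qed.

Lemma W_lt_trans : transitive (@W_lt n).
Proof. by move=> v u w; apply: ltA_trans. Qed.

Lemma W_lt_irr : irreflexive (@W_lt n).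
Proof. by move=> v; apply: ltA_irr. Qed.

Lemma W_connect : {in X &, forall v w,
  connect (hasse (@W_lt n) X) v w = perm_eq (W_word v) (W_word w)}.
Proof.
move=> v w vX wX; apply/idP/idP.
  move=> /connectP [s]; elim: s v {vX} => [|u s IH] v /=; first by move=> _ ->.
  move=> /andP [vu /IH h] e; apply: perm_trans (h e).
  by case/and3P: vu => _ _ /orP [] /andP [] /ltA_perm // + _; rewrite perm_sym.
move=> vw; have /(W_atomP n0 v zV) [pi A] := vX; have /(W_atomP n0 w zV) [pi' A'] := wX.
pose f := fold_invol zi pi.
have Av : atom_word f (W_word v) by case: A.
have Aw : atom_word f (W_word w).
  have [_ _ Aw'] := A'; apply: eq_atom_word Aw' => x _; rewrite /f /fold_invol.
  by case: ifP => // Nx; rewrite (signed_atom_unique A A' vw Nx).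
(* A chain of moves runs through mere words; each is the one-line word of an element of [X], having
   the letters of [v] and satisfying the condition for the same [f]. *)
have key x y : atom_conn f x y -> atom_word f x -> perm_eq (W_word v) x ->
    forall V U, W_word V = x -> W_word U = y -> connect (hasse (@W_lt n) X) V U.
  elim=> {x y} [x y [xy xf yf]|x|x y c IH|x y t c1 IH1 c2 IH2] xf' vx V U Vx Uy.
  - apply: lt_connect; [exact: W_lt_trans|exact: W_lt_irr| | |].
    + by apply: (signed_atom_perm A); rewrite Vx.
    + by apply: (signed_atom_perm A); rewrite Uy // (perm_trans vx) // triA_perm.
    + by apply/asboolP; apply: t_step; rewrite Vx Uy.
  - have -> : V = U by apply: W_word_inj; rewrite Vx Uy.
    exact: connect0.
  - rewrite hasse_connect_sym; have [e p] := atom_conn_word c.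
    by apply: IH => //; [apply/e|apply: perm_trans vx _; rewrite perm_sym].
  - have [e p] := atom_conn_word c1; have vy := perm_trans vx p.
    have [Y Yy] : exists Y : W n, W_word Y = y by apply: (@W_word_perm v); rewrite perm_sym.
    apply: (@connect_trans _ _ Y); first exact: IH1.
    by apply: IH2 => //; apply/e.
exact: (key _ _ (atom_word_conn Av Aw vw)).
Qed.

Lemma signed_atom_exists pi : nc_matching N pi ->
  exists2 v, v \in X & signed_atom zi pi (W_word v).
Proof.
move=> MM; have [M NC] := MM.
(* For each absolute value, the sign prescribed by [letter_cond]; any word for [fold_invol zi pi] on
   these letters will do. *)
pose sg (i : 'I_n) : pm n :=
  if letter_cond pi (pm_val (false, i)) then (false, i) else (true, i).
pose L := [seq pm_val (sg i) | i : 'I_n].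
have sgI : injective (fun i => pm_val (sg i)).
  by move=> i j /(@pm_val_inj n); rewrite /sg; do 2!case: ifP => _; case.
have LP p : (pm_val p \in L) = letter_cond pi (pm_val p).
  have oppE i : pm_val (true, i) = (- pm_val (false, i : 'I_n))%R by rewrite -pm_valN.
  have nz i : pm_val (false, i : 'I_n) <> 0%R by case: (pm_val_range (false, i)).
  have sgP i : letter_cond pi (pm_val (sg i)).
    by rewrite /sg; case: ifP => // h; rewrite oppE letter_condN ?h.
  apply/(mem_ord_word (fun i => pm_val (sg i)))/idP => [[i ->] //|h].
  exists p.2; congr pm_val; rewrite /sg; case: p h => [[] i] h /=; last by rewrite h.
  by move: h; rewrite oppE letter_condN // => /negPf ->.
have Lval x : x \in L -> exists p : pm n, pm_val p = x.
  by move=> /(mem_ord_word (fun i => pm_val (sg i))) [i ->]; exists (sg i).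
pose f := fold_invol zi pi.
have fL : invol_on (fun x => x \in L) f.
  move=> x xL; have [p pE] := Lval _ xL; have [p0 pn] := pm_val_range p.
  move: xL; rewrite -pE LP pE in p0 pn *; rewrite /letter_cond /f /fold_invol.
  case Nx: (N x) => h.
    have [Npx pp px po] := M _ Nx; have [_ _ _ ppo] := M _ Npx.
    have Nmp : N (- pi x)%R by rewrite neg_ptN.
    have /andP [/eqP m0 _] := Nmp; have [q qE] := pm_val_surj m0 (W_neg_pt_le Nmp).
    split; last by rewrite Nmp ppo pp opprK.
    by rewrite -qE LP qE /letter_cond Nmp ppo pp; lia.
  have Nz : N (zi x) = false.
    apply/negP => /andP [/eqP z0 /eqP zz]; move: Nx; rewrite /neg_pt.
    by rewrite W_int_inv in zz; rewrite [zi x](_ : _ = - x)%R ?eqxx ?andbT; lia.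
  rewrite Nz W_int_inv; split=> //; rewrite -pE W_intE LP -W_intE pE.
  by rewrite /letter_cond Nz W_int_inv; lia.
have [v' pv A] := atom_word_exists (uniq_ord_word sgI) fL.
have mv := perm_mem pv.
have [v vE] : exists v : W n, W_word v = v'.
  apply: W_word_surj.
  - by rewrite (perm_uniq pv); apply: uniq_ord_word.
  - by rewrite (perm_size pv); apply: size_ord_word.
  - move=> x; rewrite !mv => xL; have [p pE] := Lval _ xL; have [p0 pn] := pm_val_range p.
    rewrite -pE; split=> //; rewrite -pm_valN LP pm_valN letter_condN // -LP pE.
    by rewrite xL.
have Av : signed_atom zi pi (W_word v).
  split=> //; last by rewrite vE.
  move=> x; rewrite vE mv => xL; have [p pE] := Lval _ xL.
  by move: xL; rewrite -pE LP.
by exists v => //; apply/(W_atomP n0 v zV); exists pi.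
Qed.

End SignedWords.

(** * From involutions on integers to sets of blocks *)

Section Matchings.
Variable n : nat.
Hypothesis n0 : 0 < n.
Variable z : W n.
Hypothesis zV : z^-1%g = z.
Implicit Types (p q : pm n) (pi : int -> int) (M : {set {set pm n}}).

Notation zi := (W_int z).
Notation N := (neg_pt zi).

Definition Neg_pm : {set pm n} := Neg z :|: [set pm_opp x | x in Neg z].

Lemma mem_NegE p : (p \in Neg z) = ~~ p.1 && N (pm_val p).
Proof.
rewrite inE /neg_pt W_intE -pm_valN (inj_eq (@pm_val_inj n)).
by case: (pm_val_range p) => /eqP ->.
Qed.

Lemma mem_Neg_pm p : (p \in Neg_pm) = N (pm_val p).
Proof.
have Np : N (pm_val (pm_opp p)) = N (pm_val p) by rewrite pm_valN neg_ptN.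
rewrite inE mem_NegE; case h : (N (pm_val p)); last first.
  rewrite andbF /=; apply/imsetP => -[q]; rewrite mem_NegE => /andP [_ qN] e.
  by move: h; rewrite -Np e pm_oppK qN.
rewrite andbT; case p1 : p.1 => //=; apply/imsetP.
by exists (pm_opp p); rewrite ?pm_oppK // mem_NegE Np h /= p1.
Qed.

Lemma neg_pt_val x : N x -> exists p, pm_val p = x.
Proof.
by move=> Nx; have /andP [/eqP x0 _] := Nx; have := pm_val_surj x0 (W_neg_pt_le n0 Nx).
Qed.

Definition partner pi p : pm n :=
  if [pick q | pm_val q == pi (pm_val p)] is Some q then q else p.

Definition matching_of pi : {set {set pm n}} := [set [set p; partner pi p] | p in Neg_pm].

Section OfInvolution.
Variable pi : int -> int.
Hypothesis MM : nc_matching N pi.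

Lemma partner_val p : p \in Neg_pm -> pm_val (partner pi p) = pi (pm_val p).
Proof.
rewrite mem_Neg_pm => Np; have [Npp _ _ _] := MM.1 _ Np.
have [q qE] := neg_pt_val Npp; rewrite /partner; case: pickP => [r /eqP //|/(_ q)].
by rewrite qE eqxx.
Qed.

Lemma partner_props p : p \in Neg_pm ->
  [/\ partner pi p \in Neg_pm, partner pi (partner pi p) = p, partner pi p != p &
      partner pi (pm_opp p) = pm_opp (partner pi p)].
Proof.
move=> pN; have Np := pN; rewrite mem_Neg_pm in Np.
have [Npp pp px po] := MM.1 _ Np.
have ppN : partner pi p \in Neg_pm by rewrite mem_Neg_pm partner_val.
have opN : pm_opp p \in Neg_pm by rewrite mem_Neg_pm pm_valN neg_ptN.
split=> //.
- by apply: (@pm_val_inj n); rewrite !partner_val.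
- by rewrite -(inj_eq (@pm_val_inj n)) partner_val //; apply/eqP.
- by apply: (@pm_val_inj n); rewrite partner_val // !pm_valN partner_val.
Qed.

Lemma matching_of_block i k : [set i; k] \in matching_of pi -> i != k ->
  i \in Neg_pm /\ k = partner pi i.
Proof.
move=> /imsetP [p pN e] ik; have [qN qq qp _] := partner_props pN.
have /set2P iP : i \in [set p; partner pi p] by rewrite -e set21.
have /set2P kP : k \in [set p; partner pi p] by rewrite -e set22.
case: iP ik => ->; case: kP => ->; rewrite ?eqxx ?qq // => _.
Qed.

Lemma matching_ofP : matching_of pi \in ncsp_matchings Neg_pm.
Proof.
have [M NC] := MM; have blockN p : p \in Neg_pm -> [set p; partner pi p] \in matching_of pi.
  by move=> pN; apply: imset_f.
rewrite inE; apply/and4P; split.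
- apply/andP; split.
    apply/forall_inP => B /imsetP [p pN ->]; have [qN _ qp _] := partner_props pN.
    rewrite cards2 (eq_sym p) qp andbT.
    by apply/subsetP => r /set2P [] ->.
  apply/trivIsetP => B C /imsetP [p pN ->] /imsetP [q qN ->]; apply: contraR.
  have [_ pp _ _] := partner_props pN; have [_ qq _ _] := partner_props qN.
  move/pred0Pn => [r /= /andP [/set2P [] -> /set2P [] e]];
    rewrite -?e ?pp ?qq //.
  + by rewrite e qq setUC.
  + by rewrite setUC e.
  + by rewrite -pp e qq.
- apply/eqP/setP => r; apply/bigcupP/idP => [[_ /imsetP [p pN ->]]|rN].
    by have [qN _ _ _] := partner_props pN; move=> /set2P [] ->.
  by exists [set r; partner pi r]; rewrite ?blockN // set21.
- apply/forall_inP => _ /imsetP [p pN ->]; have [_ _ _ po] := partner_props pN.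
  rewrite imsetU1 imset_set1 -po blockN //.
  by move: pN; rewrite !mem_Neg_pm pm_valN neg_ptN.
- apply/negP => /existsP [i /existsP [j /existsP [k /existsP [l]]]].
  move=> /and5P [ik jl ij jk kl].
  have [|iN kE] := matching_of_block ik; first by apply/eqP => e; rewrite -e in jk; lia.
  have [|jN lE] := matching_of_block jl; first by apply/eqP => e; rewrite -e in kl; lia.
  rewrite kE lE !partner_val // in jk kl.
  by apply: (NC (pm_val i) (pm_val j)); rewrite -?mem_Neg_pm.
Qed.

End OfInvolution.

Lemma matching_of_eq pi pi' : nc_matching N pi -> nc_matching N pi' ->
  matching_of pi = matching_of pi' <-> (forall x, N x -> pi x = pi' x).
Proof.
move=> MM MM'; split=> [e x Nx|e].
  have [p pE] := neg_pt_val Nx; have pN : p \in Neg_pm by rewrite mem_Neg_pm pE.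
  have [_ _ qp _] := partner_props MM pN.
  have : [set p; partner pi p] \in matching_of pi' by rewrite -e; apply: imset_f.
  move=> /(matching_of_block MM'); rewrite eq_sym => /(_ qp) [_ /(congr1 (@pm_val n))].
  by rewrite !partner_val // pE.
apply: eq_in_imset => p pN; congr [set p; _]; apply: (@pm_val_inj n).
by rewrite !partner_val // e // -mem_Neg_pm.
Qed.

Lemma matching_of_surj M : M \in ncsp_matchings Neg_pm ->
  exists2 pi, nc_matching N pi & matching_of pi = M.
Proof.
rewrite inE => /and4P [/andP [/forall_inP blk triv] /eqP cov /forall_inP sym nc].
have same i j k : [set i; j] \in M -> [set i; k] \in M -> i != j -> j = k.
  move=> ij ik nij; have := trivIsetP triv _ _ ij ik.
  have [/setP/(_ j)|_ /(_ isT)/pred0P/(_ i)] := eqVneq [set i; j] [set i; k].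
    by rewrite !inE eqxx orbT eq_sym (negPf nij) /= => /esym/eqP.
  by rewrite /= !inE eqxx.
(* The other element of the block of [p]; the default [p] occurs only outside the matched set. *)
pose g p := odflt p [pick q | (q != p) && ([set p; q] \in M)].
have gP p : p \in Neg_pm -> g p != p /\ [set p; g p] \in M.
  rewrite -cov => /bigcupP [B BM pB]; have /andP [_ /cards2P [a [b [ab BE]]]] := blk _ BM.
  have [q qp qM] : exists2 q, q != p & [set p; q] \in M.
    move: pB BM; rewrite BE !inE => /orP [] /eqP ->; first by exists b; rewrite // eq_sym.
    by exists a; rewrite // setUC.
  by rewrite /g; case: pickP => [r /andP [-> ->]|/(_ q)]; rewrite ?qp ?qM.
have gU p q : [set p; q] \in M -> q != p -> g p = q.
  move=> pqM qp; have pN : p \in Neg_pm.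
    by rewrite -cov; apply/bigcupP; exists [set p; q]; rewrite ?set21.
  have [gp gM] := gP _ pN; by apply: (same p) => //; rewrite eq_sym.
have gN p : p \in Neg_pm -> [/\ g p \in Neg_pm, g (g p) = p & g (pm_opp p) = pm_opp (g p)].
  move=> pN; have [gp gM] := gP _ pN; split.
  - by rewrite -cov; apply/bigcupP; exists [set p; g p]; rewrite ?set22.
  - by apply: gU; rewrite 1?setUC // eq_sym.
  - apply: gU; last by rewrite (inj_eq (@pm_opp_inj n)).
    by have := sym _ gM; rewrite imsetU1 imset_set1.
pose pi := int_ext (@pm_val n) g.
have piE p : pi (pm_val p) = pm_val (g p) by apply: int_extE; apply: pm_val_inj.
have MM : nc_matching N pi.
  split=> [x Nx|x y Nx Ny].
    have [p pE] := neg_pt_val Nx; have pN : p \in Neg_pm by rewrite mem_Neg_pm pE.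
    have [ggN gg go] := gN _ pN; have [gp _] := gP _ pN.
    rewrite -pE -pm_valN !piE gg go pm_valN; split=> //; first by rewrite -mem_Neg_pm.
    by move/(@pm_val_inj n)/eqP; rewrite (negPf gp).
  have [p pE] := neg_pt_val Nx; have pN : p \in Neg_pm by rewrite mem_Neg_pm pE.
  have [q qE] := neg_pt_val Ny; have qN : q \in Neg_pm by rewrite mem_Neg_pm qE.
  rewrite -pE -qE !piE => pq qgp gpgq; move/negP: nc; apply.
  apply/existsP; exists p; apply/existsP; exists q; apply/existsP; exists (g p).
  apply/existsP; exists (g q); have [_ ->] := gP _ pN; have [_ ->] := gP _ qN.
  by rewrite pq qgp gpgq.
have partE p : p \in Neg_pm -> partner pi p = g p.
  by move=> pN; apply: (@pm_val_inj n); rewrite partner_val.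
exists pi => //; apply/setP => B; apply/imsetP/idP => [[p pN ->]|BM].
  by rewrite partE //; have [] := gP _ pN.
have /andP [_ /cards2P [a [b [ab BE]]]] := blk _ BM.
have aN : a \in Neg_pm by rewrite -cov; apply/bigcupP; exists B; rewrite // BE set21.
by exists a; rewrite // partE // (gU a b) -?BE // eq_sym.
Qed.

Notation X := (atoms_inv (W_gens n) z).

(** The chosen [pi] is unique on negated points, and [matching_of] sees no others. *)
Definition signed_matching (v : W n) : {set {set pm n}} :=
  if pselect (exists pi, signed_atom zi pi (W_word v)) is left h
  then matching_of (sval (cid h)) else set0.

Lemma signed_matchingP v : v \in X ->
  exists pi, signed_atom zi pi (W_word v) /\ signed_matching v = matching_of pi.
Proof.
move=> /(W_atomP n0 v zV) h; rewrite /signed_matching; case: pselect => // h'.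
by exists (sval (cid h')); split=> //; exact: (svalP (cid h')).
Qed.

Lemma signed_matching_connect : {in X &, forall v w,
  connect (hasse (@W_lt n) X) v w = (signed_matching v == signed_matching w)}.
Proof.
move=> v w vX wX; rewrite W_connect //.
have [pi [A ->]] := signed_matchingP vX; have [pi' [A' ->]] := signed_matchingP wX.
have [MM _ _] := A; have [MM' _ _] := A'.
apply/idP/eqP => [vw|/(matching_of_eq MM MM') e].
  by apply/(matching_of_eq MM MM'); apply: (signed_atom_unique n0 A A' vw).
apply: uniq_perm; rewrite ?W_word_uniq // => x.
have [[p <-]|np] := pselect (exists p : pm n, pm_val p = x).
  rewrite (mem_signed_atom n0 p A) (mem_signed_atom n0 p A') /letter_cond.
  by case: ifP => // Np; rewrite e.
by apply/idP/idP => /W_word_val.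
Qed.

Lemma signed_matching_image : signed_matching @: X = ncsp_matchings Neg_pm.
Proof.
apply/setP => M; apply/imsetP/idP => [[v vX ->]|/matching_of_surj [pi MM <-]].
  by have [pi [[MM _ _] ->]] := signed_matchingP vX; apply: matching_ofP.
have [v vX A] := signed_atom_exists n0 zV MM; exists v => //.
have [pi' [A' ->]] := signed_matchingP vX; have [MM' _ _] := A'.
by apply/matching_of_eq => //; apply: (signed_atom_unique n0 A A').
Qed.

End Matchings.

(** * Counting the components by signs *)

Section Counting.
Variable n : nat.
Hypothesis n0 : 0 < n.
Variable z : W n.
Hypothesis zV : z^-1%g = z.
Implicit Types (p q : pm n) (pi : int -> int).

Notation zi := (W_int z).
Notation N := (neg_pt zi).
Notation X := (atoms_inv (W_gens n) z).

Let s : seq int := sort <=%R [seq pm_val p | p in Neg z].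

Let s_uniq : uniq s.
Proof. by rewrite sort_uniq map_inj_uniq ?enum_uniq //; apply: pm_val_inj. Qed.

Let s_sorted : sorted <%R s.
Proof. by rewrite lt_sorted_uniq_le s_uniq sort_sorted //; apply: le_total. Qed.

Let s_size : size s = #|Neg z|.
Proof. by rewrite size_sort size_map cardE. Qed.

Let mem_s x : reflect (exists2 p, p \in Neg z & x = pm_val p) (x \in s).
Proof.
rewrite mem_sort; apply: (iffP imageP) => -[p pN ->]; by exists p.
Qed.

Let s_pos : {in s, forall x, (0 < x)%R}.
Proof.
by move=> x /mem_s [p + ->]; rewrite mem_NegE // /pm_val => /andP [/negPf ->].
Qed.

Let s_N : pm_mem s =1 N.
Proof.
move=> x; apply/orP/idP => [[/mem_s [p pN xE]|/mem_s [p pN xE]]|Nx].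
- by move: pN; rewrite mem_NegE // -xE => /andP [].
- by move: pN; rewrite mem_NegE // -xE neg_ptN => /andP [].
have [p pE] := neg_pt_val n0 Nx; case p1 : p.1; [right|left]; apply/mem_s.
  by exists (pm_opp p); rewrite ?pm_valN ?pE // mem_NegE // pm_valN pE neg_ptN Nx /= p1.
by exists p; rewrite // mem_NegE // pE Nx p1.
Qed.

Definition sign_set (v : W n) : {set pm n} := [set p in Neg z | pm_val p \in W_word v].

Let set_of (b : seq bool) : {set pm n} :=
  [set p in Neg z | nth false b (index (pm_val p) s)].

(** Letters outside the negated points are forced by [z], and a negative point is a letter exactly
    when its opposite is not; so the signs on [Neg z] fix the letter set. *)
Lemma sign_set_connect : {in X &, forall v w,
  connect (hasse (@W_lt n) X) v w = (sign_set v == sign_set w)}.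
Proof.
move=> v w vX wX; rewrite W_connect //; apply/idP/eqP => [vw|e].
  by apply/setP => p; rewrite !inE (perm_mem vw).
have /(W_atomP n0 v zV) [pi A] := vX; have /(W_atomP n0 w zV) [pi' A'] := wX.
have eN p : p \in Neg z -> (pm_val p \in W_word v) = (pm_val p \in W_word w).
  by move=> pN; move/setP/(_ p): e; rewrite !inE in pN *; rewrite pN.
apply: uniq_perm; rewrite ?W_word_uniq // => x.
have [[p <-]|np] := pselect (exists p, pm_val p = x); last first.
  by apply/idP/idP => /W_word_val.
case Np : (N (pm_val p)); last first.
  by rewrite (mem_signed_atom n0 p A) (mem_signed_atom n0 p A') /letter_cond Np.
case p1 : p.1; last by apply: eN; rewrite mem_NegE // Np p1.
rewrite -[p](@pm_oppK n) pm_valN !mem_W_wordN; congr negb.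
by apply: eN; rewrite mem_NegE // pm_valN neg_ptN Np /= p1.
Qed.

(** Listing the elements of [Neg z] increasingly turns the sign sets into the ballot sequences, by
    the two lemmas relating these to noncrossing matchings. *)
Lemma card_sign_set : #|sign_set @: X| = 'C(#|Neg z|, #|Neg z|./2).
Proof.
pose l := [seq set_of b | b <- sign_seqs (size s) & ballot b].
have ul : uniq l.
  rewrite map_inj_in_uniq ?filter_uniq ?sign_seqs_uniq // => b c.
  rewrite !mem_filter !mem_sign_seqs => /andP [_ /eqP bs] /andP [_ /eqP cs] e.
  apply: (@eq_from_nth _ false); first by rewrite bs cs.
  move=> k; rewrite bs => ks; have /mem_s [p pN pE] := mem_nth 0%R ks.
  move/setP/(_ p): e; rewrite !inE; have := pN; rewrite inE => ->.
  by rewrite /= -pE index_uniq.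
rewrite -s_size -count_ballot_all -size_filter -(size_map set_of) -/l.
rewrite -(card_uniqP ul); apply: eq_card => A; apply/imsetP/mapP.
  case=> v vX ->; have /(W_atomP n0 v zV) [pi Av] := vX; have [MM _ _] := Av.
  pose g x := x \in W_word v.
  exists (map g s).
    rewrite mem_filter mem_sign_seqs size_map eqxx andbT.
    apply: (@nc_matching_ballot s pi) => //.
      by apply: eq_nc_matching MM => x; rewrite s_N.
    move=> x /mem_s [p pN ->]; rewrite /g (mem_signed_atom n0 p Av) /letter_cond.
    by move: pN; rewrite mem_NegE // => /andP [_ ->].
  apply/setP => p; rewrite !inE; apply: andb_id2l => pN.
  have ps : pm_val p \in s by apply/mem_s; exists p; rewrite // inE.
  by rewrite (nth_map 0%R) ?index_mem // nth_index.
case=> b; rewrite mem_filter mem_sign_seqs => /andP [bb /eqP bs] ->.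
pose g x := nth false b (index x s).
have gb : map g s = b.
  apply: (@eq_from_nth _ false); rewrite size_map // => k ks.
  by rewrite (nth_map 0%R) // /g index_uniq.
have [|pi [MM op]] := @ballot_nc_matching s g s_sorted s_pos; first by rewrite gb.
have MN := eq_nc_matching s_N MM.
have [v vX Av] := signed_atom_exists n0 zV MN; exists v => //.
apply/setP => p; rewrite !inE; apply: andb_id2l => pN.
have pN' : p \in Neg z by rewrite inE.
have ps : pm_val p \in s by apply/mem_s; exists p.
rewrite (mem_signed_atom n0 p Av) /letter_cond.
by move: pN'; rewrite mem_NegE // => /andP [_ ->]; rewrite op.
Qed.

End Counting.

Lemma S_word_inj n : injective (@S_word n).
Proof.
move=> u v e; apply/permP => i; apply: (@ord_val_inj n).
by have /eq_in_map := e; apply; rewrite mem_enum.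
Qed.

(** * Standardization of a component *)

Section Standardization.
Variable n : nat.
Hypothesis n0 : 0 < n.
Variable z : W n.
Hypothesis zV : z^-1%g = z.
Notation zi := (W_int z).
Notation X := (atoms_inv (W_gens n) z).

Variables (x0 : W n) (pi : int -> int).
Hypothesis A0 : signed_atom zi pi (W_word x0).

Let L := W_word x0.
Let f := fold_invol zi pi.
Let s : seq int := sort <=%R L.
Let rank (x : int) : int := Posz (index x s).+1.
Let unrank (y : int) : int := nth 0%R s `|y|.-1.

Let s_uniq : uniq s. Proof. by rewrite sort_uniq W_word_uniq. Qed.
Let s_size : size s = n. Proof. by rewrite size_sort W_word_size. Qed.
Let mem_s x : (x \in s) = (x \in L). Proof. exact: mem_sort. Qed.

Let rank_mono : {in L &, {mono rank : x y / (x < y)%R}}.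
Proof.
have srt : sorted <%R s by rewrite lt_sorted_uniq_le s_uniq sort_sorted //; apply: le_total.
have homo x y : x \in L -> y \in L -> (rank x < rank y)%R -> (x < y)%R.
  by rewrite -!mem_s /rank => xs ys; apply: (sorted_ltn_index lt_trans srt).
move=> x y xL yL; apply/idP/idP; first exact: homo.
case: (ltgtP (rank x) (rank y)) => // [lt|e]; first by have := homo _ _ yL xL lt; lia.
have : x = y by apply: (@index_inj _ 0%R s); rewrite ?mem_s //; case: e.
by move=> ->; rewrite ltxx.
Qed.

Let rank_range x : x \in L -> (0 < rank x <= Posz n)%R.
Proof. by rewrite -mem_s -index_mem s_size /rank; lia. Qed.

Let rankK x : x \in L -> unrank (rank x) = x.
Proof. by rewrite -mem_s => xs; rewrite /unrank /rank /= nth_index. Qed.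

Let unrankP y : (0 < y <= Posz n)%R -> unrank y \in L /\ rank (unrank y) = y.
Proof.
move=> yP; have ys : `|y|.-1 < size s by rewrite s_size; lia.
by rewrite -mem_s mem_nth // /rank /unrank index_uniq //; split=> //; lia.
Qed.

Let fL : invol_on (fun x => x \in L) f. Proof. by case: A0 => _ _ []. Qed.

Lemma standard_involution : exists zeta : 'S_n,
  zeta^-1%g = zeta /\ {in L, forall x, S_int zeta (rank x) = rank (f x)}.
Proof.
have ordP (i : 'I_n) : (0 < ord_val i <= Posz n)%R.
  by have := ltn_ord i; rewrite /ord_val; lia.
have /choice [g gP] : forall i : 'I_n, exists j : 'I_n,
    ord_val j = rank (f (unrank (ord_val i))).
  move=> i; have [uL _] := unrankP (ordP i); have [fuL _] := fL uL.
  by have /andP [r0 rn] := rank_range fuL; have [j] := ord_val_surj r0 rn; exists j.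
have gK : involutive g.
  move=> i; apply: (@ord_val_inj n); rewrite !gP.
  have [uL ru] := unrankP (ordP i); have [fuL ffu] := fL uL.
  by rewrite rankK // ffu.
exists (perm (inv_inj gK)); split.
  apply/permP => i; apply: (@perm_inj _ (perm (inv_inj gK))).
  by rewrite permKV !permE gK.
move=> x xL; have /andP [r0 rn] := rank_range xL; have [i iE] := ord_val_surj r0 rn.
by rewrite -iE /S_int int_extE ?permE ?gP ?iE ?rankK //; apply: ord_val_inj.
Qed.

Lemma component_standardization (C : {set W n}) :
    (forall v, v \in C = (v \in X) && perm_eq L (W_word v)) ->
  exists zeta : 'S_n, zeta = zeta^-1%g /\
    poset_iso (@W_lt n) C (@S_lt n) (atoms_inv (S_gens n) zeta).
Proof.
move=> CP; have [zeta [zetaV zetaE]] := standard_involution; exists zeta; split=> //.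
(* The default is never taken on the component, where [map rank (W_word v)] lists the values from 1
   to [n]. *)
pose phi (v : W n) : 'S_n := odflt 1%g [pick u | S_word u == map rank (W_word v)].
have phiP (v : W n) : perm_eq L (W_word v) -> S_word (phi v) = map rank (W_word v).
  move=> Lv; have mL := perm_mem Lv; rewrite /phi; case: pickP => [u /eqP //|no].
  have [|||u uE] := @S_word_surj n (map rank (W_word v)).
  - rewrite map_inj_in_uniq ?W_word_uniq // => x y; rewrite -!mL => xL yL e.
    by rewrite -(rankK xL) e rankK.
  - by rewrite size_map W_word_size.
  - by move=> _ /mapP [x + ->]; rewrite -mL; apply: rank_range.
  by have := no u; rewrite uE eqxx.
have rank_map (v : W n) : perm_eq L (W_word v) -> map unrank (map rank (W_word v)) = W_word v.
  move=> Lv; rewrite -map_comp -[RHS]map_id; apply/eq_in_map => x.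
  by rewrite -(perm_mem Lv) /=; apply: rankK.
have atomP (v : W n) : perm_eq L (W_word v) ->
    atom_word f (W_word v) <-> atom_word (S_int zeta) (map rank (W_word v)).
  move=> Lv; have mL := perm_mem Lv; apply: atom_word_map.
  - by move=> x y; rewrite -!mL; apply: rank_mono.
  - by move=> x; rewrite -!mL => /fL [].
  - by move=> x; rewrite -mL; apply: zetaE.
have CL v : v \in C -> perm_eq L (W_word v) by rewrite CP => /andP [].
exists phi; split.
- move=> v w vC wC e; apply: (@W_word_inj n).
  by rewrite -(rank_map v) ?CL // -(rank_map w) ?CL // -!phiP ?CL // e.
- apply/setP => u; apply/imsetP/idP => [[v vC ->]|].
    have Lv := CL _ vC; move: vC; rewrite CP => /andP [vX _].
    apply/(S_atomP _ zetaV); rewrite phiP //; apply/(atomP _ Lv).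
    have /(W_atomP n0 v zV) [pi' A'] := vX; have [_ _ Av] := A'.
    apply: eq_atom_word Av => x _; rewrite /f /fold_invol.
    by case: ifP => // Nx; rewrite (signed_atom_unique n0 A0 A' Lv Nx).
  move=> /(S_atomP _ zetaV) Au; pose v' := map unrank (S_word u).
  have uP x : x \in S_word u -> unrank x \in L /\ rank (unrank x) = x.
    by rewrite mem_S_word; apply: unrankP.
  have v'E : map rank v' = S_word u.
    rewrite -map_comp -[RHS]map_id; apply/eq_in_map => x xu /=.
    by have [_ ->] := uP _ xu.
  have v'u : uniq v' by apply: (@map_uniq _ _ rank); rewrite v'E S_word_uniq.
  have v'L : perm_eq v' L.
    have sub : {subset v' <= L} by move=> _ /mapP [x xu ->]; have [] := uP _ xu.
    apply: uniq_perm => //; first exact: W_word_uniq.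
    have sz : size L <= size v'.
      by rewrite W_word_size size_map (size_ord_word (fun i => ord_val (u i))).
    by have [_] := uniq_min_size v'u sub sz.
  have [V VE] := W_word_perm v'L; have LV : perm_eq L (W_word V) by rewrite VE perm_sym.
  have AV : atom_word f (W_word V) by apply/(atomP _ LV); rewrite VE v'E.
  exists V; first by rewrite CP LV andbT; apply: (signed_atom_perm n0 zV A0 AV LV).
  by apply: S_word_inj; rewrite phiP // VE v'E.
- move=> v w vC wC; have Lv := CL _ vC; have Lw := CL _ wC.
  rewrite /S_lt /W_lt !phiP //; apply/idP/idP => lt.
    (* The order is also reflected, because [unrank] is increasing on the ranks. *)
    rewrite -(rank_map v) // -(rank_map w) //; apply: ltA_map lt.
    move=> _ _ /mapP [x + ->] /mapP [y + ->]; rewrite -!(perm_mem Lv) => xL yL.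
    by rewrite !rankK // rank_mono.
  apply: ltA_map lt => x y; rewrite -!(perm_mem Lv) => xL yL.
  by rewrite rank_mono.
Qed.

End Standardization.

Theorem theorem1p1 (n : nat) (hn : (1 <= n)%N) (z : W n) (hz : z = z^-1%g) :
  [/\ #|components (@W_lt n) (atoms_inv (W_gens n) z)|
        = 'C(#|Neg z|, #|Neg z|./2),
      set_bijection (components (@W_lt n) (atoms_inv (W_gens n) z))
        (ncsp_matchings (Neg z :|: [set pm_opp x | x in Neg z])) &
      forall C : {set W n},
        C \in components (@W_lt n) (atoms_inv (W_gens n) z) ->
        exists zeta : 'S_n,
          zeta = zeta^-1%g /\
          poset_iso (@W_lt n) C (@S_lt n) (atoms_inv (S_gens n) zeta)].
Proof.
have zV := esym hz; split.
- have [f [fI fE]] := components_image 1%g (sign_set_connect hn zV).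
  by rewrite -(card_sign_set hn zV) -fE card_in_imset.
- rewrite -[_ :|: _]/(Neg_pm z) -(signed_matching_image hn zV).
  exact: components_image 1%g (signed_matching_connect hn zV).
- move=> C CX; have [x0 x0C] := component_ex CX.
  have [CE x0X] := componentsE (sign_set_connect hn zV) CX x0C.
  have /(W_atomP hn x0 zV) [pi A0] := x0X.
  apply: (component_standardization hn zV A0) => v; rewrite CE inE.
  case vX: (v \in _) => //=.
  by rewrite -(sign_set_connect hn zV) // W_connect.
Qed.
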